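(* Let $p\in(1,\infty)$ be a constant and let $(v_n)_{n\in\mathbb N}$ be a family of smooth conformal factors on $\mathbb R^2$. Assume that the corresponding volumes are bounded, i.e. $$\limsup_{n\to\infty}\int_{\mathbb R^2}\exp(2v_n)\,dx=:c_\mu<\infty,$$ and that the Gauß curvature is $L^p$-locally converging to one, i.e. $$\lim_{n\to\infty}\int_{K'}|K_n-1|^p\,d\mu_n=0\qquad\forall\,K'\subseteq\mathbb R^2\text{ compact},$$ where $\mu_n=\exp(2v_n)\,dx$ and $K_n=-\exp(-2v_n)\,\Delta v_n$ denote the measure and the Gauß curvature with respect to $\exp(2v_n)$ times the Euclidean metric, respectively. Then each point $x\in\mathbb R^2$ with $\varrho(x)>0$ satisfies $\varrho(x)\ge4\pi$, where $$\varrho(x):=\inf_{R>0}\liminf_{n\to\infty}\int_{B_R(x)}\exp(2v_n)\,dx.$$ In particular, there are not more than $\frac{c_\mu}{4\pi}$ many points $x\in\mathbb R^2$ with $\varrho(x)>0$.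
   Context: $\Delta$ is the Euclidean Laplace operator on $\mathbb R^2$ and $B_R(x)$ the Euclidean ball. A smooth conformal factor is a smooth function $v_n:\mathbb R^2\to\mathbb R$, with associated metric $\exp(2v_n)$ times the Euclidean metric. *)

(* Defs.v *)
From HB Require Import structures.
From mathcomp Require Import all_boot all_order all_algebra.
From mathcomp Require Import all_classical all_reals all_analysis.
From mathcomp Require Import measurable_realfun.

Set Implicit Arguments.
Unset Strict Implicit.
Unset Printing Implicit Defensive.

Import Order.TTheory GRing.Theory Num.Theory.
Import numFieldNormedType.Exports.

Local Open Scope classical_set_scope.
Local Open Scope ring_scope.

(* The plane is R * R. Its canonical norm is the sup norm, which gives the
   right topology (continuity, compactness, directional derivatives), but its
   library balls are squares, hence the explicit Euclidean ball. *)
Definition euclidean_ball {R : realType} (x : R * R) (r : R) : set (R * R) :=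
  [set y | Num.sqrt ((y.1 - x.1) ^+ 2 + (y.2 - x.2) ^+ 2) < r].

Definition e1 {R : realType} : R * R := (1, 0).
Definition e2 {R : realType} : R * R := (0, 1).

Fixpoint Ck {R : realType} (k : nat) (f : R * R -> R) : Prop :=
  continuous f /\
  match k with
  | 0%N => True
  | k'.+1 =>
      [/\ forall x, derivable f x e1, forall x, derivable f x e2,
          Ck k' ('D_e1 f) & Ck k' ('D_e2 f)]
  end.

Definition smooth {R : realType} (f : R * R -> R) : Prop := forall k, Ck k f.

Definition laplacian {R : realType} (f : R * R -> R) (x : R * R) : R :=
  'D_e1 ('D_e1 f) x + 'D_e2 ('D_e2 f) x.

Record conformal_factor (R : realType) := ConformalFactor {
  cf_fun :> R * R -> R;
  cf_smooth : smooth cf_fun }.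

(* measurableTypeR R is R with its Borel sigma-algebra, the type on which the
   library defines lebesgue_measure. *)
Definition conformal_measure {R : realType} (v : conformal_factor R)
    (A : set (measurableTypeR R * measurableTypeR R)) : \bar R :=
  (\int[@lebesgue_measure R \x @lebesgue_measure R]_(x in A) (expR (2 * v x))%:E)%E.

Section conformal_measure_is_measure.
Context {R : realType}.

Let rbox (i : (rat * rat) * (rat * rat)) : set (R * R) :=
  `]ratr i.1.1, ratr i.1.2[%classic `*` `]ratr i.2.1, ratr i.2.2[%classic.

Let rbox_measurable i :
  measurable (rbox i : set (measurableTypeR R * measurableTypeR R)).
Proof. by apply: measurableX; exact: measurable_itv. Qed.

Let ratr_itv (x e : R) : 0 < e -> exists q : rat * rat,
  [/\ x - e < ratr q.1, ratr q.1 < x, x < ratr q.2 & ratr q.2 < x + e].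
Proof.
move=> e0.
have [a] : exists q, ratr q \in `]x - e, x[.
  by apply: rat_in_itvoo; rewrite ltrBlDr ltrDl.
have [b] : exists q, ratr q \in `]x, x + e[.
  by apply: rat_in_itvoo; rewrite ltrDl.
by rewrite !in_itv/= => /andP[? ?] /andP[? ?]; exists (a, b).
Qed.

Lemma open_measurable2 (A : set (R * R)) : open A ->
  measurable (A : set (measurableTypeR R * measurableTypeR R)).
Proof.
move=> oA.
pose F (n : nat) : set (measurableTypeR R * measurableTypeR R) :=
  if unpickle n is Some i then (if `[< rbox i `<=` A >] then rbox i else set0)
  else set0.
have -> : A = \bigcup_n F n.
  apply/seteqP; split => [x Ax|x [n _]]; last first.
    rewrite /F; case: unpickle => // i; case: asboolP => // + ?; exact.
  have /nbhs_ballP[e /= e0 xeA] : nbhs x A by exact: open_nbhs_nbhs.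
  have [q [q1 q2 q3 q4]] := ratr_itv x.1 e0.
  have [r [r1 r2 r3 r4]] := ratr_itv x.2 e0.
  exists (pickle (q, r)); [exact: I|rewrite /F pickleK].
  have qrA : rbox (q, r) `<=` A.
    move=> y [/=]; rewrite !in_itv/= => /andP[y1 y2] /andP[y3 y4].
    apply: xeA; split; rewrite /= /ball/= distrC ltr_distl; apply/andP; split;
      by [exact: lt_trans y1 | exact: lt_trans q4
         |exact: lt_trans y3 | exact: lt_trans r4].
  rewrite (asboolT qrA); split; rewrite /= in_itv/=; exact/andP.
apply: bigcupT_measurable => n; rewrite /F; case: unpickle => // i.
by case: asboolP => _; [exact: rbox_measurable|exact: measurable0].
Qed.

Lemma continuous_measurable2 (f : R * R -> R) : continuous f ->
  measurable_fun setT (f : measurableTypeR R * measurableTypeR R -> R).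
Proof.
move=> /continuousP cf.
apply: (measurability _ (RGenOpens.measurableE R)) => _ [_ [a [b ->]] <-].
rewrite setTI; apply: open_measurable2; exact: cf.
Qed.

Lemma measurable_conformal_density (v : conformal_factor R) :
  measurable_fun setT (fun x : measurableTypeR R * measurableTypeR R =>
    (expR (2 * v x))%:E).
Proof.
apply/measurable_EFinP/measurableT_comp => //.
apply: measurable_funM => //.
by apply: continuous_measurable2; have [] := cf_smooth v 0.
Qed.

Variable v : conformal_factor R.

Let conformal_measure0 : conformal_measure v set0 = 0%E.
Proof. exact: integral_set0. Qed.

Let conformal_measure_ge0 A : (0 <= conformal_measure v A)%E.
Proof. by apply: integral_ge0 => x _; rewrite lee_fin expR_ge0. Qed.

Let conformal_measure_sigma_additive :
  semi_sigma_additive (conformal_measure v).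
Proof.
apply: semi_sigma_additive_nng_induced; first exact: measurable_conformal_density.
by move=> x; rewrite lee_fin expR_ge0.
Qed.

HB.instance Definition _ := isMeasure.Build _ _ _ (conformal_measure v)
  conformal_measure0 conformal_measure_ge0 conformal_measure_sigma_additive.

End conformal_measure_is_measure.

Definition gauss_curvature {R : realType} (v : conformal_factor R)
    (x : R * R) : R :=
  - expR (- (2 * v x)) * laplacian v x.

Definition limsup_volume {R : realType} (v : nat -> conformal_factor R) :
    \bar R :=
  limn_esup (fun n => conformal_measure (v n) setT).

Definition concentration {R : realType} (v : nat -> conformal_factor R)
    (x : R * R) : \bar R :=
  ereal_inf [set limn_einf (fun n => conformal_measure (v n) (euclidean_ball x r))
            | r in [set r : R | 0 < r]].

(* Main.v *)
From HB Require Import structures.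
Require Import Defs.
From mathcomp Require Import all_boot all_order all_algebra.
From mathcomp Require Import all_classical all_reals all_analysis.
From mathcomp Require Import finmap measurable_realfun ring lra.

(** The curvature hypothesis enters only through [K <= 1 + e + C |K - 1|^p], i.e. as
    an [L^1] bound. Write [A(t)] for the volume of [{v > t}] inside a small disc. With
    [m(t)] the Lebesgue measure of [{v > t}], the sharp isoperimetric inequality and
    the flux identity [int_{v = t} |grad v| = int_{v > t} K e^(2v)] give
    [4 pi m <= A (- m')], and [A' = e^(2t) m'] turns this into
    [4 pi e^(2t) m <= - A A' = - (A^2)' / 2]. Integrating in [t] yields
    [4 pi int (e^(2v) - e^(2t))^+ <= A(t)^2], so that if the volume of the disc is less
    than [4 pi] the excess [W(t) = int (e^(2v) - e^(2t))^+] decays geometrically in [t],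
    uniformly in [v], and the volume cannot concentrate at a point. A cutoff [zeta]
    localises the argument; the errors it creates are controlled by the volume of
    the annulus where [0 < zeta < 1], which is small when the discs shrink to a
    point of concentration. *)

Set Implicit Arguments.
Unset Strict Implicit.
Unset Printing Implicit Defensive.

Import Order.TTheory GRing.Theory Num.Theory.
Import numFieldNormedType.Exports.

Local Open Scope classical_set_scope.
Local Open Scope ring_scope.

(** * Integration over the plane *)

Section plane_integral.
Context {R : realType}.
Implicit Types (f g : R * R -> R) (z : R * R).

(** Level curves and the coarea formula are avoided. The indicator of [{v > t}] is replaced by a
    [C^2] function of [(v - t) / H], so that perimeter and flux become plane integrals, at the price
    of comparing the levels [t], [t + 3 H] and [t + 6 H]. The isoperimetric constant must be sharp,
    since any loss would spoil [4 pi]. It comes from evaluating the double integral of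
    [g(x) grad phi(y) . (x - y) / |x - y|^2] in both orders: in [y] the divergence theorem produces
    [2 pi g phi], in [x] a rearrangement bounds the result by [|grad phi|]. For a volume at most
    [La < 4 pi], the quotient [4 pi / La] leaves room for six factors [gam > 1]: they pay for the
    smoothing, the curvature and the cutoff, and one is left as contraction rate. The obstacle is
    uniformity: the first level, the number of iterations and the final radius may depend on the
    disc but not on [v], as they must serve infinitely many [v n]. The annulus is small only for
    those [n] at which the volume of the larger disc is close to the concentration; such [n] occur
    infinitely often, which is enough for a contradiction. *)

Definition plane_measure := (@lebesgue_measure R \x @lebesgue_measure R)%E.
Local Notation P := (measurableTypeR R * measurableTypeR R)%type.
HB.instance Definition _ := Measure.on plane_measure.

Definition plane_integral f : R := (\int[plane_measure]_z f z)%R.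
Local Notation I := plane_integral.

Definition box (r : R) : set (R * R) :=
  `[- r, r]%classic `*` `[- r, r]%classic.

Lemma boxE r z : box r z <-> `|z.1| <= r /\ `|z.2| <= r.
Proof. by rewrite /box/= !in_itv/= -!ler_norml; split => -[]. Qed.

Lemma box_measurable r : measurable (box r : set P).
Proof. by apply: measurableX; exact: measurable_itv. Qed.

Lemma box_measure r : 0 <= r -> plane_measure (box r : set P) = (4 * r ^+ 2)%:E.
Proof.
move=> r0; rewrite /plane_measure product_measure1E; try exact: measurable_itv.
have H : lebesgue_measure `[- r, r]%classic = (2 * r)%:E :> \bar R.
  rewrite lebesgue_measure_itv/= lte_fin.
  case: ltP => [_|h]; first by rewrite -EFinD; congr EFin; lra.
  by have -> : r = 0 by [lra]; rewrite mulr0.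
transitivity ((2 * r)%:E * (2 * r)%:E)%E; first by congr (_ * _)%E; exact: H.
by rewrite -EFinM; congr EFin; ring.
Qed.

Lemma plane_measure_sigma_finite : sigma_finite [set: P] plane_measure.
Proof.
exists (fun n => box n%:R : set P).
  apply/esym/seteqP; split => // z _; exists (Num.truncn (`|z.1| + `|z.2|)).+1 => //.
  apply/boxE; have := truncnS_gt (`|z.1| + `|z.2|).
  by have := normr_ge0 z.1; have := normr_ge0 z.2; split; lra.
by move=> n; split; [exact: box_measurable|rewrite box_measure ?ltry].
Qed.

HB.instance Definition _ := Measure_isSigmaFinite.Build _ _ _ plane_measure
  plane_measure_sigma_finite.

Lemma box_compact r : compact (box r).
Proof. by apply: compact_setX; exact: segment_compact. Qed.

Definition locally_bounded_measurable f :=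
  measurable_fun [set: P] f /\
  forall r, exists M, forall z, box r z -> `|f z| <= M.
Local Notation lbm := locally_bounded_measurable.

Definition bounded_support f := exists r, forall z, ~ box r z -> f z = 0.

(** Nearly all integrands are brought into this class. It is stable under multiplication by
    continuous functions, so integrability can be read off the shape of the integrand. *)
Definition nice f := lbm f /\ bounded_support f.

Lemma lbm_continuous f : continuous f -> lbm f.
Proof.
move=> cf; split; first exact: continuous_measurable2.
move=> r.
have := @continuous_compact _ _ f (box r) (continuous_subspaceT cf) (@box_compact r).
move=> /compact_bounded [M [_ HM]].
exists (M + 1) => z zr; apply: (HM (M + 1)); first by rewrite ltrDl.
by exists z.
Qed.

Lemma lbm_indic (A : set (R * R)) : measurable (A : set P) -> lbm (\1_A).
Proof.
move=> mA; split; first exact: measurable_indic.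
by move=> r; exists 1 => z _; rewrite indicE; case: (_ \in _); rewrite ?normr1 ?normr0.
Qed.

Lemma lbm_cst (c : R) : lbm (fun=> c).
Proof. by apply: lbm_continuous => x; exact: cvg_cst. Qed.

Lemma lbmD f g : lbm f -> lbm g -> lbm (fun z => f z + g z).
Proof.
move=> [mf bf] [mg bg]; split; first exact: measurable_funD.
move=> r; have [M HM] := bf r; have [N HN] := bg r.
exists (M + N) => z zr; rewrite (le_trans (ler_normD _ _))// lerD//; [exact: HM|exact: HN].
Qed.

Lemma lbmM f g : lbm f -> lbm g -> lbm (fun z => f z * g z).
Proof.
move=> [mf bf] [mg bg]; split; first exact: measurable_funM.
move=> r; have [M HM] := bf r; have [N HN] := bg r.
exists (M * N) => z zr; rewrite normrM ler_pM//; [exact: HM|exact: HN].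
Qed.

Lemma lbmN f : lbm f -> lbm (fun z => - f z).
Proof.
move=> lf; have := lbmM (lbm_cst (-1)) lf.
by under eq_fun do rewrite mulN1r.
Qed.

Lemma box_le r s z : r <= s -> box r z -> box s z.
Proof. by move=> rs /boxE[? ?]; apply/boxE; split; exact: le_trans rs. Qed.

Lemma niceD f g : nice f -> nice g -> nice (fun z => f z + g z).
Proof.
move=> [lf [r Hr]] [lg [s Hs]]; split; first exact: lbmD.
exists (Num.max r s) => z zrs; rewrite Hr ?Hs ?addr0// => H; apply: zrs;
  by apply: box_le H; rewrite le_max lexx ?orbT.
Qed.

Lemma niceM f g : nice f -> lbm g -> nice (fun z => f z * g z).
Proof.
move=> [lf [r Hr]] lg; split; first exact: lbmM.
by exists r => z zr; rewrite Hr// mul0r.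
Qed.

Lemma niceMl f g : lbm f -> nice g -> nice (fun z => f z * g z).
Proof. by move=> lf ng; under eq_fun do rewrite mulrC; exact: niceM. Qed.

Lemma niceZ (c : R) f : nice f -> nice (fun z => c * f z).
Proof. by move=> nf; apply: niceMl => //; exact: lbm_cst. Qed.

Lemma niceN f : nice f -> nice (fun z => - f z).
Proof.
move=> /(niceZ (-1)); by under eq_fun do rewrite mulN1r.
Qed.

Lemma niceB f g : nice f -> nice g -> nice (fun z => f z - g z).
Proof. by move=> nf ng; apply: niceD => //; exact: niceN. Qed.

Lemma nice0 : nice (fun=> 0).
Proof. by split; [exact: lbm_cst|exists 0]. Qed.

Lemma nice_sum n (F : nat -> R * R -> R) : (forall i, nice (F i)) ->
  nice (fun z => \sum_(0 <= i < n) F i z).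
Proof.
move=> nF; elim: n => [|n IH]; first by under eq_fun do rewrite big_nil; exact: nice0.
by under eq_fun do rewrite big_nat_recr//=; exact: niceD.
Qed.

Lemma nice_bounded f : nice f -> exists M, forall z, `|f z| <= M.
Proof.
move=> [[_ bf] [r Hr]]; have [M HM] := bf r; exists (Num.max 0 M) => z.
have [zr|zr] := pselect (box r z); first by rewrite le_max HM ?orbT.
by rewrite Hr// normr0 le_max lexx.
Qed.

Lemma nice_integrable f : nice f -> plane_measure.-integrable [set: P] (EFin \o f).
Proof.
move=> [[mf bf] [r Hr]]; have [M HM] := bf r.
have mb := box_measurable r.
have : plane_measure.-integrable (box r : set P) (EFin \o f).
  apply: measurable_bounded_integrable => //.
  (* [r] may be negative, whereas the measure of a box is known for nonnegative radii. *)
  - rewrite (@le_lt_trans _ _ (plane_measure (box (Num.max 0 r) : set P)))//.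
      apply: le_measure; try exact: (mem_set (box_measurable _)).
      by move=> z; apply: box_le; rewrite le_max lexx orbT.
    by rewrite box_measure ?ltry// le_max lexx.
  - exact: measurable_funS mf.
  - exists M; split; first exact: num_real.
    by move=> N MN z zr; rewrite /= (le_trans (HM _ zr))// ltW.
move=> /(integrable_mkcond _ mb); congr (integrable _ _ _).
apply/funext => z; rewrite /patch/=; case: ifPn => // /negP zr.
by rewrite /= Hr// => ?; apply: zr; exact/mem_set.
Qed.

Lemma planeD f g : nice f -> nice g -> I (fun z => f z + g z) = I f + I g.
Proof. by move=> nf ng; apply: RintegralD => //; exact: nice_integrable. Qed.

Lemma planeB f g : nice f -> nice g -> I (fun z => f z - g z) = I f - I g.
Proof. by move=> nf ng; apply: RintegralB => //; exact: nice_integrable. Qed.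

Lemma planeZ c f : nice f -> I (fun z => c * f z) = c * I f.
Proof. by move=> nf; apply: RintegralZl => //; exact: nice_integrable. Qed.

Lemma plane0 : I (fun=> 0) = 0.
Proof. by rewrite /I /plane_integral Rintegral_cst// mul0r. Qed.

Lemma plane_sum n (F : nat -> R * R -> R) : (forall i, nice (F i)) ->
  I (fun z => \sum_(0 <= i < n) F i z) = \sum_(0 <= i < n) I (F i).
Proof.
move=> nF; elim: n => [|n IH].
  by rewrite big_nil -[RHS]plane0; congr I; apply/funext => z; rewrite big_nil.
rewrite big_nat_recr//= -IH -planeD//; last exact: nice_sum.
by congr I; apply/funext => z; rewrite big_nat_recr.
Qed.

Lemma le_plane f g : nice f -> nice g -> (forall z, f z <= g z) -> I f <= I g.
Proof.
move=> nf ng fg; apply: le_Rintegral => //; exact: nice_integrable.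
Qed.

Lemma plane_ge0 f : (forall z, 0 <= f z) -> 0 <= I f.
Proof. by move=> f0; apply: Rintegral_ge0 => z _. Qed.

Lemma plane_EFin f : nice f -> (\int[plane_measure]_z (f z)%:E)%E = (I f)%:E.
Proof.
move=> nf; rewrite /I /plane_integral /Rintegral fineK//.
by apply: integrable_fin_num => //; exact: nice_integrable.
Qed.

End plane_integral.

(** * Integrals of derivatives of functions with bounded support *)

Section divergence.
Context {R : realType}.
Implicit Types (f g : R * R -> R) (z : R * R).
Local Notation I := plane_integral.
Local Notation mu := (@lebesgue_measure R).

Lemma plane_iterated1 f : nice f ->
  (I f)%:E = (\int[mu]_a \int[mu]_b (f (a, b))%:E)%E.
Proof.
move=> nf; rewrite -plane_EFin// /plane_measure -integral12_prod_meas1//.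
exact: nice_integrable.
Qed.

Lemma plane_iterated2 f : nice f ->
  (I f)%:E = (\int[mu]_b \int[mu]_a (f (a, b))%:E)%E.
Proof.
move=> nf; rewrite -plane_EFin// /plane_measure -integral21_prod_meas1//.
exact: nice_integrable.
Qed.

Lemma integral_derive (F f : R -> R) (a b : R) : a < b ->
  (forall x : R, is_derive x 1 F (f x)) -> continuous f ->
  (\int[mu]_(x in `[a, b]) (f x)%:E = (F b - F a)%:E)%E.
Proof.
move=> ab dF cf.
have dF1 (x : R) : derivable F x 1 by have [] := dF x.
have cF : continuous F.
  by move=> x; apply: differentiable_continuous; exact/derivable1_diffP.
rewrite (@continuous_FTC2 _ f F)//; first exact: continuous_subspaceT.
- split=> //; first by apply: cvg_at_right_filter; exact: cF.
  by apply: cvg_at_left_filter; exact: cF.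
- by move=> x _; rewrite derive1E; have [] := dF x.
Qed.

Lemma integral_derive0 (F f : R -> R) (r : R) :
  (forall x : R, is_derive x 1 F (f x)) -> continuous f ->
  (forall x, r < `|x| -> F x = 0) -> (forall x, r < `|x| -> f x = 0) ->
  (\int[mu]_x (f x)%:E = 0)%E.
Proof.
move=> dF cf F0 f0.
(* Larger than [r], so that [F] vanishes at both ends, and positive, so that the interval is not
   degenerate. *)
set s := Num.max 0 r + 1.
have s0 : 0 < s by rewrite ltr_pwDr// le_max lexx.
have rs : r < s by rewrite ltr_pwDr// le_max lexx orbT.
transitivity (\int[mu]_(x in `[(- s)%R, s]) (f x)%:E)%E.
  rewrite [RHS]integral_mkcond; apply: eq_integral => x _.
  rewrite /patch; case: ifPn => // /negP xs; rewrite f0// (lt_le_trans rs)//.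
  rewrite leNgt; apply/negP => xs'; apply: xs; apply/mem_set.
  by rewrite /= in_itv/= -ler_norml ltW.
rewrite (@integral_derive F f)//; last by lra.
by rewrite !F0 ?subrr// ?normrN gtr0_norm.
Qed.

Lemma continuous_pair1 f b : continuous f -> continuous (fun a => f (a, b)).
Proof.
move=> cf a; apply: (@cvg_comp _ _ _ (fun a => (a, b)) f); last exact: cf.
by apply: (@cvg_pair _ _ _ _ (nbhs a) (nbhs b)); [exact: cvg_id|exact: cvg_cst].
Qed.

Lemma continuous_pair2 f a : continuous f -> continuous (fun b => f (a, b)).
Proof.
move=> cf b; apply: (@cvg_comp _ _ _ (fun b => (a, b)) f); last exact: cf.
by apply: (@cvg_pair _ _ _ _ (nbhs a) (nbhs b)); [exact: cvg_cst|exact: cvg_id].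
Qed.

(** Partial derivatives are expressed along coordinate lines, so that the one-variable rules apply
    to them directly. *)
Definition has_d1 (F f : R * R -> R) := forall a b : R, is_derive a 1 (fun s : R => F (s, b)) (f (a, b)).
Definition has_d2 (F f : R * R -> R) := forall a b : R, is_derive b 1 (fun s : R => F (a, s)) (f (a, b)).

Lemma plane_d1_eq0 F f : has_d1 F f -> continuous f ->
  bounded_support F -> bounded_support f -> I f = 0.
Proof.
move=> dF cf [r Fr] sf; have [s fs] := sf.
have nf : nice f by split => //; exact: lbm_continuous.
apply: EFin_inj; rewrite plane_iterated2//.
rewrite (eq_integral (cst 0%E)) ?integral_cst ?mul0e//= => b _.
apply: (@integral_derive0 (fun a => F (a, b)) (fun a => f (a, b)) (Num.max r s)).
- by move=> a; exact: dF.
- exact: continuous_pair1.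
- move=> a; rewrite gt_max => /andP[ra _]; apply: Fr => /boxE[/= h _].
  by move: ra; rewrite ltNge h.
- move=> a; rewrite gt_max => /andP[_ ra]; apply: fs => /boxE[/= h _].
  by move: ra; rewrite ltNge h.
Qed.

Lemma plane_d2_eq0 F f : has_d2 F f -> continuous f ->
  bounded_support F -> bounded_support f -> I f = 0.
Proof.
move=> dF cf [r Fr] sf; have [s fs] := sf.
have nf : nice f by split => //; exact: lbm_continuous.
apply: EFin_inj; rewrite plane_iterated1//.
rewrite (eq_integral (cst 0%E)) ?integral_cst ?mul0e//= => a _.
apply: (@integral_derive0 (fun b => F (a, b)) (fun b => f (a, b)) (Num.max r s)).
- by move=> b; exact: dF.
- exact: continuous_pair2.
- move=> b; rewrite gt_max => /andP[ra _]; apply: Fr => /boxE[/= _ h].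
  by move: ra; rewrite ltNge h.
- move=> b; rewrite gt_max => /andP[_ ra]; apply: fs => /boxE[/= _ h].
  by move: ra; rewrite ltNge h.
Qed.

End divergence.

(** * Differentiation rules and the area of a disc *)

Section derivation_rules.
Context {R : realType}.
Implicit Types (f g : R -> R) (x a b : R).

Lemma der_cst x (c : R) : is_derive x 1 (fun=> c) 0.
Proof. exact: is_derive_cst. Qed.

Lemma der_id x : is_derive x 1 (fun s : R => s) 1.
Proof. exact: is_derive_id. Qed.

Lemma der_add f g x a b : is_derive x 1 f a -> is_derive x 1 g b ->
  is_derive x 1 (fun s => f s + g s) (a + b).
Proof. by move=> df dg; exact: is_deriveD. Qed.

Lemma der_opp f x a : is_derive x 1 f a -> is_derive x 1 (fun s => - f s) (- a).
Proof. by move=> df; exact: is_deriveN. Qed.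

Lemma der_mul f g x a b : is_derive x 1 f a -> is_derive x 1 g b ->
  is_derive x 1 (fun s => f s * g s) (a * g x + f x * b).
Proof.
move=> df dg; apply: (is_derive_eq (is_deriveM df dg)).
by rewrite /GRing.scale/=; ring.
Qed.

Lemma der_comp f g x a b : is_derive (g x) 1 f b -> is_derive x 1 g a ->
  is_derive x 1 (fun s => f (g s)) (b * a).
Proof. by move=> df dg; exact: is_derive1_comp. Qed.

Lemma der_exp f x a n : is_derive x 1 f a ->
  is_derive x 1 (fun s => f s ^+ n.+1) (n.+1%:R * f x ^+ n * a).
Proof.
move=> df; elim: n => [|n IH].
  by under eq_fun do rewrite expr1; rewrite expr0 mulr1 mul1r.
under eq_fun do rewrite exprS.
apply: (is_derive_eq (der_mul df IH)).
by rewrite exprS -[in RHS]addn1 natrD; ring.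
Qed.

Lemma der_sqrt f x a : 0 < f x -> is_derive x 1 f a ->
  is_derive x 1 (fun s => Num.sqrt (f s)) ((2 * Num.sqrt (f x))^-1 * a).
Proof. by move=> fx df; apply: der_comp => //; exact: is_derive1_sqrt. Qed.

Lemma der_atan f x a : is_derive x 1 f a ->
  is_derive x 1 (fun s => atan (f s)) ((1 + f x ^+ 2)^-1 * a).
Proof. by move=> df; apply: der_comp => //; exact: is_derive1_atan. Qed.

Lemma der_inv f x a : f x != 0 -> is_derive x 1 f a ->
  is_derive x 1 (fun s => (f s)^-1) (- (f x ^- 2) * a).
Proof.
move=> fx df; split; first by apply: derivableV => //; case: df.
by rewrite deriveV//; have [_ ->] := df; rewrite /GRing.scale/= mulNr.
Qed.

Lemma der_expR f x a : is_derive x 1 f a ->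
  is_derive x 1 (fun s => expR (f s)) (expR (f x) * a).
Proof. by move=> df; apply: der_comp => //; exact: is_derive_expR. Qed.

Lemma derive_increment (f df : R -> R) (x y : R) : x <= y ->
  (forall x : R, is_derive x 1 f (df x)) ->
  exists2 c, x <= c <= y & f y - f x = df c * (y - x).
Proof.
move=> xy d; have [|c] := @MVT_segment R f df x y xy (fun x _ => d x).
  apply: continuous_subspaceT => z; apply: differentiable_continuous.
  by apply/derivable1_diffP; have [] := d z.
by rewrite in_itv => ? ?; exists c.
Qed.

End derivation_rules.

(* [notypeclasses] because resolution would solve some of the goals with instances
   whose derivatives are written with [*:]. *)
Ltac der := repeat first
  [ notypeclasses refine (der_id _) | notypeclasses refine (der_cst _ _)
  | notypeclasses refine (der_add _ _) | notypeclasses refine (der_opp _)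
  | notypeclasses refine (der_exp _ _) | notypeclasses refine (der_mul _ _)
  | notypeclasses refine (der_sqrt _ _) | notypeclasses refine (der_atan _)
  | notypeclasses refine (der_inv _ _) | notypeclasses refine (der_expR _)].
Ltac der_to := notypeclasses refine (is_derive_eq _ _).

Section disc.
Context {R : realType}.
Local Notation I := plane_integral.
Local Notation mu := (@lebesgue_measure R).
Local Notation P := (measurableTypeR R * measurableTypeR R)%type.

Lemma ltr_norm_sqrt (x y : R) : (`|x| < Num.sqrt y) = (x ^+ 2 < y).
Proof.
have [y0|y0] := leP y 0.
  rewrite ler0_sqrtr//; apply/idP/idP => h; first by have := normr_ge0 x; lra.
  by have := sqr_ge0 x; lra.
by rewrite -sqrtr_sqr ltr_sqrt.
Qed.

(** Squared form of the Euclidean ball, with which it agrees for [0 < r]. Being given by a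
    polynomial, it suits measurability and the completion of squares. *)
Definition disc (c : R * R) (r : R) : set (R * R) :=
  [set z | (z.1 - c.1) ^+ 2 + (z.2 - c.2) ^+ 2 < r ^+ 2].

Lemma continuous_sqdist (c : R * R) :
  continuous (fun z : R * R => (z.1 - c.1) ^+ 2 + (z.2 - c.2) ^+ 2).
Proof.
move=> z; apply: cvgD; rewrite !expr2.
  by apply: cvgM; (apply: cvgB; [exact: cvg_fst|exact: cvg_cst]).
by apply: cvgM; (apply: cvgB; [exact: cvg_snd|exact: cvg_cst]).
Qed.

Lemma disc_measurable c r : measurable (disc c r : set P).
Proof.
have := continuous_measurable2 (@continuous_sqdist c).
move=> /(_ measurableT _ (measurable_itv `]-oo, (r ^+ 2)[)).
by rewrite setTI.
Qed.

Lemma nice_disc c r : nice (\1_(disc c r)).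
Proof.
split; first by apply: lbm_indic; exact: disc_measurable.
exists (`|c.1| + `|c.2| + `|r|) => z zb; rewrite indicE memNset// => zd.
apply: zb; apply/boxE.
have h (x y : R) : x ^+ 2 + y ^+ 2 < r ^+ 2 -> `|x| <= `|r|.
  move=> h; rewrite -(@ler_pXn2r _ 2) ?nnegrE ?normr_ge0// !real_normK ?num_real//.
  by have := sqr_ge0 y; lra.
have h1 := h _ _ zd.
move: zd; rewrite /disc/= addrC => /h h2; split.
- have := ler_normD (z.1 - c.1) c.1; rewrite subrK.
  by have := normr_ge0 c.2; lra.
- have := ler_normD (z.2 - c.2) c.2; rewrite subrK.
  by have := normr_ge0 c.1; lra.
Qed.

(** Lines that miss the disc are covered by the value [0] of [Num.sqrt] on negative arguments. *)
Lemma disc_slice c r a :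
  (\int[mu]_b (\1_(disc c r) (a, b))%:E = (2 * Num.sqrt (r ^+ 2 - (a - c.1) ^+ 2))%:E)%E.
Proof.
set s := Num.sqrt _.
transitivity (\int[mu]_b (\1_(`](c.2 - s)%R, (c.2 + s)%R[%classic) b)%:E)%E.
  have E (b : R) : ((a - c.1) ^+ 2 + (b - c.2) ^+ 2 < r ^+ 2) =
      (c.2 - s < b < c.2 + s).
    by rewrite -ltr_distl ltr_norm_sqrt ltrBrDl.
  apply: eq_integral => b _; rewrite !indicE; congr ((nat_of_bool _)%:R%:E).
  by apply/idP/idP => /set_mem/= H; apply/mem_set; move: H;
    rewrite /= /disc/= in_itv/= E.
rewrite integral_indic//= setIT.
have s0 : 0 <= s by exact: sqrtr_ge0.
rewrite lebesgue_measure_itv/= lte_fin; case: ltP => h.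
  by rewrite -EFinD; congr EFin; lra.
by congr EFin; lra.
Qed.

(** The length of a chord is not differentiable at the ends of the diameter. Adding [d^2] under the
    root makes it smooth on the closed interval, and [d] can be taken arbitrarily small
    afterwards. *)
Lemma half_disc_integral (x0 r d : R) : 0 < r -> 0 < d ->
  (\int[mu]_(a in `[(x0 - r)%R, (x0 + r)%R])
     (2 * Num.sqrt (r ^+ 2 + d ^+ 2 - (a - x0) ^+ 2))%:E
   <= (2 * r * d + pi * (r ^+ 2 + d ^+ 2))%:E)%E.
Proof.
move=> r0 d0; set q := r ^+ 2 + d ^+ 2.
pose T a := Num.sqrt (q - (a - x0) ^+ 2).
(* [G] is a primitive of [2 T]. At both ends [T = d], and [atan < pi / 2] produces the factor
   [pi]. *)
pose G a := (a - x0) * T a + q * atan ((a - x0) / T a).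
have sq a : a \in `[x0 - r, x0 + r]%R -> 0 < q - (a - x0) ^+ 2.
  rewrite in_itv/= => /andP[h1 h2].
  suff : (a - x0) ^+ 2 <= r ^+ 2 by have : 0 < d ^+ 2 := exprn_gt0 _ d0; rewrite /q; lra.
  by nra.
have dG (a : R) : a \in `[x0 - r, x0 + r]%R -> is_derive a 1 G (2 * T a).
  move=> /sq qa; have T0 : 0 < T a by rewrite sqrtr_gt0.
  have T2 : T a ^+ 2 = q - (a - x0) ^+ 2 by rewrite sqr_sqrtr// ltW.
  der_to; first by der => //; rewrite ?gt_eqF.
  rewrite -/(T a) /= /GRing.scale/=.
  have -> : q = T a ^+ 2 + (a - x0) ^+ 2 by rewrite T2; ring.
  have T20 : 0 < T a ^+ 2 + (a - x0) ^+ 2 by rewrite ltr_pwDl ?exprn_gt0 ?sqr_ge0.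
  by field; rewrite !lt0r_neq0.
have cG a : a \in `[x0 - r, x0 + r]%R -> {for a, continuous G}.
  move=> /dG[h _]; apply: differentiable_continuous; exact/derivable1_diffP.
rewrite (@continuous_FTC2 _ _ G); last first.
- move=> a /subset_itv_oo_cc /dG[_ h]; by rewrite derive1E h.
- split.
  + by move=> a /subset_itv_oo_cc /dG[].
  + by apply: cvg_at_right_filter; apply: cG; rewrite in_itv/= lexx/=; lra.
  + by apply: cvg_at_left_filter; apply: cG; rewrite in_itv/= lexx andbT; lra.
- apply: continuous_subspaceT => a.
  apply: cvgM; first exact: cvg_cst.
  apply: (@continuous_comp _ _ _ (fun a => q - (a - x0) ^+ 2)); last exact: sqrt_continuous.
  apply: cvgB; first exact: cvg_cst.
  by rewrite !expr2; apply: cvgM; (apply: cvgB; [exact: cvg_id|exact: cvg_cst]).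
- by lra.
have Te : T (x0 + r) = d /\ T (x0 - r) = d.
  rewrite /T /q; split; rewrite -[RHS](ger0_norm (ltW d0)) -sqrtr_sqr; congr Num.sqrt; ring.
rewrite -EFinD lee_fin /G !Te.1 !Te.2.
have -> : x0 + r - x0 = r by ring.
have -> : x0 - r - x0 = - r by ring.
have := atan_ltpi2 (r / d); rewrite (mulNr r d^-1) atanN.
have q0 : 0 < q by rewrite addr_gt0// exprn_gt0.
by move=> h; nra.
Qed.

Lemma measurable_half_chord (q x0 : R) :
  measurable_fun [set: R] (fun a : R => 2 * Num.sqrt (q - (a - x0) ^+ 2)).
Proof.
apply: continuous_measurable_fun => a; apply: cvgM; first exact: cvg_cst.
apply: (@continuous_comp _ _ _ (fun a => q - (a - x0) ^+ 2)); last exact: sqrt_continuous.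
apply: cvgB; first exact: cvg_cst.
by rewrite !expr2; apply: cvgM; (apply: cvgB; [exact: cvg_id|exact: cvg_cst]).
Qed.

Lemma disc_area_le c r : 0 < r -> I (\1_(disc c r)) <= pi * r ^+ 2.
Proof.
move=> r0; apply/ler_addgt0Pr => e e0.
(* Since [d <= 1], the error [2 r d + pi d^2] is at most [d (2 r + pi) <= e]. *)
pose d := Num.min 1 (e / (2 * r + pi)).
have pi0 := pi_gt0 R.
have q0 : 0 < 2 * r + pi by lra.
have d0 : 0 < d by rewrite lt_min ltr01/= divr_gt0.
have d1 : d <= 1 by rewrite ge_min lexx.
have d2 : d * (2 * r + pi) <= e by rewrite -ler_pdivlMr// ge_min lexx orbT.
apply: (@le_trans _ _ (2 * r * d + pi * (r ^+ 2 + d ^+ 2))); last first.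
  have d3 : d ^+ 2 <= d by rewrite expr2 ler_piMr// ltW.
  have : pi * d ^+ 2 <= pi * d by rewrite ler_pM2l.
  by lra.
rewrite -lee_fin (plane_iterated1 (nice_disc c r)).
under eq_integral do rewrite disc_slice.
apply: le_trans (half_disc_integral c.1 r0 d0).
rewrite [leRHS]integral_mkcond; apply: ge0_le_integral => //.
- by apply/measurable_EFinP; exact: measurable_half_chord.
- apply/(measurable_restrictT _ _).1 => //.
  apply/measurable_EFinP; apply: (measurable_funS measurableT) => //.
  exact: measurable_half_chord.
- move=> a _; rewrite patchE; case: ifPn => [_|/negP h].
    rewrite lee_fin ler_pM2l// ler_wsqrtr//.
    by have := sqr_ge0 d; lra.
  rewrite lee_fin ler0_sqrtr ?mulr0//.
  rewrite leNgt; apply/negP => h'; apply: h; apply/mem_set; rewrite /= in_itv/=.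
  by apply/andP; split; nra.
Qed.

End disc.

(** * The sharp isoperimetric inequality *)

Section bathtub.
Context {R : realType}.
Local Notation I := plane_integral.

(** A discrete layer-cake formula: each level [s j] below [f] contributes the gap that lies above
    it, and these gaps reach from [s 0] up to [min f (s J)]. *)
Lemma layer_sum (s : nat -> R) (f : R) J : (forall j, s j <= s j.+1) ->
  Num.min f (s J) - s 0%N <= \sum_(0 <= j < J) (s j.+1 - s j) * (s j < f)%R%:R.
Proof.
move=> s_nd; elim: J => [|J IH].
  by rewrite big_nil subr_le0 ge_min lexx orbT.
rewrite big_nat_recr//=; case: (ltP (s J) f) IH => h IH.
  rewrite mulr1; have : Num.min f (s J.+1) <= s J.+1 by rewrite ge_min lexx orbT.
  by lra.
rewrite mulr0 addr0; apply: le_trans IH; rewrite lerD2r.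
by rewrite ge_min lexx.
Qed.

(** By Bernoulli's inequality, [n (q - 1) <= q ^+ n]. *)
Lemma expr_unbounded (q M : R) : 1 < q -> exists n, M <= q ^+ n.
Proof.
move=> q1; have [n Hn] : exists n, M <= n%:R * (q - 1).
  exists (Num.truncn (`|M| / (q - 1))).+1.
  rewrite -ler_pdivrMr ?subr_gt0//.
  apply: le_trans (ltW (truncnS_gt _)).
  by rewrite ler_pM2r ?invr_gt0 ?subr_gt0// ler_norm.
exists n; apply: le_trans Hn _.
elim: n => [|n IH]; first by rewrite mul0r expr0.
rewrite exprS -natr1 mulrDl mul1r.
have : 1 <= q ^+ n by rewrite exprn_ege1// ltW.
by nra.
Qed.

(* [kernel1] and [kernel2] are the components of [(x - y) / (|x - y|^2 + e)], the
   gradient of the fundamental solution of the Laplacian regularised by [e]. *)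
Definition kernel1 (e : R) (y x : R * R) :=
  (x.1 - y.1) / ((x.1 - y.1) ^+ 2 + (x.2 - y.2) ^+ 2 + e).
Definition kernel2 (e : R) (y x : R * R) :=
  (x.2 - y.2) / ((x.1 - y.1) ^+ 2 + (x.2 - y.2) ^+ 2 + e).

Lemma kernel_den_gt0 (e : R) (y x : R * R) : 0 < e ->
  0 < (x.1 - y.1) ^+ 2 + (x.2 - y.2) ^+ 2 + e.
Proof. by move=> e0; rewrite ltr_wpDl// addr_ge0// sqr_ge0. Qed.

Lemma continuous_kernel_den (e : R) (y : R * R) : 0 < e ->
  continuous (fun x : R * R => ((x.1 - y.1) ^+ 2 + (x.2 - y.2) ^+ 2 + e)^-1).
Proof.
move=> e0 x; apply: cvgV; first by rewrite gt_eqF// kernel_den_gt0.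
apply: cvgD; [exact: continuous_sqdist|exact: cvg_cst].
Qed.

Lemma continuous_kernel1 (e : R) y : 0 < e -> continuous (kernel1 e y).
Proof.
move=> e0 x; apply: cvgM; last exact: (@continuous_kernel_den e y e0 x).
by apply: cvgB; [exact: cvg_fst|exact: cvg_cst].
Qed.

Lemma continuous_kernel2 (e : R) y : 0 < e -> continuous (kernel2 e y).
Proof.
move=> e0 x; apply: cvgM; last exact: (@continuous_kernel_den e y e0 x).
by apply: cvgB; [exact: cvg_snd|exact: cvg_cst].
Qed.

Lemma kernel_le (e : R) (u w : R) : 0 < e -> `|u / (u ^+ 2 + w ^+ 2 + e)| <= 1 + e^-1.
Proof.
move=> e0; have u0 := sqr_ge0 u; have w0 := sqr_ge0 w.
have d0 : 0 < u ^+ 2 + w ^+ 2 + e by lra.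
rewrite normrM normfV (gtr0_norm d0) ler_pdivrMr//.
have ei : 0 < e^-1 by rewrite invr_gt0.
have ee : e^-1 * e = 1 by rewrite mulVf// gt_eqF.
have u1 : `|u| <= u ^+ 2 + 1.
  by rewrite -[u ^+ 2]real_normK ?num_real//; have := sqr_ge0 (`|u| - 1); nra.
rewrite mulrDl mul1r mulrDr ee; nra.
Qed.

Lemma kernel1_le (e : R) y x : 0 < e -> `|kernel1 e y x| <= 1 + e^-1.
Proof. exact: kernel_le. Qed.

Lemma kernel2_le (e : R) y x : 0 < e -> `|kernel2 e y x| <= 1 + e^-1.
Proof. by rewrite /kernel2 [_ ^+ 2 + _ ^+ 2]addrC; exact: kernel_le. Qed.

(* The superlevel sets of z |-> p.z / |z|^2 are discs through the origin, so the
   rearrangement bound only needs the area of a disc; the geometric levels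
   [s0 q^j] replace the layer-cake integral. *)
Lemma bathtub (e l : R) (p y : R * R) (g : R * R -> R) :
  0 < e -> 0 < l -> nice g -> (forall x, 0 <= g x <= 1) ->
  I (fun x => g x * (p.1 * kernel1 e y x + p.2 * kernel2 e y x)) <=
  Num.sqrt (p.1 ^+ 2 + p.2 ^+ 2) * (l * I g + pi / (4 * l)).
Proof.
move=> e0 l0 ng g01; set r := Num.sqrt _.
have r_ge0 : 0 <= r by exact: sqrtr_ge0.
have r2 : r ^+ 2 = p.1 ^+ 2 + p.2 ^+ 2 by rewrite sqr_sqrtr// addr_ge0// sqr_ge0.
have [r0|r0] := eqVneq r 0.
  have [p1 p2] : p.1 = 0 /\ p.2 = 0.
    have := sqr_ge0 p.1; have := sqr_ge0 p.2; move: r2; rewrite r0 expr0n/= => h h1 h2.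
    by split; apply/eqP; rewrite -sqrf_eq0; apply/eqP; lra.
  rewrite r0 mul0r (_ : (fun x => _) = (fun=> 0)) ?plane0//.
  by apply/funext => x; rewrite p1 p2 !mul0r addr0 mulr0.
have rp : 0 < r by rewrite lt_def r0.
pose f x := p.1 * kernel1 e y x + p.2 * kernel2 e y x.
have cf : continuous f.
  move=> x; apply: cvgD; (apply: cvgM; first exact: cvg_cst).
    exact: continuous_kernel1.
  exact: continuous_kernel2.
have ngf : nice (fun x => g x * f x) by apply: niceM => //; exact: lbm_continuous.
have pi0 := pi_gt0 R.
(* The ratio [q] of consecutive levels costs a factor [q] in the area term, and it may be taken
   arbitrarily close to [1]. *)
suff key (q : R) : 1 < q -> I (fun x => g x * f x) <= r * l * I g + r * pi / (4 * l) * q.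
  apply/ler_addgt0Pr => d d0.
  have B0 : 0 < r * pi / (4 * l) by rewrite divr_gt0 ?mulr_gt0.
  have := key (1 + d / (r * pi / (4 * l))).
  rewrite ltrDl divr_gt0// => /(_ isT) /le_trans; apply.
  by rewrite mulrDr mulr1 mulrCA divff ?gt_eqF// mulr1 -/r; lra.
move=> q1.
have q0 : 0 < q by lra.
(* Below the first level [r l] the mass of [g] is counted, above it the area of the superlevel
   sets. *)
pose s j := r * l * q ^+ j.
have s_gt0 j : 0 < s j by rewrite !mulr_gt0// exprn_gt0.
have sS j : s j.+1 = s j * q by rewrite /s exprSr mulrA.
have s_nd j : s j <= s j.+1 by rewrite sS ler_peMr// ltW.
have [J HJ] := expr_unbounded ((`|p.1| + `|p.2|) * (1 + e^-1) / (r * l)) q1.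
have fJ x : f x <= s J.
  move: HJ; rewrite ler_pdivrMr ?mulr_gt0// [leRHS]mulrC -/(s J).
  apply: le_trans; apply: le_trans (ler_norm _) _.
  apply: le_trans (ler_normD _ _) _; rewrite (normrM p.1) (normrM p.2) mulrDl.
  by apply: lerD; apply: ler_wpM2l => //; (exact: kernel1_le || exact: kernel2_le).
(* Centre and radius come from completing the square in [s j |z|^2 < p . z], where [z = x - y]. *)
pose D j := disc (y.1 + p.1 / (2 * s j), y.2 + p.2 / (2 * s j)) (r / (2 * s j)).
have fD j x : s j < f x -> D j x.
  rewrite /f /kernel1 /kernel2 !mulrA -mulrDl ltr_pdivlMr ?kernel_den_gt0//.
  set u := x.1 - y.1; set w := x.2 - y.2 => h.
  rewrite /D /disc/= !opprD !addrA -/u -/w.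
  move: (s_gt0 j) h; set t := s j => t0 h.
  rewrite -subr_gt0.
  have -> : (r / (2 * t)) ^+ 2 - ((u - p.1 / (2 * t)) ^+ 2 + (w - p.2 / (2 * t)) ^+ 2)
     = t^-1 * (p.1 * u + p.2 * w - t * (u ^+ 2 + w ^+ 2)).
    rewrite expr_div_n r2; by field; rewrite gt_eqF.
  by rewrite mulr_gt0 ?invr_gt0//; have : 0 < t * e by [rewrite mulr_gt0]; lra.
have nS : nice (fun x => \sum_(0 <= j < J) (s j.+1 - s j) * \1_(D j) x).
  by apply: nice_sum => j; apply: niceZ; exact: nice_disc.
apply: (@le_trans _ _ (I (fun x => s 0%N * g x + \sum_(0 <= j < J) (s j.+1 - s j) * \1_(D j) x))).
  apply: le_plane => //; first by apply: niceD => //; exact: niceZ.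
  move=> x; have /andP[g0 g1] := g01 x.
  have h0 : 0 <= \sum_(0 <= j < J) (s j.+1 - s j) * \1_(D j) x.
    by apply: sumr_ge0 => j _; rewrite mulr_ge0 ?subr_ge0.
  have h1 : f x - s 0%N <= \sum_(0 <= j < J) (s j.+1 - s j) * \1_(D j) x.
    have := @layer_sum s (f x) J s_nd; rewrite min_l// => /le_trans; apply.
    apply: ler_sum => j _; apply: ler_wpM2l; first by rewrite subr_ge0.
    rewrite indicE; case: (ltP (s j) (f x)) => [/fD h|_]; last by rewrite ler0n.
    by rewrite mem_set.
  set S := \sum_(_ <= _ < _) _ in h0 h1 *.
  have := s_gt0 0%N; nra.
rewrite planeD//; last exact: niceZ.
rewrite planeZ// plane_sum; last by move=> j; apply: niceZ; exact: nice_disc.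
rewrite {1}/s expr0 mulr1 lerD2l.
(* The term of index [j] is at most [(q - 1) r pi / (4 l q^j)], and the sum of this geometric
   progression is the right-hand side. *)
suff : \sum_(0 <= j < J) I (fun x => (s j.+1 - s j) * \1_(D j) x) <=
    r * pi / (4 * l) * (q - q * q^-1 ^+ J).
  move=> /le_trans; apply; rewrite ler_pM2l ?divr_gt0 ?mulr_gt0//.
  by rewrite gerBl mulr_ge0 ?exprn_ge0 ?invr_ge0// ltW.
elim: J {HJ fJ nS} => [|J IH]; first by rewrite big_nil expr0 mulr1 subrr mulr0.
rewrite big_nat_recr//= planeZ; last exact: nice_disc.
have sJ := s_gt0 J.
have h : (s J.+1 - s J) * I (\1_(D J)) <= (s J.+1 - s J) * (pi * (r / (2 * s J)) ^+ 2).
  by apply: ler_wpM2l; [rewrite subr_ge0|apply: disc_area_le; rewrite divr_gt0// mulr_gt0].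
apply: le_trans (lerD IH h) _; rewrite le_eqVlt; apply/orP; left; apply/eqP.
rewrite sS /s (exprSr q^-1) !exprVn.
have qJ : q ^+ J != 0 by rewrite expf_neq0// gt_eqF.
by field; rewrite qJ !gt_eqF.
Qed.

End bathtub.

(** * Flux of the regularised kernel *)

Section kernel_flux.
Context {R : realType}.
Local Notation I := plane_integral.
Local Notation mu := (@lebesgue_measure R).
Local Notation P := (measurableTypeR R * measurableTypeR R)%type.

Definition kernel_den (e : R) (x y : R * R) :=
  (y.1 - x.1) ^+ 2 + (y.2 - x.2) ^+ 2 + e.
Definition dkernel1 (e : R) (x y : R * R) :=
  (kernel_den e x y)^-1 - 2 * (y.1 - x.1) ^+ 2 / kernel_den e x y ^+ 2.
Definition dkernel2 (e : R) (x y : R * R) :=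
  (kernel_den e x y)^-1 - 2 * (y.2 - x.2) ^+ 2 / kernel_den e x y ^+ 2.
(* This approximates [2 pi] times the Dirac mass at [x] as [e] tends to [0]. *)
Definition kernel_div (e : R) (x y : R * R) := 2 * e / kernel_den e x y ^+ 2.

Lemma has_d1_kernel1 e x : 0 < e -> has_d1 (kernel1 e x) (dkernel1 e x).
Proof.
move=> e0 a b; have h := @kernel_den_gt0 R e x (a, b) e0.
rewrite /kernel1 /dkernel1/=.
der_to; first by der; rewrite gt_eqF.
by rewrite /= -!/(kernel_den e x (a, b)) /GRing.scale/= in h *; field; rewrite gt_eqF.
Qed.

Lemma has_d2_kernel2 e x : 0 < e -> has_d2 (kernel2 e x) (dkernel2 e x).
Proof.
move=> e0 a b; have h := @kernel_den_gt0 R e x (a, b) e0.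
rewrite /kernel2 /dkernel2/=.
der_to; first by der; rewrite gt_eqF.
by rewrite /= -!/(kernel_den e x (a, b)) /GRing.scale/= in h *; field; rewrite gt_eqF.
Qed.

Lemma dkernelD e x y : 0 < e -> dkernel1 e x y + dkernel2 e x y = kernel_div e x y.
Proof.
move=> e0; have := @kernel_den_gt0 R e x y e0; rewrite /dkernel1 /dkernel2 /kernel_div.
rewrite -/(kernel_den e x y) => h.
have -> : e = kernel_den e x y - ((y.1 - x.1) ^+ 2 + (y.2 - x.2) ^+ 2).
  by rewrite /kernel_den; ring.
have -> : kernel_den (kernel_den e x y - ((y.1 - x.1) ^+ 2 + (y.2 - x.2) ^+ 2)) x y
   = kernel_den e x y by rewrite /kernel_den; ring.
by field; rewrite gt_eqF.
Qed.

Lemma continuous_dkernel1 e x : 0 < e -> continuous (dkernel1 e x).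
Proof.
move=> e0 y; have ci := @continuous_kernel_den R e x e0 y.
apply: cvgB; first exact: ci.
apply: cvgM.
  apply: cvgM; first exact: cvg_cst.
  by rewrite !expr2; apply: cvgM; (apply: cvgB; [exact: cvg_fst|exact: cvg_cst]).
rewrite -exprVn expr2 /kernel_den.
under eq_fun do rewrite -exprVn expr2.
by apply: cvgM.
Qed.

Lemma continuous_dkernel2 e x : 0 < e -> continuous (dkernel2 e x).
Proof.
move=> e0 y; have ci := @continuous_kernel_den R e x e0 y.
apply: cvgB; first exact: ci.
apply: cvgM.
  apply: cvgM; first exact: cvg_cst.
  by rewrite !expr2; apply: cvgM; (apply: cvgB; [exact: cvg_snd|exact: cvg_cst]).
rewrite -exprVn expr2 /kernel_den.
under eq_fun do rewrite -exprVn expr2.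
by apply: cvgM.
Qed.

(** Squares serve as neighbourhoods of the pole: on them Fubini's theorem reduces the mass of
    [kernel_div] to an arctangent. *)
Definition square (x : R * R) (r : R) : set (R * R) :=
  `[x.1 - r, x.1 + r]%classic `*` `[x.2 - r, x.2 + r]%classic.

Lemma nice_square x r : nice (\1_(square x r)).
Proof.
split; first by apply: lbm_indic; apply: measurableX; exact: measurable_itv.
exists (`|x.1| + `|x.2| + `|r|) => z zb; rewrite indicE memNset// => zd.
apply: zb; apply/boxE; move: zd => [/=]; rewrite !in_itv/=.
have := ler_norm r; have := ler_norm (- x.1); have := ler_norm (- x.2).
have := ler_norm (x.1); have := ler_norm (x.2); rewrite !normrN.
by rewrite !ler_norml => *; split; lra.
Qed.

(** This is the flux of the regularised kernel through two opposite sides of a square centred at the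
    pole. It tends to [pi] as [e] tends to [0], so that the four sides together give [2 pi]. *)
Lemma arctan_profile (e r x0 : R) : 0 < e -> 0 < r ->
  (\int[mu]_(b in `[(x0 - r)%R, (x0 + r)%R]) (2 * r / (r ^+ 2 + (b - x0) ^+ 2 + e))%:E
   = (4 * (r / Num.sqrt (r ^+ 2 + e)) * atan (r / Num.sqrt (r ^+ 2 + e)))%:E)%E.
Proof.
move=> e0 r0; set w := Num.sqrt _.
have r20 : 0 < r ^+ 2 by rewrite exprn_gt0.
have w2 : w ^+ 2 = r ^+ 2 + e by rewrite sqr_sqrtr//; lra.
have w0 : 0 < w by rewrite sqrtr_gt0; lra.
transitivity ((2 * (r / w) * atan ((x0 + r - x0) / w) -
    2 * (r / w) * atan ((x0 - r - x0) / w))%:E)%E.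
apply: (@integral_derive _ (fun b => 2 * (r / w) * atan ((b - x0) / w))
  (fun b => 2 * r / (r ^+ 2 + (b - x0) ^+ 2 + e))).
- by lra.
- move=> b; der_to; first by der.
  rewrite /= /GRing.scale/=; have -> : r ^+ 2 + (b - x0) ^+ 2 + e = w ^+ 2 + (b - x0) ^+ 2 by rewrite w2; ring.
  have h : 0 < w ^+ 2 + (b - x0) ^+ 2 by rewrite ltr_pwDl ?exprn_gt0 ?sqr_ge0.
  by field; rewrite !gt_eqF.
- move=> b; apply: cvgM; first exact: cvg_cst.
  apply: cvgV; first by rewrite gt_eqF//; have := sqr_ge0 (b - x0); lra.
  apply: cvgD; last exact: cvg_cst.
  apply: cvgD; first exact: cvg_cst.
  by rewrite !expr2; apply: cvgM; (apply: cvgB; [exact: cvg_id|exact: cvg_cst]).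
congr EFin; have -> : x0 + r - x0 = r by ring.
have -> : x0 - r - x0 = - r by ring.
by rewrite mulNr atanN; ring.
Qed.

Lemma integral_dkernel1_square e x r : 0 < e -> 0 < r ->
  I (fun y => \1_(square x r) y * dkernel1 e x y) =
  4 * (r / Num.sqrt (r ^+ 2 + e)) * atan (r / Num.sqrt (r ^+ 2 + e)).
Proof.
move=> e0 r0; apply: EFin_inj.
rewrite plane_iterated2; last first.
  apply: niceM; first exact: nice_square.
  by apply: lbm_continuous; exact: continuous_dkernel1.
rewrite -(arctan_profile x.2 e0 r0) [RHS]integral_mkcond.
apply: eq_integral => b _; rewrite patchE.
transitivity (\int[mu]_(a in `[(x.1 - r)%R, (x.1 + r)%R])
    (\1_(`[x.2 - r, x.2 + r]%classic) b * dkernel1 e x (a, b))%:E)%E.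
  rewrite [RHS]integral_mkcond; apply: eq_integral => a _; rewrite patchE.
  rewrite /square !indicE in_setX/=.
  by case: (a \in _) => //=; rewrite ?mul0r.
rewrite indicE; case: ifPn => hb; last first.
  by under eq_integral do rewrite mul0r; rewrite integral0.
under eq_integral do rewrite mul1r.
transitivity ((kernel1 e x (x.1 + r, b) - kernel1 e x (x.1 - r, b))%:E)%E.
  apply: (@integral_derive _ (fun a => kernel1 e x (a, b))); first by lra.
  - by move=> a; exact: has_d1_kernel1.
  - by apply: continuous_pair1; exact: continuous_dkernel1.
congr EFin; rewrite /kernel1/=.
have -> : x.1 + r - x.1 = r by ring.
have -> : x.1 - r - x.1 = - r by ring.
by rewrite sqrrN mulNr; ring.
Qed.

Lemma integral_dkernel2_square e x r : 0 < e -> 0 < r ->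
  I (fun y => \1_(square x r) y * dkernel2 e x y) =
  4 * (r / Num.sqrt (r ^+ 2 + e)) * atan (r / Num.sqrt (r ^+ 2 + e)).
Proof.
move=> e0 r0; apply: EFin_inj.
rewrite plane_iterated1; last first.
  apply: niceM; first exact: nice_square.
  by apply: lbm_continuous; exact: continuous_dkernel2.
rewrite -(arctan_profile x.1 e0 r0) [RHS]integral_mkcond.
apply: eq_integral => a _; rewrite patchE.
transitivity (\int[mu]_(b in `[(x.2 - r)%R, (x.2 + r)%R])
    (\1_(`[x.1 - r, x.1 + r]%classic) a * dkernel2 e x (a, b))%:E)%E.
  rewrite [RHS]integral_mkcond; apply: eq_integral => b _; rewrite patchE.
  rewrite /square !indicE in_setX/= andbC.
  by case: (b \in _) => //=; rewrite ?mul0r.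
rewrite indicE; case: ifPn => hb; last first.
  by under eq_integral do rewrite mul0r; rewrite integral0.
under eq_integral do rewrite mul1r.
transitivity ((kernel2 e x (a, x.2 + r) - kernel2 e x (a, x.2 - r))%:E)%E.
  apply: (@integral_derive _ (fun b => kernel2 e x (a, b))); first by lra.
  - by move=> b; exact: has_d2_kernel2.
  - by apply: continuous_pair2; exact: continuous_dkernel2.
congr EFin; rewrite /kernel2/=.
have -> : x.2 + r - x.2 = r by ring.
have -> : x.2 - r - x.2 = - r by ring.
by rewrite sqrrN mulNr [r ^+ 2 + _]addrC; ring.
Qed.

Lemma integral_kernel_div_square e x r : 0 < e -> 0 < r ->
  I (fun y => \1_(square x r) y * kernel_div e x y) =
  8 * (r / Num.sqrt (r ^+ 2 + e)) * atan (r / Num.sqrt (r ^+ 2 + e)).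
Proof.
move=> e0 r0; have nq := nice_square x r.
have c1 := lbm_continuous (@continuous_dkernel1 e x e0).
have c2 := lbm_continuous (@continuous_dkernel2 e x e0).
under [X in I X]eq_fun do rewrite -dkernelD// mulrDr.
rewrite planeD; try exact: niceM.
by rewrite integral_dkernel1_square// integral_dkernel2_square//; ring.
Qed.

End kernel_flux.

Section plane_fubini.
Context {R : realType}.
Local Notation I := plane_integral.
Local Notation lam := (@plane_measure R).
Local Notation P := (measurableTypeR R * measurableTypeR R)%type.
Variable K : R * R -> R * R -> R.
Hypothesis mK : measurable_fun [set: P * P] (fun w : P * P => K w.1 w.2).
Variables (M r : R).
Hypothesis K_le : forall x y, `|K x y| <= M.
Hypothesis K_supp : forall x y, ~ (box r x /\ box r y) -> K x y = 0.

Let K_integrable : (lam \x lam)%E.-integrable [set: P * P] (EFin \o (fun w => K w.1 w.2)).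
Proof.
have mb : measurable (box r `*` box r : set (P * P)).
  by apply: measurableX; exact: box_measurable.
have : (lam \x lam)%E.-integrable (box r `*` box r : set (P * P))
    (EFin \o (fun w => K w.1 w.2)).
  apply: measurable_bounded_integrable => //.
  - rewrite [X in (X < _)%E](product_measure1E lam lam (box_measurable r) (box_measurable r)).
    have h : (lam (box r : set P) < +oo)%E.
      have [r0|r0] := leP 0 r; first by rewrite [X in (X < _)%E]box_measure// ltry.
      rewrite (_ : box r = set0) ?measure0//.
      by apply/seteqP; split => // z /boxE[h _]; have := normr_ge0 z.1; lra.
    by apply: lte_mul_pinfty => //; rewrite ge0_fin_numE.
  - exact: measurable_funS mK.
  - by exists M; split; [exact: num_real|move=> N MN w _; rewrite /= (le_trans (K_le _ _))// ltW].
move=> /(integrable_mkcond _ mb); congr (integrable _ _ _).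
apply/funext => w; rewrite /patch/=; case: ifPn => // /negP wr.
by rewrite K_supp// => ?; apply: wr; exact/mem_set.
Qed.

(** The integrability of both partial integrals is recorded along with their equality, because these
    functions are compared later without being shown to be [nice]. *)
Lemma plane_fubini : (forall x, nice (K x)) -> (forall y, nice (K^~ y)) ->
  [/\ lam.-integrable [set: P] (EFin \o (fun x => I (K x))),
      lam.-integrable [set: P] (EFin \o (fun y => I (K^~ y))) &
      I (fun x => I (K x)) = I (fun y => I (K^~ y))].
Proof.
move=> n1 n2.
have E1 : EFin \o (fun x => I (K x)) = (fun x => \int[lam]_y (K x y)%:E)%E.
  by apply/funext => x; rewrite /= -plane_EFin.
have E2 : EFin \o (fun y => I (K^~ y)) = (fun y => \int[lam]_x (K x y)%:E)%E.
  by apply/funext => y; rewrite /= -plane_EFin.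
have K_integrable' : (lam \x lam)%E.-integrable [set: P * P]
    (EFin \o (fun w => K w.2 w.1)).
  have mK' : measurable_fun [set: P * P] (EFin \o (fun w : P * P => K w.2 w.1)).
    by apply/measurable_EFinP; exact: (measurableT_comp mK (@measurable_swap _ _ P P)).
  apply/(integrable12ltyP lam lam mK').
  exact: ((integrable21ltyP lam lam (measurable_int _ K_integrable)).1 K_integrable).
split.
- by rewrite E1; exact: (integrable_fubini_F K_integrable).
- by rewrite E2; exact: (integrable_fubini_F K_integrable').
- rewrite /I /plane_integral /Rintegral; congr fine.
  rewrite (_ : (fun x => _) = (fun x => \int[lam]_y (K x y)%:E)%E); last first.
    by rewrite -E1.
  rewrite [in RHS](_ : (fun x => _) = (fun y => \int[lam]_x (K x y)%:E)%E); last first.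
    by rewrite -E2.
  exact: (Fubini K_integrable).
Qed.

End plane_fubini.

(** * The isoperimetric inequality from a double integral *)

Section isoperimetric.
Context {R : realType}.
Local Notation I := plane_integral.
Local Notation P := (measurableTypeR R * measurableTypeR R)%type.

Lemma bounded_supportM (f g : R * R -> R) : bounded_support f ->
  bounded_support (fun z => f z * g z).
Proof. by move=> [r fr]; exists r => z /fr ->; rewrite mul0r. Qed.

Lemma bounded_supportD (f g : R * R -> R) : bounded_support f -> bounded_support g ->
  bounded_support (fun z => f z + g z).
Proof.
move=> [r fr] [s gs]; exists (Num.max r s) => z h.
rewrite fr ?gs ?addr0// => h'; apply: h; apply: box_le h';
  by rewrite le_max lexx ?orbT.
Qed.

Lemma continuousM2 (f g : R * R -> R) : continuous f -> continuous g ->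
  continuous (fun z => f z * g z).
Proof. by move=> cf cg z; apply: cvgM; [exact: cf|exact: cg]. Qed.

Lemma continuousD2 (f g : R * R -> R) : continuous f -> continuous g ->
  continuous (fun z => f z + g z).
Proof. by move=> cf cg z; apply: cvgD; [exact: cf|exact: cg]. Qed.

Lemma continuousN2 (f : R * R -> R) : continuous f -> continuous (fun z => - f z).
Proof. by move=> cf z; apply: cvgN; exact: cf. Qed.

Lemma has_d1M (f f1 g g1 : R * R -> R) : has_d1 f f1 -> has_d1 g g1 ->
  has_d1 (fun z => f z * g z) (fun z => f1 z * g z + f z * g1 z).
Proof. by move=> df dg a b; apply: der_mul. Qed.

Lemma has_d2M (f f2 g g2 : R * R -> R) : has_d2 f f2 -> has_d2 g g2 ->
  has_d2 (fun z => f z * g z) (fun z => f2 z * g z + f z * g2 z).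
Proof. by move=> df dg a b; apply: der_mul. Qed.

Lemma plane_by_parts1 (f f1 g g1 : R * R -> R) :
  has_d1 f f1 -> has_d1 g g1 -> continuous f -> continuous f1 ->
  continuous g -> continuous g1 -> bounded_support f -> bounded_support f1 ->
  I (fun z => f1 z * g z) = - I (fun z => f z * g1 z).
Proof.
move=> df dg cf cf1 cg cg1 sf sf1.
have : I (fun z => f1 z * g z + f z * g1 z) = 0.
  apply: (plane_d1_eq0 (has_d1M df dg)).
  - by apply: continuousD2; exact: continuousM2.
  - exact: bounded_supportM.
  - by apply: bounded_supportD; exact: bounded_supportM.
rewrite planeD; first by move=> /eqP; rewrite addr_eq0 => /eqP.
- by split; [apply: lbm_continuous; exact: continuousM2|exact: bounded_supportM].
- by split; [apply: lbm_continuous; exact: continuousM2|exact: bounded_supportM].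
Qed.

Lemma plane_by_parts2 (f f2 g g2 : R * R -> R) :
  has_d2 f f2 -> has_d2 g g2 -> continuous f -> continuous f2 ->
  continuous g -> continuous g2 -> bounded_support f -> bounded_support f2 ->
  I (fun z => f2 z * g z) = - I (fun z => f z * g2 z).
Proof.
move=> df dg cf cf2 cg cg2 sf sf2.
have : I (fun z => f2 z * g z + f z * g2 z) = 0.
  apply: (plane_d2_eq0 (has_d2M df dg)).
  - by apply: continuousD2; exact: continuousM2.
  - exact: bounded_supportM.
  - by apply: bounded_supportD; exact: bounded_supportM.
rewrite planeD; first by move=> /eqP; rewrite addr_eq0 => /eqP.
- by split; [apply: lbm_continuous; exact: continuousM2|exact: bounded_supportM].
- by split; [apply: lbm_continuous; exact: continuousM2|exact: bounded_supportM].
Qed.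

Lemma derive_lipschitz (f df : R -> R) (M : R) :
  (forall x : R, is_derive x 1 f (df x)) -> (forall x, `|df x| <= M) ->
  forall x y : R, `|f x - f y| <= M * `|x - y|.
Proof.
move=> d b; have key x y : x <= y -> `|f x - f y| <= M * `|x - y|.
  move=> /derive_increment/(_ d)[c _ E].
  by rewrite distrC E normrM distrC ler_wpM2r.
move=> x y; have [|/ltW] := leP x y; first exact: key.
by rewrite distrC (distrC x); exact: key.
Qed.

Section iso.
Variables phi phi1 phi2 g : R * R -> R.
Hypotheses (d1 : has_d1 phi phi1) (d2 : has_d2 phi phi2).
Hypotheses (c0 : continuous phi) (c1 : continuous phi1) (c2 : continuous phi2).
Hypotheses (s0 : bounded_support phi) (s1 : bounded_support phi1)
  (s2 : bounded_support phi2).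
Hypothesis phi_ge0 : forall z, 0 <= phi z.
Hypotheses (ng : nice g) (g01 : forall z, 0 <= g z <= 1).

(** The gradient of [phi] at [y] against the kernel with pole [x]. Its integral in [y] approaches
    [- 2 pi phi(x)] as [e] tends to [0]. Up to sign it is also the kernel with pole [y] evaluated at
    [x], the form required by [bathtub]. *)
Let pairing (e : R) (x y : R * R) :=
  phi1 y * kernel1 e x y + phi2 y * kernel2 e x y.

Let n0 : nice phi. Proof. by split => //; exact: lbm_continuous. Qed.
Let n1 : nice phi1. Proof. by split => //; exact: lbm_continuous. Qed.
Let n2 : nice phi2. Proof. by split => //; exact: lbm_continuous. Qed.

Lemma nice_pairing e x : 0 < e -> nice (pairing e x).
Proof.
move=> e0; apply: niceD; apply: niceM => //; apply: lbm_continuous.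
  exact: continuous_kernel1.
exact: continuous_kernel2.
Qed.

Lemma continuous_kernel_div (e : R) x : 0 < e -> continuous (kernel_div e x).
Proof.
move=> e0; rewrite (_ : kernel_div e x = fun y => dkernel1 e x y + dkernel2 e x y).
  by apply: continuousD2; [exact: continuous_dkernel1|exact: continuous_dkernel2].
by apply/funext => y; rewrite dkernelD.
Qed.

Lemma pairing_by_parts e x : 0 < e ->
  I (pairing e x) = - I (fun y => phi y * kernel_div e x y).
Proof.
move=> e0; rewrite planeD; last 2 first.
- by apply: niceM => //; apply: lbm_continuous; exact: continuous_kernel1.
- by apply: niceM => //; apply: lbm_continuous; exact: continuous_kernel2.
have ck1 := @continuous_kernel1 R e x e0; have ck2 := @continuous_kernel2 R e x e0.
have cd1 := @continuous_dkernel1 R e x e0; have cd2 := @continuous_dkernel2 R e x e0.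
rewrite (plane_by_parts1 d1 (has_d1_kernel1 x e0))//.
rewrite (plane_by_parts2 d2 (has_d2_kernel2 x e0))//.
rewrite -opprD -planeD; last 2 first.
- by apply: niceM => //; exact: lbm_continuous.
- by apply: niceM => //; exact: lbm_continuous.
congr (- plane_integral _); apply/funext => y.
by rewrite -(dkernelD x y e0) [RHS]mulrDr.
Qed.

(** As [phi] and [kernel_div] are nonnegative, the integral may be restricted to a square on which
    [phi] stays above [phi x - w]. *)
Lemma pairing_le e x r w : 0 < e -> 0 < r ->
  (forall y, square x r y -> phi x - w <= phi y) ->
  8 * (r / Num.sqrt (r ^+ 2 + e)) * atan (r / Num.sqrt (r ^+ 2 + e)) * (phi x - w)
    <= - I (pairing e x).
Proof.
move=> e0 r0 Hw; rewrite pairing_by_parts// opprK.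
have ck := lbm_continuous (@continuous_kernel_div e x e0).
rewrite -(integral_kernel_div_square x e0 r0).
have ns : nice (fun y => \1_(square x r) y * kernel_div e x y).
  by apply: niceM => //; exact: nice_square.
rewrite mulrC -planeZ//; apply: le_plane; [exact: niceZ|exact: niceM|].
move=> y; have k0 : 0 <= kernel_div e x y.
  by rewrite divr_ge0 ?mulr_ge0 ?exprn_ge0// ltW// kernel_den_gt0.
rewrite mulrA; apply: ler_wpM2r => //.
rewrite indicE; case: (boolP (y \in _)) => [/set_mem/Hw|_]; first by rewrite mulr1.
by rewrite mulr0.
Qed.

Let Fker (e : R) (x y : R * R) := g x * - pairing e x y.

Lemma measurable_kernel_inv (e : R) : 0 < e ->
  measurable_fun [set: P * P] (fun w : P * P => (kernel_den e w.1 w.2)^-1).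
Proof.
move=> e0.
(* The maximum with [e] changes nothing here and makes the reciprocal continuous on the whole line,
   so that joint measurability follows by composition. *)
have -> : (fun w : P * P => (kernel_den e w.1 w.2)^-1) =
   (fun t : R => (Num.max t e)^-1) \o (fun w : P * P => kernel_den e w.1 w.2).
  apply/funext => w /=; rewrite max_l// /kernel_den lerDr.
  by rewrite addr_ge0 ?sqr_ge0.
apply: measurableT_comp.
  apply: continuous_measurable_fun => t; apply: cvgV.
    by rewrite gt_eqF// lt_max e0 orbT.
  by apply: continuous_max; [exact: cvg_id|exact: cvg_cst].
have m11 : measurable_fun [set: P * P] (fun w : P * P => w.1.1).
  exact: (measurableT_comp (@measurable_fst _ _ _ _) (@measurable_fst _ _ _ _)).
have m12 : measurable_fun [set: P * P] (fun w : P * P => w.1.2).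
  exact: (measurableT_comp (@measurable_snd _ _ _ _) (@measurable_fst _ _ _ _)).
have m21 : measurable_fun [set: P * P] (fun w : P * P => w.2.1).
  exact: (measurableT_comp (@measurable_fst _ _ _ _) (@measurable_snd _ _ _ _)).
have m22 : measurable_fun [set: P * P] (fun w : P * P => w.2.2).
  exact: (measurableT_comp (@measurable_snd _ _ _ _) (@measurable_snd _ _ _ _)).
by apply: measurable_funD => //; apply: measurable_funD; apply: measurable_funX;
  exact: measurable_funB.
Qed.

Lemma measurable_Fker (e : R) : 0 < e ->
  measurable_fun [set: P * P] (fun w : P * P => Fker e w.1 w.2).
Proof.
move=> e0; have mi := measurable_kernel_inv e0.
have m11 : measurable_fun [set: P * P] (fun w : P * P => w.1.1).
  exact: (measurableT_comp (@measurable_fst _ _ _ _) (@measurable_fst _ _ _ _)).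
have m12 : measurable_fun [set: P * P] (fun w : P * P => w.1.2).
  exact: (measurableT_comp (@measurable_snd _ _ _ _) (@measurable_fst _ _ _ _)).
have m21 : measurable_fun [set: P * P] (fun w : P * P => w.2.1).
  exact: (measurableT_comp (@measurable_fst _ _ _ _) (@measurable_snd _ _ _ _)).
have m22 : measurable_fun [set: P * P] (fun w : P * P => w.2.2).
  exact: (measurableT_comp (@measurable_snd _ _ _ _) (@measurable_snd _ _ _ _)).
apply: measurable_funM.
  exact: (measurableT_comp (proj1 (proj1 ng)) (@measurable_fst _ _ P P)).
under eq_fun do rewrite -mulN1r; apply: measurable_funM => //.
apply: measurable_funD; apply: measurable_funM.
- exact: (measurableT_comp (proj1 (proj1 n1)) (@measurable_snd _ _ P P)).
- by apply: measurable_funM => //; exact: measurable_funB.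
- exact: (measurableT_comp (proj1 (proj1 n2)) (@measurable_snd _ _ P P)).
- by apply: measurable_funM => //; exact: measurable_funB.
Qed.

Lemma Fker_supp e : exists r, forall x y, ~ (box r x /\ box r y) -> Fker e x y = 0.
Proof.
have [_ [rg Hg]] := ng; have [r1 H1] := s1; have [r2 H2] := s2.
pose r := Num.max rg (Num.max r1 r2).
have rg_le : rg <= r by rewrite le_max lexx.
have r1_le : r1 <= r by rewrite !le_max lexx orbT.
have r2_le : r2 <= r by rewrite !le_max lexx !orbT.
exists r => x y h; rewrite /Fker.
have [xr|xr] := pselect (box r x); last first.
  by rewrite Hg ?mul0r// => /(box_le rg_le).
have yr : ~ box r y by move=> yr; exact: h.
rewrite /pairing H1 ?H2 ?mul0r ?addr0 ?oppr0 ?mulr0//.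
- by move=> /(box_le r2_le).
- by move=> /(box_le r1_le).
Qed.

Lemma Fker_le e : 0 < e -> exists M, forall x y, `|Fker e x y| <= M.
Proof.
move=> e0; have [M1 H1] := nice_bounded n1; have [M2 H2] := nice_bounded n2.
exists ((M1 + M2) * (1 + e^-1)) => x y.
have /andP[g0 g1] := g01 x; rewrite normrM normrN (ger0_norm g0).
apply: le_trans (_ : `|pairing e x y| <= _).
  by rewrite ler_piMl.
apply: le_trans (ler_normD _ _) _; rewrite mulrDl; apply: lerD.
  by rewrite normrM ler_pM//; exact: kernel1_le.
by rewrite normrM ler_pM//; exact: kernel2_le.
Qed.

Lemma Fker_fubini e : 0 < e ->
  [/\ (@plane_measure R).-integrable [set: P] (EFin \o (fun x => I (Fker e x))),
      (@plane_measure R).-integrable [set: P] (EFin \o (fun y => I (fun x => Fker e x y))) &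
      I (fun x => I (Fker e x)) = I (fun y => I (fun x => Fker e x y))].
Proof.
move=> e0; have [M HM] := Fker_le e0; have [r Hr] := Fker_supp e.
apply: (plane_fubini (measurable_Fker e0) HM Hr).
- by move=> x; apply: niceZ; apply: niceN; exact: nice_pairing.
- move=> y; apply: niceM => //; apply: lbmN.
  rewrite (_ : (fun x => pairing e x y) =
     (fun x => - (phi1 y * kernel1 e y x + phi2 y * kernel2 e y x))); last first.
    apply/funext => x; rewrite /pairing /kernel1 /kernel2.
    rewrite -(opprB x.1 y.1) -(opprB x.2 y.2) !sqrrN; ring.
  apply: lbmN; apply: lbmD; (apply: lbmM; first exact: lbm_cst);
    apply: lbm_continuous.
    exact: continuous_kernel1.
  exact: continuous_kernel2.
Qed.

Let grad z := Num.sqrt (phi1 z ^+ 2 + phi2 z ^+ 2).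

Lemma nice_grad : nice grad.
Proof.
have cs : continuous (fun z => phi1 z ^+ 2 + phi2 z ^+ 2).
  by apply: continuousD2; under eq_fun do rewrite expr2; exact: continuousM2.
split.
  apply: lbm_continuous => z.
  apply: (@continuous_comp _ _ _ (fun z => phi1 z ^+ 2 + phi2 z ^+ 2)); last exact: sqrt_continuous.
  exact: cs.
have [r1 H1] := s1; have [r2 H2] := s2.
exists (Num.max r1 r2) => z h; rewrite /grad H1 ?H2 ?expr0n/= ?addr0 ?sqrtr0//.
- by move=> /(@box_le _ _ (Num.max r1 r2)); rewrite le_max lexx orbT => /(_ isT).
- by move=> /(@box_le _ _ (Num.max r1 r2)); rewrite le_max lexx => /(_ isT).
Qed.

(** After the exchange of the integrals, [bathtub] applies at each fixed [y] with [p] the gradient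
    of [phi] at [y]. *)
Lemma Fker_upper e l : 0 < e -> 0 < l ->
  I (fun x => I (Fker e x)) <= (l * I g + pi / (4 * l)) * I grad.
Proof.
move=> e0 l0; have [_ i2 ->] := Fker_fubini e0.
have ngr := nice_grad.
rewrite -planeZ//; apply: le_Rintegral => //.
  by apply: nice_integrable; exact: niceZ.
move=> y _; rewrite mulrC.
apply: le_trans (bathtub (phi1 y, phi2 y) y e0 l0 ng g01).
rewrite le_eqVlt; apply/orP; left; apply/eqP; congr plane_integral.
apply/funext => x; rewrite /Fker /pairing /kernel1 /kernel2/=.
by rewrite -(opprB x.1 y.1) -(opprB x.2 y.2) !sqrrN; ring.
Qed.

Lemma phi_unif_continuous (w : R) : 0 < w ->
  exists2 r, 0 < r & forall x y, square x r y -> phi x - w <= phi y.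
Proof.
move=> w0; have [M1 H1] := nice_bounded n1; have [M2 H2] := nice_bounded n2.
have M10 : 0 <= M1 by apply: le_trans (H1 (0, 0)).
have M20 : 0 <= M2 by apply: le_trans (H2 (0, 0)).
exists (w / (M1 + M2 + 1)) => [|x y [/=]]; first by rewrite divr_gt0//; lra.
set r := w / _ => xy1 xy2.
have rE : (M1 + M2 + 1) * r = w by rewrite mulrC divfK// gt_eqF//; lra.
have h1 := derive_lipschitz (fun a => d1 a y.2) (fun a => H1 (a, y.2)) x.1 y.1.
have h2 := derive_lipschitz (fun b => d2 x.1 b) (fun b => H2 (x.1, b)) x.2 y.2.
have n1r : `|x.1 - y.1| <= r by rewrite distrC ler_distl; move: xy1; rewrite in_itv.
have n2r : `|x.2 - y.2| <= r by rewrite distrC ler_distl; move: xy2; rewrite in_itv.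
have r0 : 0 < r by rewrite divr_gt0//; lra.
move: h1 h2; rewrite -!surjective_pairing => h1 h2.
have := le_trans h1 (ler_wpM2l M10 n1r).
have := le_trans h2 (ler_wpM2l M20 n2r).
by rewrite !ler_norml; lra.
Qed.

Lemma Fker_lower e r w : 0 < e -> 0 < r ->
  (forall x y, square x r y -> phi x - w <= phi y) ->
  8 * (r / Num.sqrt (r ^+ 2 + e)) * atan (r / Num.sqrt (r ^+ 2 + e)) *
    (I (fun x => g x * phi x) - w * I g) <= I (fun x => I (Fker e x)).
Proof.
move=> e0 r0 Hw; have [i1 _ _] := Fker_fubini e0.
set c := 8 * _ * _.
have ngp : nice (fun x => g x * phi x) by apply: niceM => //; exact: lbm_continuous.
have -> : c * (I (fun x => g x * phi x) - w * I g) =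
    I (fun x => c * (g x * phi x - w * g x)).
  by rewrite planeZ ?planeB ?planeZ//; [exact: niceZ|apply: niceB => //; exact: niceZ].
apply: le_Rintegral => //.
  by apply: nice_integrable; apply: niceZ; apply: niceB => //; exact: niceZ.
move=> x _; rewrite /Fker planeZ; last by apply: niceN; exact: nice_pairing.
have -> : c * (g x * phi x - w * g x) = g x * (c * (phi x - w)) by ring.
apply: ler_wpM2l; first by case/andP: (g01 x).
apply: le_trans (pairing_le e0 r0 (Hw x)) _.
have := planeZ (-1) (nice_pairing x e0).
rewrite mulN1r => <-; rewrite le_eqVlt; apply/orP; left; apply/eqP.
by congr plane_integral; apply/funext => y; rewrite mulN1r.
Qed.

(* For [g] and [phi] close to the indicator of a set of area [A] and perimeter [L], the
   optimal [l] gives [2 pi A <= sqrt (pi A) L], that is [4 pi A <= L^2]. *)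
Lemma isoperimetric (l : R) : 0 < l ->
  2 * pi * I (fun z => g z * phi z) <= (l * I g + pi / (4 * l)) * I grad.
Proof.
move=> l0; set B := (_ + _) * _; set A := I _; set G := I g.
have key a w : 0 < a < 1 -> 0 < w -> 8 * a * atan a * (A - w * G) <= B.
  move=> /andP[a0 a1] w0; have [r r0 Hr] := phi_unif_continuous w0.
  (* This [e] makes [r / sqrt (r^2 + e)] equal to the prescribed [a < 1]. *)
  pose e := r ^+ 2 * (a ^- 2 - 1).
  have a2 : 1 < a ^- 2 by rewrite invf_gt1 ?exprn_gt0// exprn_ilt1// ltW.
  have e0 : 0 < e by rewrite mulr_gt0 ?exprn_gt0// subr_gt0.
  have E : r / Num.sqrt (r ^+ 2 + e) = a.
    have -> : r ^+ 2 + e = (r / a) ^+ 2.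
      by rewrite /e; field; rewrite gt_eqF.
    by rewrite sqrtr_sqr gtr0_norm ?divr_gt0// invf_div mulrC divfK// gt_eqF.
  by have := le_trans (Fker_lower e0 r0 Hr) (Fker_upper e0 l0); rewrite E.
have key2 w : 0 < w -> 2 * pi * (A - w * G) <= B.
  (* As [a] tends to [1], the factor [8 a atan a] tends to [8 (pi / 4) = 2 pi]. *)
  move=> w0; have c : (8 * a * atan a * (A - w * G)) @[a --> (1:R)^'-] --> 8 * 1 * atan 1 * (A - w * G).
    apply: cvg_at_left_filter; apply: cvgM; last exact: cvg_cst.
    apply: cvgM; last exact: continuous_atan.
    by apply: cvgM; [exact: cvg_cst|exact: cvg_id].
  have -> : 2 * pi * (A - w * G) = 8 * 1 * atan 1 * (A - w * G).
    by rewrite atan1; field.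
  rewrite -(cvg_lim _ c)//; apply: limr_le; first exact: cvgP c.
  near=> a; apply: key => //; apply/andP; split; near: a.
    exact: nbhs_left_gt.
  exact: nbhs_left_lt.
have G0 : 0 <= G by apply: plane_ge0 => z; case/andP: (g01 z).
have pi0 := pi_gt0 R.
apply/ler_addgt0Pr => d d0.
(* With this [w] the loss [2 pi w G] is at most [d], and the denominator is positive even if
   [G = 0]. *)
have w0 : 0 < d / (2 * pi * G + 1) by rewrite divr_gt0// ltr_wpDl// !mulr_ge0// ltW.
have := key2 _ w0; set w := d / _ in w0 *.
have : w * (2 * pi * G + 1) = d by rewrite divfK// gt_eqF// ltr_wpDl// !mulr_ge0// ltW.
by lra.
Unshelve. all: by end_near. Qed.

End iso.
End isoperimetric.

(** * Level sets of the conformal factor *)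

Section spline_step.
Context {R : realType}.
Implicit Types (s : R).

Definition ppow (k : nat) s := Num.max s 0 ^+ k.

Lemma ppow_le0 k s : s <= 0 -> ppow k.+1 s = 0.
Proof. by move=> s0; rewrite /ppow max_r// expr0n. Qed.

Lemma ppow_ge0 k s : 0 <= s -> ppow k s = s ^+ k.
Proof. by move=> s0; rewrite /ppow max_l. Qed.

Lemma continuous_ppow k : continuous (ppow k).
Proof.
elim: k => [|k IH] s.
  rewrite (_ : ppow 0 = fun=> 1); first exact: cvg_cst.
  by apply/funext => u; rewrite /ppow expr0.
rewrite (_ : ppow k.+1 = fun s => Num.max s 0 * ppow k s); last first.
  by apply/funext => u; rewrite /ppow exprS.
apply: cvgM; last exact: IH.
by apply: continuous_max; [exact: cvg_id|exact: cvg_cst].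
Qed.

(** Only [s = 0] needs care: there the difference quotient is [ppow k.+1] itself, which is
    continuous and vanishes at [0]. *)
Lemma der_ppow k s : is_derive s 1 (ppow k.+2) (k.+2%:R * ppow k.+1 s).
Proof.
have [s0|s0|s0] := ltgtP s 0.
- rewrite ppow_le0 ?ltW// mulr0.
  notypeclasses refine (near_eq_is_derive (f := fun=> 0) _ (der_cst s 0)).
  near=> u; rewrite ppow_le0//; apply/ltW; near: u; exact: lt_nbhsl.
- rewrite ppow_ge0 ?ltW//.
  notypeclasses refine (near_eq_is_derive (f := fun u : R => u ^+ k.+2) _ _).
    near=> u; rewrite ppow_ge0//; apply/ltW; near: u; exact: lt_nbhsr.
  by der_to; [der|rewrite mulr1].
- rewrite s0 ppow_le0// mulr0.
  have h : (fun h : R => h^-1 *: ((ppow k.+2 \o shift 0) (h *: 1) - ppow k.+2 0)) @ 0^'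
      --> (0 : R).
    apply: (@cvg_trans _ (ppow k.+1 @ 0^')).
      apply: near_eq_cvg; near=> h.
      rewrite /= [ppow _ 0]ppow_le0// subr0 addr0 /GRing.scale/= mulr1.
      have h0 : h != 0 by near: h; exact: nbhs_dnbhs_neq.
      have [h1|h1] := leP h 0; first by rewrite !ppow_le0// mulr0.
      by rewrite !ppow_ge0 ?ltW// (exprS h k.+1) mulrA mulVf// mul1r.
    have := @continuous_ppow k.+1 0; rewrite /continuous_at ppow_le0// => c.
    exact: cvg_within_filter.
  by split; [exact: cvgP h|exact: cvg_lim h].
Unshelve. all: by end_near. Qed.

(* Third differences of truncated powers: [step] is a cubic spline of class [C^2]
   rising from [0] on [s <= 0] to [1] on [3 <= s], with derivatives [step1], [step2]
   and antiderivative [ramp]. *)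
Definition step s := (ppow 3 s - 3 * ppow 3 (s - 1) + 3 * ppow 3 (s - 2) - ppow 3 (s - 3)) / 6.
Definition step1 s := (ppow 2 s - 3 * ppow 2 (s - 1) + 3 * ppow 2 (s - 2) - ppow 2 (s - 3)) / 2.
Definition step2 s := ppow 1 s - 3 * ppow 1 (s - 1) + 3 * ppow 1 (s - 2) - ppow 1 (s - 3).
Definition ramp s := (ppow 4 s - 3 * ppow 4 (s - 1) + 3 * ppow 4 (s - 2) - ppow 4 (s - 3)) / 24.

Lemma der_third_difference k (c s : R) :
  is_derive s 1 (fun s => (ppow k.+2 s - 3 * ppow k.+2 (s - 1) +
     3 * ppow k.+2 (s - 2) - ppow k.+2 (s - 3)) / c)
   (k.+2%:R * (ppow k.+1 s - 3 * ppow k.+1 (s - 1) +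
     3 * ppow k.+1 (s - 2) - ppow k.+1 (s - 3)) / c).
Proof.
have d (a : R) : is_derive s 1 (fun s => ppow k.+2 (s - a)) (k.+2%:R * ppow k.+1 (s - a)).
  notypeclasses refine (is_derive_eq
    (der_comp (g := fun s => s - a) (der_ppow k (s - a)) (der_add (der_id s) (der_opp (der_cst s a)))) _).
  by rewrite subr0 mulr1.
notypeclasses refine (is_derive_eq (der_mul (der_add (der_add (der_add (der_ppow k s)
  (der_opp (der_mul (der_cst s 3) (d 1)))) (der_mul (der_cst s 3) (d 2)))
  (der_opp (d 3))) (der_cst s c^-1)) _).
by ring.
Qed.

Lemma der_step s : is_derive s 1 step (step1 s).
Proof.
notypeclasses refine (is_derive_eq (der_third_difference 1 6 s) _).
by rewrite /step1; field.
Qed.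

Lemma der_step1 s : is_derive s 1 step1 (step2 s).
Proof.
notypeclasses refine (is_derive_eq (der_third_difference 0 2 s) _).
by rewrite /step2; field.
Qed.

Lemma der_ramp s : is_derive s 1 ramp (step s).
Proof.
notypeclasses refine (is_derive_eq (der_third_difference 2 24 s) _).
by rewrite /step; field.
Qed.

Lemma step_pieces (Q : R -> Prop) :
  (forall s, s <= 0 -> Q s) -> (forall s, 0 <= s <= 1 -> Q s) ->
  (forall s, 1 <= s <= 2 -> Q s) -> (forall s, 2 <= s <= 3 -> Q s) ->
  (forall s, 3 <= s -> Q s) -> forall s, Q s.
Proof.
move=> q0 q1 q2 q3 q4 s.
have [|s0] := leP s 0; first exact: q0.
have [s1|s1] := leP s 1; first by apply: q1; rewrite s1 ltW.
have [s2|s2] := leP s 2; first by apply: q2; rewrite s2 ltW.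
have [s3|s3] := leP s 3; first by apply: q3; rewrite s3 ltW.
by apply: q4; rewrite ltW.
Qed.

Lemma step1_ge0 s : 0 <= step1 s.
Proof.
rewrite /step1; elim/step_pieces: s => s hs.
- by rewrite !ppow_le0; lra.
- by rewrite (ppow_ge0 2) ?ppow_le0; [nra|lra..].
- by rewrite (@ppow_ge0 2 s) ?(@ppow_ge0 2 (s - 1)) ?ppow_le0; [nra|lra..].
- rewrite (@ppow_ge0 2 s) ?(@ppow_ge0 2 (s - 1)) ?(@ppow_ge0 2 (s - 2)) ?ppow_le0; [|lra..].
  by have := sqr_ge0 (s - 3); lra.
- by rewrite !ppow_ge0; lra.
Qed.

Lemma step1_le1 s : step1 s <= 1.
Proof.
rewrite /step1; elim/step_pieces: s => s hs.
- by rewrite !ppow_le0; lra.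
- by rewrite (ppow_ge0 2) ?ppow_le0; [nra|lra..].
- rewrite (@ppow_ge0 2 s) ?(@ppow_ge0 2 (s - 1)) ?ppow_le0; [|lra..].
  by have := sqr_ge0 (s - 3 / 2); lra.
- rewrite (@ppow_ge0 2 s) ?(@ppow_ge0 2 (s - 1)) ?(@ppow_ge0 2 (s - 2)) ?ppow_le0; [|lra..].
  by nra.
- by rewrite !ppow_ge0; lra.
Qed.

Lemma step2_norm_le1 s : `|step2 s| <= 2.
Proof.
rewrite /step2 ler_norml; elim/step_pieces: s => s hs.
- by rewrite !ppow_le0; lra.
- by rewrite (ppow_ge0 1) ?ppow_le0; [lra|lra..].
- by rewrite (@ppow_ge0 1 s) ?(@ppow_ge0 1 (s - 1)) ?ppow_le0; [lra|lra..].
- by rewrite (@ppow_ge0 1 s) ?(@ppow_ge0 1 (s - 1)) ?(@ppow_ge0 1 (s - 2)) ?ppow_le0; [lra|lra..].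
- by rewrite !ppow_ge0; lra.
Qed.

Lemma step_le0 s : s <= 0 -> step s = 0.
Proof. by move=> s0; rewrite /step !ppow_le0; lra. Qed.

Lemma step_ge3 s : 3 <= s -> step s = 1.
Proof. by move=> s0; rewrite /step !ppow_ge0; try lra; field. Qed.

Lemma step1_le0 s : s <= 0 -> step1 s = 0.
Proof. by move=> s0; rewrite /step1 !ppow_le0; lra. Qed.

Lemma step1_ge3 s : 3 <= s -> step1 s = 0.
Proof. by move=> s0; rewrite /step1 !ppow_ge0; try lra; field. Qed.

Lemma step2_le0 s : s <= 0 -> step2 s = 0.
Proof. by move=> s0; rewrite /step2 !ppow_le0; lra. Qed.

Lemma ramp_le0 s : s <= 0 -> ramp s = 0.
Proof. by move=> s0; rewrite /ramp !ppow_le0; lra. Qed.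

Lemma step_ge0 s : 0 <= step s.
Proof.
have [s0|s0] := leP s 0; first by rewrite step_le0.
have [c _] := derive_increment (ltW s0) der_step.
rewrite (step_le0 (lexx 0)) !subr0 => ->.
by rewrite mulr_ge0 ?step1_ge0// ltW.
Qed.

Lemma step_le1 s : step s <= 1.
Proof.
have [s3|s3] := leP 3 s; first by rewrite step_ge3.
have [c _] := derive_increment (ltW s3) der_step.
rewrite (step_ge3 (lexx 3)) => h.
by rewrite -subr_ge0 h mulr_ge0 ?step1_ge0// subr_ge0 ltW.
Qed.

Lemma ramp_ge0 s : 0 <= ramp s.
Proof.
have [s0|s0] := leP s 0; first by rewrite ramp_le0.
have [c _] := derive_increment (ltW s0) der_ramp.
rewrite (ramp_le0 (lexx 0)) !subr0 => ->.
by rewrite mulr_ge0 ?step_ge0// ltW.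
Qed.

Lemma ramp_le s : ramp s <= Num.max s 0.
Proof.
have [s0|s0] := leP s 0; first by rewrite ramp_le0.
have [c _] := derive_increment (ltW s0) der_ramp.
rewrite (ramp_le0 (lexx 0)) !subr0 => ->.
by rewrite ler_piMl ?step_le1// ltW.
Qed.

Lemma step_decrement_le s (h : R) : 0 <= h -> step s - step (s - h) <= h.
Proof.
move=> h0; have [|c _ ->] := @derive_increment _ step step1 (s - h) s _ der_step.
  by rewrite gerBl.
by rewrite opprB addrC subrK ler_piMl// step1_le1.
Qed.

Lemma step_decrement_ge0 s (h : R) : 0 <= h -> 0 <= step s - step (s - h).
Proof.
move=> h0; have [|c _ ->] := @derive_increment _ step step1 (s - h) s _ der_step.
  by rewrite gerBl.
by rewrite opprB addrC subrK mulr_ge0// step1_ge0.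
Qed.

(** A Taylor estimate: the mean value theorem is applied to [step] and then to [step1], whose
    derivative is bounded by [2]. *)
Lemma step_decrement_ge s (h : R) : 0 <= h ->
  h * step1 s <= step s - step (s - h) + 2 * h ^+ 2.
Proof.
move=> h0; have [|c /andP[c1 c2] ->] := @derive_increment _ step step1 (s - h) s _ der_step.
  by rewrite gerBl.
have -> : s - (s - h) = h by ring.
have [d _ E] := derive_increment c2 der_step1.
have := step2_norm_le1 d; rewrite ler_norml => /andP[_ hd].
have : step1 s - step1 c <= 2 * h.
  rewrite E; have : 0 <= s - c by rewrite subr_ge0.
  by nra.
by nra.
Qed.

Lemma continuous_step : continuous step.
Proof.
move=> s; apply: differentiable_continuous; apply/derivable1_diffP.
by have [] := der_step s.
Qed.

Lemma continuous_step1 : continuous step1.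
Proof.
move=> s; apply: differentiable_continuous; apply/derivable1_diffP.
by have [] := der_step1 s.
Qed.

Lemma continuous_ramp : continuous ramp.
Proof.
move=> s; apply: differentiable_continuous; apply/derivable1_diffP.
by have [] := der_ramp s.
Qed.

Lemma continuous_step2 : continuous step2.
Proof.
have c k (a : R) : continuous (fun s => ppow k (s - a)).
  move=> s; apply: (@continuous_comp _ _ _ (fun s => s - a)); last exact: continuous_ppow.
  by apply: cvgB; [exact: cvg_id|exact: cvg_cst].
move=> s; apply: cvgB; last exact: c.
apply: cvgD; last by apply: cvgM; [exact: cvg_cst|exact: c].
apply: cvgB; first exact: continuous_ppow.
by apply: cvgM; [exact: cvg_cst|exact: c].
Qed.

End spline_step.

Section real_lemmas.
Context {R : realType}.

(** Optimisation in [a], with [a = P / D]. It turns a pointwise Young inequality, integrated for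
    each [a], into the Cauchy-Schwarz inequality. *)
Lemma cauchy_schwarz_of_young (P D b : R) : 0 <= P -> 0 <= D -> 0 <= b ->
  (forall a, 0 < a -> 2 * P <= a * D + b / a) -> P ^+ 2 <= D * b.
Proof.
move=> P0 D0 b0 H; have [->|Pn0] := eqVneq P 0; first by rewrite expr0n mulr_ge0.
have Pp : 0 < P by rewrite lt_def Pn0.
have [D00|Dn0] := eqVneq D 0.
  (* With [D = 0] this [a] would give [2 P <= P b / (b + 1) <= P], which is impossible for
     [P > 0]. *)
  have a0 : 0 < (b + 1) / P by rewrite divr_gt0//; lra.
  have := H _ a0; rewrite D00 mulr0 add0r invf_div mulrCA => h.
  suff : P * (b / (b + 1)) <= P by lra.
  by rewrite ler_piMr// ler_pdivrMr; lra.
have Dp : 0 < D by rewrite lt_def Dn0.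
have := H (P / D); rewrite divr_gt0// => /(_ isT).
rewrite divfK ?gt_eqF// invf_div mulrA => h.
have : P <= b * D / P by lra.
by rewrite ler_pdivlMr// -expr2 mulrC.
Qed.

(** The choice [l = pi / Q] is the optimal one when [m] is the area of a disc of perimeter [Q], so
    the constant stays sharp. [N] stands for the loss caused by the cutoff. *)
Lemma isoperimetric_quadratic (m N Q : R) : 0 <= Q -> 0 <= N ->
  (forall l, 0 < l -> 2 * pi * (m - N) <= (l * m + pi / (4 * l)) * Q) ->
  4 * pi * m <= Q ^+ 2 + 8 * pi * N.
Proof.
have pi0 := pi_gt0 R.
move=> Q0 N0 H; have [E|Qn0] := eqVneq Q 0.
  have := H 1 ltr01; rewrite E mulr0 expr0n/= => h.
  have : 0 <= pi * N by rewrite mulr_ge0// ltW.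
  by lra.
have Qp : 0 < Q by rewrite lt_def Qn0.
have := H (pi / Q); rewrite divr_gt0// => /(_ isT).
have F (q : R) : 0 < q -> (q / Q * m + q / (4 * (q / Q))) * Q = q * m + Q ^+ 2 / 4.
  by move=> q0; field; rewrite (gt_eqF Qp) (gt_eqF q0).
rewrite F//.
by lra.
Qed.

Lemma sqrt_triangle (a b c d : R) :
  Num.sqrt ((a + b) ^+ 2 + (c + d) ^+ 2) <=
  Num.sqrt (a ^+ 2 + c ^+ 2) + Num.sqrt (b ^+ 2 + d ^+ 2).
Proof.
set x := Num.sqrt (a ^+ 2 + c ^+ 2); set y := Num.sqrt (b ^+ 2 + d ^+ 2).
have x0 : 0 <= x by exact: sqrtr_ge0.
have y0 : 0 <= y by exact: sqrtr_ge0.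
have x2 : x ^+ 2 = a ^+ 2 + c ^+ 2 by rewrite sqr_sqrtr// addr_ge0// sqr_ge0.
have y2 : y ^+ 2 = b ^+ 2 + d ^+ 2 by rewrite sqr_sqrtr// addr_ge0// sqr_ge0.
rewrite -[leRHS]ger0_norm ?addr_ge0// -sqrtr_sqr; apply: ler_wsqrtr.
suff : a * b + c * d <= x * y.
  by lra.
have [h|h] := leP (a * b + c * d) 0; first by rewrite (le_trans h)// mulr_ge0.
rewrite -(@ler_pXn2r _ 2)// ?nnegrE ?mulr_ge0// ?(ltW h)//.
rewrite exprMn x2 y2.
by have := sqr_ge0 (a * d - b * c); lra.
Qed.

End real_lemmas.

(** * Flux and isoperimetry of the smoothed level sets *)

Section level_sets.
Context {R : realType}.
Local Notation I := plane_integral.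
Variables (v v1 v2 v11 v22 : R * R -> R).
Hypotheses (dv1 : has_d1 v v1) (dv2 : has_d2 v v2).
Hypotheses (dv11 : has_d1 v1 v11) (dv22 : has_d2 v2 v22).
Hypotheses (cv : continuous v) (cv1 : continuous v1) (cv2 : continuous v2).
Hypotheses (cv11 : continuous v11) (cv22 : continuous v22).
(** In the application [zeta] is a cutoff supported in a disc, [beta] the indicator of the disc and
    [omega] that of an annulus containing all points where [zeta] varies. The gradient of [zeta] has
    to be paid for by [omega]; its Laplacian comes with a factor [exp (- 2 t)] and may be paid for
    by [beta]. *)
Variables (zeta z1 z2 z11 z22 beta omega : R * R -> R).
Hypotheses (dz1 : has_d1 zeta z1) (dz2 : has_d2 zeta z2).
Hypotheses (dz11 : has_d1 z1 z11) (dz22 : has_d2 z2 z22).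
Hypotheses (cz : continuous zeta) (cz1 : continuous z1) (cz2 : continuous z2).
Hypotheses (cz11 : continuous z11) (cz22 : continuous z22).
Hypotheses (sz : bounded_support zeta) (sz1 : bounded_support z1)
  (sz2 : bounded_support z2) (sz11 : bounded_support z11) (sz22 : bounded_support z22).
Hypotheses (nbeta : nice beta) (nomega : nice omega).
Hypothesis zeta01 : forall x, 0 <= zeta x <= 1.
Hypothesis zeta_beta : forall x, zeta x <= beta x.
Hypothesis omega_ge0 : forall x, 0 <= omega x.
Hypothesis omega_beta : forall x, omega x <= beta x.
Hypothesis zeta_omega : forall x, zeta x - zeta x ^+ 2 <= omega x.
Variable C : R.
Hypothesis C0 : 0 <= C.
Hypothesis grad_zeta : forall x, Num.sqrt (z1 x ^+ 2 + z2 x ^+ 2) <= C * omega x.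
Hypothesis lap_zeta : forall x, `|z11 x + z22 x| <= C * beta x.

Variable H : R.
Hypothesis H0 : 0 < H.

(* [level t] is a smooth version of the indicator of [{v > t}]: it vanishes where
   [v <= t] and equals [1] where [t + 3 H <= v]. *)
Definition level (t : R) x := step ((v x - t) / H).
Definition dlevel (t : R) x := step1 ((v x - t) / H) / H.
(** A smooth version of the positive part of [v - t]. Its gradient is [level t] times that of [v],
    which allows one more integration by parts onto the cutoff. *)
Definition plevel (t : R) x := H * ramp ((v x - t) / H).

Lemma der_level_arg (f : R -> R) (t x a : R) : is_derive x 1 f a ->
  is_derive x 1 (fun s => (f s - t) / H) (a / H).
Proof.
move=> df; notypeclasses refine (is_derive_eq
  (der_mul (der_add df (der_opp (der_cst x t))) (der_cst x H^-1)) _).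
by rewrite subr0 mulr0 addr0.
Qed.

Lemma level_d1 t : has_d1 (level t) (fun x => dlevel t x * v1 x).
Proof.
move=> a b; notypeclasses refine (is_derive_eq
  (der_comp (g := fun s => (v (s, b) - t) / H) (der_step _) (der_level_arg t (dv1 a b))) _).
by rewrite /dlevel mulrA mulrAC.
Qed.

Lemma level_d2 t : has_d2 (level t) (fun x => dlevel t x * v2 x).
Proof.
move=> a b; notypeclasses refine (is_derive_eq
  (der_comp (g := fun s => (v (a, s) - t) / H) (der_step _) (der_level_arg t (dv2 a b))) _).
by rewrite /dlevel mulrA mulrAC.
Qed.

Lemma plevel_d1 t : has_d1 (plevel t) (fun x => level t x * v1 x).
Proof.
move=> a b; notypeclasses refine (is_derive_eq (der_mul (der_cst _ H)
  (der_comp (g := fun s => (v (s, b) - t) / H) (der_ramp _) (der_level_arg t (dv1 a b)))) _).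
by rewrite /level; field; rewrite gt_eqF.
Qed.

Lemma plevel_d2 t : has_d2 (plevel t) (fun x => level t x * v2 x).
Proof.
move=> a b; notypeclasses refine (is_derive_eq (der_mul (der_cst _ H)
  (der_comp (g := fun s => (v (a, s) - t) / H) (der_ramp _) (der_level_arg t (dv2 a b)))) _).
by rewrite /level; field; rewrite gt_eqF.
Qed.

Lemma continuous_level_arg t : continuous (fun x => (v x - t) / H).
Proof.
move=> x; apply: cvgM; last exact: cvg_cst.
by apply: cvgB; [exact: cv|exact: cvg_cst].
Qed.

Lemma continuous_level t : continuous (level t).
Proof.
move=> x; apply: (@continuous_comp _ _ _ (fun x => (v x - t) / H) step).
  exact: continuous_level_arg.
exact: continuous_step.
Qed.

Lemma continuous_dlevel t : continuous (dlevel t).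
Proof.
move=> x; apply: cvgM; last exact: cvg_cst.
apply: (@continuous_comp _ _ _ (fun x => (v x - t) / H) step1).
  exact: continuous_level_arg.
exact: continuous_step1.
Qed.

Lemma continuous_plevel t : continuous (plevel t).
Proof.
move=> x; apply: cvgM; first exact: cvg_cst.
apply: (@continuous_comp _ _ _ (fun x => (v x - t) / H) ramp).
  exact: continuous_level_arg.
exact: continuous_ramp.
Qed.

Lemma level_ge0 t x : 0 <= level t x. Proof. exact: step_ge0. Qed.
Lemma level_le1 t x : level t x <= 1. Proof. exact: step_le1. Qed.
Lemma dlevel_ge0 t x : 0 <= dlevel t x.
Proof. by rewrite /dlevel divr_ge0 ?step1_ge0// ltW. Qed.

Lemma level_eq0 t x : v x <= t -> level t x = 0.
Proof. by move=> h; rewrite /level step_le0// pmulr_lle0 ?invr_gt0// subr_le0. Qed.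

Lemma dlevel_eq0 t x : v x <= t -> dlevel t x = 0.
Proof. by move=> h; rewrite /dlevel step1_le0 ?mul0r// pmulr_lle0 ?invr_gt0// subr_le0. Qed.

Lemma level_eq1 t x : t + 3 * H <= v x -> level t x = 1.
Proof. by move=> h; rewrite /level step_ge3// ler_pdivlMr//; lra. Qed.

Lemma level_expR_le t x : expR (2 * t) * level t x <= expR (2 * v x).
Proof.
have [h|h] := leP (v x) t; first by rewrite level_eq0// mulr0 expR_ge0.
apply: (@le_trans _ _ (expR (2 * t))); first by rewrite ler_piMr ?expR_ge0// level_le1.
by rewrite ler_expR; lra.
Qed.

Lemma dlevel_expR_le t x : expR (2 * t) * dlevel t x <= dlevel t x * expR (2 * v x).
Proof.
have [h|h] := leP (v x) t; first by rewrite dlevel_eq0// mulr0 mul0r.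
by rewrite mulrC ler_wpM2l ?dlevel_ge0// ler_expR; lra.
Qed.

Lemma plevel_ge0 t x : 0 <= plevel t x.
Proof. by rewrite mulr_ge0 ?ramp_ge0// ltW. Qed.

(** From [y <= exp (2 y)] at [y = v - t]. The factor [exp (- 2 t)] makes the error due to the
    Laplacian of the cutoff small at high levels. *)
Lemma plevel_expR_le t x : plevel t x <= expR (- (2 * t)) * expR (2 * v x).
Proof.
rewrite -expRD; apply: (@le_trans _ _ (Num.max (v x - t) 0)).
  apply: (@le_trans _ _ (H * Num.max ((v x - t) / H) 0)).
    by rewrite ler_pM2l// ramp_le.
  by rewrite (maxr_pMr _ _ (ltW H0)) mulr0 mulrCA divff ?gt_eqF// mulr1.
rewrite ge_max expR_ge0 andbT.
have := expR_ge1Dx (- (2 * t) + 2 * v x).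
have := expR_ge0 (- (2 * t) + 2 * v x).
have [|] := leP 0 (v x - t); lra.
Qed.

Let cexp : continuous (fun x => expR (2 * v x)).
Proof.
move=> x; apply: (@continuous_comp _ _ _ (fun x => 2 * v x) expR); last exact: continuous_expR.
by apply: cvgM; [exact: cvg_cst|exact: cv].
Qed.

Let nz : nice zeta. Proof. by split => //; exact: lbm_continuous. Qed.
Let nzc (f : R * R -> R) : continuous f -> nice (fun x => zeta x * f x).
Proof. by move=> cf; apply: niceM => //; exact: lbm_continuous. Qed.
Let beta_ge0 x : 0 <= beta x.
Proof. by apply: le_trans (zeta_beta x); case/andP: (zeta01 x). Qed.

Let grad2 x := v1 x ^+ 2 + v2 x ^+ 2.
Let cgrad2 : continuous grad2.
Proof. by apply: continuousD2; under eq_fun do rewrite expr2; exact: continuousM2. Qed.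
Let cgrad : continuous (fun x => Num.sqrt (grad2 x)).
Proof.
move=> x; apply: (@continuous_comp _ _ _ grad2); last exact: sqrt_continuous.
exact: cgrad2.
Qed.

(** Integrating [zeta grad v . grad (level t)] by parts gives the term with the Laplacian of [v] and
    a cross term [- level t (grad zeta . grad v)]. The latter is [- grad zeta . grad (plevel t)],
    and a second integration by parts removes the derivatives of [v] from it. *)
Lemma flux t :
  I (fun x => zeta x * (dlevel t x * grad2 x)) =
  I (fun x => zeta x * (level t x * - (v11 x + v22 x))) +
  I (fun x => plevel t x * (z11 x + z22 x)).
Proof.
have cl := @continuous_level t; have cdl := @continuous_dlevel t.
have cpl := @continuous_plevel t.
have nzz (f g : R * R -> R) : continuous f -> bounded_support f -> continuous g ->
    nice (fun x => f x * g x).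
  by move=> cf sf cg; apply: niceM; [split => //|]; exact: lbm_continuous.
have e1 : I (fun x => zeta x * (dlevel t x * v1 x ^+ 2)) =
   I (fun x => zeta x * (level t x * - v11 x)) + I (fun x => z11 x * plevel t x).
  rewrite (plane_by_parts1 dz11 (plevel_d1 t))//; last exact: continuousM2.
  have := plane_by_parts1 (has_d1M dz1 dv11) (level_d1 t).
  rewrite -(_ : I (fun x => z1 x * v1 x * level t x) + I (fun x => zeta x * (level t x * v11 x)) =
    I (fun z => (z1 z * v1 z + zeta z * v11 z) * level t z)); last first.
    rewrite -planeD; last 2 first.
    - by under eq_fun do rewrite -mulrA; apply: nzz => //; exact: continuousM2.
    - by apply: nzz => //; exact: continuousM2.
    by congr plane_integral; apply/funext => x; ring.
  move=> h.
  have {}h : I (fun x => z1 x * v1 x * level t x) + I (fun x => zeta x * (level t x * v11 x)) =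
     - I (fun z => zeta z * v1 z * (dlevel t z * v1 z)).
    apply: h; rewrite //; try exact: continuousM2.
    - by apply: continuousD2; exact: continuousM2.
    - exact: bounded_supportM.
    - by apply: bounded_supportD; exact: bounded_supportM.
  rewrite (_ : I (fun x => zeta x * (dlevel t x * v1 x ^+ 2)) =
     I (fun z => zeta z * v1 z * (dlevel t z * v1 z))); last first.
    by congr plane_integral; apply/funext => x; ring.
  rewrite (_ : I (fun x => zeta x * (level t x * - v11 x)) =
     - I (fun x => zeta x * (level t x * v11 x))); last first.
    rewrite -mulN1r -planeZ; last by apply: nzz => //; exact: continuousM2.
    by congr plane_integral; apply/funext => x; ring.
  rewrite (_ : I (fun x => z1 x * (level t x * v1 x)) = I (fun x => z1 x * v1 x * level t x)).
    by lra.
  by congr plane_integral; apply/funext => x; ring.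
have e2 : I (fun x => zeta x * (dlevel t x * v2 x ^+ 2)) =
   I (fun x => zeta x * (level t x * - v22 x)) + I (fun x => z22 x * plevel t x).
  rewrite (plane_by_parts2 dz22 (plevel_d2 t))//; last exact: continuousM2.
  have := plane_by_parts2 (has_d2M dz2 dv22) (level_d2 t).
  rewrite -(_ : I (fun x => z2 x * v2 x * level t x) + I (fun x => zeta x * (level t x * v22 x)) =
    I (fun z => (z2 z * v2 z + zeta z * v22 z) * level t z)); last first.
    rewrite -planeD; last 2 first.
    - by under eq_fun do rewrite -mulrA; apply: nzz => //; exact: continuousM2.
    - by apply: nzz => //; exact: continuousM2.
    by congr plane_integral; apply/funext => x; ring.
  move=> h.
  have {}h : I (fun x => z2 x * v2 x * level t x) + I (fun x => zeta x * (level t x * v22 x)) =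
     - I (fun z => zeta z * v2 z * (dlevel t z * v2 z)).
    apply: h; rewrite //; try exact: continuousM2.
    - by apply: continuousD2; exact: continuousM2.
    - exact: bounded_supportM.
    - by apply: bounded_supportD; exact: bounded_supportM.
  rewrite (_ : I (fun x => zeta x * (dlevel t x * v2 x ^+ 2)) =
     I (fun z => zeta z * v2 z * (dlevel t z * v2 z))); last first.
    by congr plane_integral; apply/funext => x; ring.
  rewrite (_ : I (fun x => zeta x * (level t x * - v22 x)) =
     - I (fun x => zeta x * (level t x * v22 x))); last first.
    rewrite -mulN1r -planeZ; last by apply: nzz => //; exact: continuousM2.
    by congr plane_integral; apply/funext => x; ring.
  rewrite (_ : I (fun x => z2 x * (level t x * v2 x)) = I (fun x => z2 x * v2 x * level t x)).
    by lra.
  by congr plane_integral; apply/funext => x; ring.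
have csq (f : R * R -> R) : continuous f -> continuous (fun x => f x ^+ 2).
  by move=> cf; under eq_fun do rewrite expr2; exact: continuousM2.
transitivity (I (fun x => zeta x * (dlevel t x * v1 x ^+ 2)) +
    I (fun x => zeta x * (dlevel t x * v2 x ^+ 2))).
  rewrite -planeD; [|by apply: nzc; apply: continuousM2 => //; exact: csq..].
  by congr plane_integral; apply/funext => x; rewrite /grad2; ring.
rewrite e1 e2 addrACA; congr (_ + _).
  rewrite -planeD; [|by apply: nzc; apply: continuousM2 => //; exact: continuousN2..].
  by congr plane_integral; apply/funext => x; ring.
rewrite -planeD; [|exact: nzz..].
by congr plane_integral; apply/funext => x; ring.
Qed.

Variables (gam : R) (k : R * R -> R).
Hypothesis gam1 : 1 < gam.
Hypotheses (lk : locally_bounded_measurable k) (k0 : forall x, 0 <= k x).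
Hypothesis curv : forall x, - (v11 x + v22 x) <= gam * expR (2 * v x) + k x.

(** [level_mass], [level_volume] and [level_rate] are the smoothed and localised forms of [m], [A]
    and [- A']; [level_error] and [total_volume] measure the cost of the cutoff. *)
Definition level_mass t := I (fun x => zeta x * level t x).
Definition level_volume t := I (fun x => zeta x * (level t x * expR (2 * v x))).
Definition level_rate t := I (fun x => zeta x * (dlevel t x * expR (2 * v x))).
Definition level_error t := I (fun x => omega x * level t x).
Definition total_volume := I (fun x => beta x * expR (2 * v x)).
Local Notation m := level_mass.
Local Notation B := level_volume.
Local Notation b := level_rate.
Local Notation N := level_error.
Local Notation M := total_volume.

Lemma nice_continuous_mul (f g : R * R -> R) : nice f -> continuous g ->
  nice (fun x => f x * g x).
Proof. by move=> nf cg; apply: niceM => //; exact: lbm_continuous. Qed.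
Local Notation nc := nice_continuous_mul.

Lemma continuous_level_exp t : continuous (fun x => level t x * expR (2 * v x)).
Proof. by apply: continuousM2 => //; exact: continuous_level. Qed.

Lemma continuous_dlevel_exp t : continuous (fun x => dlevel t x * expR (2 * v x)).
Proof. by apply: continuousM2 => //; exact: continuous_dlevel. Qed.

Let cl := continuous_level.
Let cdl := continuous_dlevel.
Let cle := continuous_level_exp.
Let cdle := continuous_dlevel_exp.
Let zeta_ge0 x : 0 <= zeta x. Proof. by case/andP: (zeta01 x). Qed.
Let zeta_le1 x : zeta x <= 1. Proof. by case/andP: (zeta01 x). Qed.

Lemma level_error_ge0 t : 0 <= N t.
Proof. by apply: plane_ge0 => x; rewrite mulr_ge0// level_ge0. Qed.

Lemma level_error_le t : expR (2 * t) * N t <= I (fun x => omega x * expR (2 * v x)).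
Proof.
rewrite -planeZ; last exact: nc.
apply: le_plane; [by apply: niceZ; exact: nc|exact: nc|move=> x].
by rewrite mulrCA ler_wpM2l// level_expR_le.
Qed.

Lemma omega_volume_le : I (fun x => omega x * expR (2 * v x)) <= M.
Proof.
by apply: le_plane => [| |x]; [exact: nc|exact: nc|rewrite ler_wpM2r// expR_ge0].
Qed.

Lemma flux_le t : I (fun x => zeta x * (dlevel t x * grad2 x)) <=
  gam * B t + I (fun x => beta x * k x) + C * expR (- (2 * t)) * M.
Proof.
rewrite flux; apply: lerD.
  rewrite -planeZ; last exact: nc.
  have nk : nice (fun x => beta x * k x) by exact: niceM.
  rewrite -planeD//; last by apply: niceZ; exact: nc.
  apply: le_plane.
  - by apply: nc => //; apply: continuousM2 => //; apply: continuousN2; exact: continuousD2.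
  - by apply: niceD => //; apply: niceZ; exact: nc.
  move=> x; have l0 := level_ge0 t x; have l1 := level_le1 t x.
  apply: (@le_trans _ _ (zeta x * (level t x * (gam * expR (2 * v x) + k x)))).
    by rewrite ler_wpM2l// ler_wpM2l.
  rewrite !mulrDr; apply: lerD; first by rewrite le_eqVlt; apply/orP; left; apply/eqP; ring.
  rewrite mulrA ler_wpM2r//; apply: le_trans (zeta_beta x).
  by rewrite ler_piMr.
rewrite -planeZ; last exact: nc.
apply: le_plane.
- apply: niceMl; last by apply: niceD; split => //; exact: lbm_continuous.
  by apply: lbm_continuous; exact: continuous_plevel.
- by apply: niceZ; exact: nc.
move=> x; apply: (@le_trans _ _ (plevel t x * (C * beta x))).
  by apply: ler_wpM2l; [exact: plevel_ge0|exact: le_trans (ler_norm _) (lap_zeta x)].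
have := ler_wpM2r (mulr_ge0 C0 (beta_ge0 x)) (plevel_expR_le t x).
by move=> /le_trans; apply; rewrite le_eqVlt; apply/orP; left; apply/eqP; ring.
Qed.

(** [P] replaces the length of the level curve and [D] the flux of [grad v] through it, both
    averaged over the levels between [t] and [t + 3 H]. *)
Let P t := I (fun x => zeta x * (dlevel t x * Num.sqrt (grad2 x))).
Let D t := I (fun x => zeta x * (dlevel t x * grad2 x)).

Lemma grad_bound_sq t : P t ^+ 2 <= D t * I (fun x => zeta x * dlevel t x).
Proof.
have g0 x : 0 <= grad2 x by rewrite addr_ge0// sqr_ge0.
have d0 x := dlevel_ge0 t x.
apply: cauchy_schwarz_of_young.
- by apply: plane_ge0 => x; rewrite mulr_ge0// mulr_ge0// sqrtr_ge0.
- by apply: plane_ge0 => x; rewrite mulr_ge0// mulr_ge0.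
- by apply: plane_ge0 => x; rewrite mulr_ge0.
move=> a a0; rewrite [_ / a]mulrC.
have n1 : nice (fun x => zeta x * (dlevel t x * Num.sqrt (grad2 x))).
  by apply: nc => //; exact: continuousM2.
have n2 : nice (fun x => zeta x * (dlevel t x * grad2 x)).
  by apply: nc => //; exact: continuousM2.
have n3 : nice (fun x => zeta x * dlevel t x) by exact: nc.
rewrite /P /D -(planeZ 2 n1) -(planeZ a n2) -(planeZ a^-1 n3) -(planeD (niceZ a n2) (niceZ a^-1 n3)).
apply: le_plane; [exact: niceZ|by apply: niceD; exact: niceZ|].
move=> x; set w := Num.sqrt _; have w2 : grad2 x = w ^+ 2 by rewrite sqr_sqrtr.
have -> : 2 * (zeta x * (dlevel t x * w)) = (zeta x * dlevel t x) * (2 * w) by ring.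
have -> : a * (zeta x * (dlevel t x * grad2 x)) + a^-1 * (zeta x * dlevel t x) =
  (zeta x * dlevel t x) * (a * w ^+ 2 + a^-1) by rewrite w2; ring.
apply: ler_wpM2l; first exact: mulr_ge0.
have : 0 <= a^-1 * (a * w - 1) ^+ 2 by rewrite mulr_ge0 ?sqr_ge0// invr_ge0 ltW.
have -> : a^-1 * (a * w - 1) ^+ 2 = a * w ^+ 2 + a^-1 - 2 * w by field; rewrite gt_eqF.
by rewrite subr_ge0.
Qed.

(** [isoperimetric] is applied with [g] built from level [t + 3 H] and [phi] from level [t]. Where
    the former does not vanish [level t] equals [1], so that the product loses at most
    [zeta - zeta^2 <= omega], whence the term with [N]. The gradient of [zeta] adds at most [C N] to
    the perimeter. *)
Lemma level_isoperimetric t :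
  4 * pi * m (t + 3 * H) <= (P t + C * N t) ^+ 2 + 8 * pi * N t.
Proof.
have N0 := level_error_ge0 t.
have P0 : 0 <= P t.
  by apply: plane_ge0 => x; rewrite mulr_ge0// mulr_ge0 ?dlevel_ge0// sqrtr_ge0.
apply: isoperimetric_quadratic => //; first by rewrite addr_ge0// mulr_ge0.
move=> l l0; set t' := t + 3 * H.
pose phi1 x := z1 x * level t x + zeta x * (dlevel t x * v1 x).
pose phi2 x := z2 x * level t x + zeta x * (dlevel t x * v2 x).
have ng : nice (fun x => zeta x * level t' x) by exact: nc.
have g01 x : 0 <= zeta x * level t' x <= 1.
  by rewrite mulr_ge0 ?level_ge0//= mulr_ile1 ?level_ge0 ?level_le1.
have c1 : continuous phi1 by apply: continuousD2; apply: continuousM2 => //; exact: continuousM2.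
have c2 : continuous phi2 by apply: continuousD2; apply: continuousM2 => //; exact: continuousM2.
have s1 : bounded_support phi1 by apply: bounded_supportD; exact: bounded_supportM.
have s2 : bounded_support phi2 by apply: bounded_supportD; exact: bounded_supportM.
have c0 : continuous (fun x => zeta x * level t x) by exact: continuousM2.
have s0 : bounded_support (fun x => zeta x * level t x) by exact: bounded_supportM.
have p0 x : 0 <= zeta x * level t x by rewrite mulr_ge0// level_ge0.
have iso := isoperimetric (has_d1M dz1 (level_d1 t)) (has_d2M dz2 (level_d2 t))
  c0 c1 c2 s0 s1 s2 p0 ng g01 l0.
have ngr := nice_grad c1 c2 s1 s2.
have pi0 := pi_gt0 R.
have m0 : 0 <= m t' by apply: plane_ge0 => x; case/andP: (g01 x).
have h1 : m t' - N t <= I (fun x => zeta x * level t' x * (zeta x * level t x)).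
  rewrite -planeB//; last exact: nc.
  apply: le_plane; first by apply: niceB => //; exact: nc.
    by apply: nc.
  move=> x; have l1 := level_le1 t' x; have lp := level_ge0 t' x.
  have lt0 := level_ge0 t x.
  have [h|h] := leP (v x) t'; last first.
    have -> : level t x = 1 by rewrite level_eq1// ltW.
    have := ler_wpM2l lp (zeta_omega x).
    have : level t' x * omega x <= omega x by rewrite ler_piMl.
    by lra.
  by rewrite (level_eq0 h) !mulr0 mul0r sub0r oppr_le0 mulr_ge0.
have h2 : I (fun z => Num.sqrt (phi1 z ^+ 2 + phi2 z ^+ 2)) <= P t + C * N t.
  have n1 : nice (fun x => zeta x * (dlevel t x * Num.sqrt (grad2 x))).
    by apply: nc => //; exact: continuousM2.
  have n2 : nice (fun x => omega x * level t x) by exact: nc.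
  rewrite -planeZ// -planeD//; last exact: niceZ.
  apply: le_plane => //; first by apply: niceD => //; exact: niceZ.
  move=> x; apply: le_trans (sqrt_triangle _ _ _ _) _; rewrite addrC; apply: lerD.
    have -> : (zeta x * (dlevel t x * v1 x)) ^+ 2 + (zeta x * (dlevel t x * v2 x)) ^+ 2 =
       (zeta x * dlevel t x) ^+ 2 * grad2 x by rewrite /grad2; ring.
    have zd : 0 <= zeta x * dlevel t x by apply: mulr_ge0 => //; exact: dlevel_ge0.
    rewrite sqrtrM ?sqr_ge0// sqrtr_sqr (ger0_norm zd).
    by rewrite -mulrA.
  have -> : (z1 x * level t x) ^+ 2 + (z2 x * level t x) ^+ 2 =
       level t x ^+ 2 * (z1 x ^+ 2 + z2 x ^+ 2) by ring.
  rewrite sqrtrM ?sqr_ge0// sqrtr_sqr ger0_norm ?level_ge0//.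
  by rewrite mulrA mulrC ler_wpM2r ?level_ge0.
apply: le_trans (ler_wpM2l _ h1) _; first by rewrite mulr_ge0// ltW.
apply: le_trans iso _; apply: ler_wpM2l => //.
have l0' := ltW l0.
by apply: addr_ge0; [exact: mulr_ge0|apply: divr_ge0; [exact: ltW|exact: mulr_ge0]].
Qed.

(** Isoperimetry, Cauchy-Schwarz and the flux bound are chained and multiplied by [exp (2 t)]. The
    number [s] collects both flux errors; the second hypothesis bounds the contribution quadratic in
    [N] by one linear in [N]. *)
Lemma level_inequality (t s : R) :
  I (fun x => beta x * k x) + C * expR (- (2 * t)) * M <= s ->
  gam / (gam - 1) * C ^+ 2 * (expR (- (2 * t)) * M) <= 1 ->
  4 * pi * (expR (2 * t) * m (t + 3 * H)) <=
  gam * ((gam * B t + s) * b t) + (8 * pi + 1) * (expR (2 * t) * N t).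
Proof.
move=> hs hC.
have N0 := level_error_ge0 t.
have e0 := expR_gt0 (2 * t).
have g1 : 0 < gam - 1 by rewrite subr_gt0.
have D0 : 0 <= D t.
  apply: plane_ge0 => x; rewrite mulr_ge0// mulr_ge0 ?dlevel_ge0//.
  by rewrite addr_ge0// sqr_ge0.
have DB : D t <= gam * B t + s by apply: le_trans (flux_le t) _; rewrite -addrA lerD2l.
have b00 : 0 <= I (fun x => zeta x * dlevel t x).
  by apply: plane_ge0 => x; rewrite mulr_ge0// dlevel_ge0.
have bb : expR (2 * t) * I (fun x => zeta x * dlevel t x) <= b t.
  rewrite -planeZ; last exact: nc.
  apply: le_plane; [by apply: niceZ; exact: nc|exact: nc|move=> x].
  by rewrite mulrCA ler_wpM2l// dlevel_expR_le.
(* Young's inequality with weights that keep the coefficient of [P^2] down to [gam]. *)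
have Q1 : (P t + C * N t) ^+ 2 <= gam * P t ^+ 2 + gam / (gam - 1) * (C * N t) ^+ 2.
  have h : 0 <= (gam - 1)^-1 * ((gam - 1) * P t - C * N t) ^+ 2.
    by rewrite mulr_ge0 ?sqr_ge0// invr_ge0 ltW.
  rewrite -subr_ge0; apply: le_trans h _; rewrite le_eqVlt; apply/orP; left; apply/eqP.
  by field; rewrite gt_eqF.
have Q2 := grad_bound_sq t.
have NM : expR (2 * t) * N t <= M := le_trans (level_error_le t) omega_volume_le.
have h1 : gam * P t ^+ 2 * expR (2 * t) <= gam * ((gam * B t + s) * b t).
  rewrite -mulrA; apply: ler_wpM2l; first by lra.
  apply: le_trans (ler_wpM2r (ltW e0) Q2) _; rewrite -mulrA [_ * expR _]mulrC.
  by apply: ler_pM => //; rewrite mulr_ge0// ltW.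
have h2 : gam / (gam - 1) * (C * N t) ^+ 2 * expR (2 * t) <= expR (2 * t) * N t.
  have E : expR (- (2 * t)) * expR (2 * t) = 1 by rewrite -expRD addNr expR0.
  have NM' : N t <= expR (- (2 * t)) * M.
    have := ler_wpM2l (expR_ge0 (- (2 * t))) NM.
    by rewrite mulrA E mul1r.
  have c0 : 0 <= gam / (gam - 1) * C ^+ 2.
    by rewrite mulr_ge0 ?sqr_ge0// divr_ge0//; lra.
  have h : gam / (gam - 1) * C ^+ 2 * N t <= 1.
    by apply: le_trans hC; exact: ler_wpM2l.
  have -> : gam / (gam - 1) * (C * N t) ^+ 2 * expR (2 * t) =
     (gam / (gam - 1) * C ^+ 2 * N t) * (expR (2 * t) * N t) by ring.
  by rewrite ler_piMl// mulr_ge0// ltW.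
have := ler_wpM2r (ltW e0) (level_isoperimetric t); rewrite [leRHS]mulrDl => h4.
have := ler_wpM2r (ltW e0) Q1; rewrite [leRHS]mulrDl => h3.
have -> : 4 * pi * (expR (2 * t) * m (t + 3 * H)) = 4 * pi * m (t + 3 * H) * expR (2 * t).
  by ring.
apply: le_trans h4 _; apply: le_trans (lerD h3 (lexx _)) _.
have -> : (8 * pi + 1) * (expR (2 * t) * N t) = 8 * pi * N t * expR (2 * t) + expR (2 * t) * N t.
  by ring.
by lra.
Qed.

End level_sets.

(** * Summation over the levels *)

Section summation.
Context {R : realType}.
Local Notation I := plane_integral.
Variables (v zeta omega : R * R -> R).
Hypothesis cv : continuous v.
Hypotheses (nz : nice zeta) (nomega : nice omega).
Hypothesis zeta01 : forall x, 0 <= zeta x <= 1.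
Hypothesis omega_ge0 : forall x, 0 <= omega x.
Variables H gam s t0 : R.
Hypotheses (H0 : 0 < H) (gam0 : 0 <= gam) (s0 : 0 <= s).
Local Notation level := (level v H).
Local Notation dlevel := (dlevel v H).
Local Notation m := (level_mass v zeta H).
Local Notation B := (level_volume v zeta H).
Local Notation b := (level_rate v zeta H).
Local Notation N := (level_error v omega H).
Let V := I (fun x => zeta x * expR (2 * v x)).
Let Om := I (fun x => omega x * expR (2 * v x)).
Hypothesis level_ineq : forall t, t0 <= t ->
  4 * pi * (expR (2 * t) * m (t + 3 * H)) <=
  gam * ((gam * B t + s) * b t) + (8 * pi + 1) * (expR (2 * t) * N t).

Definition excess t := I (fun x => zeta x * Num.max (expR (2 * v x) - expR (2 * t)) 0).

Let cexp : continuous (fun x => expR (2 * v x)).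
Proof.
move=> x; apply: (@continuous_comp _ _ _ (fun x => 2 * v x) expR); last exact: continuous_expR.
by apply: cvgM; [exact: cvg_cst|exact: cv].
Qed.
Let zeta_ge0 x : 0 <= zeta x. Proof. by case/andP: (zeta01 x). Qed.
Let nc (f g : R * R -> R) : nice f -> continuous g -> nice (fun x => f x * g x).
Proof. by move=> nf cg; apply: niceM => //; exact: lbm_continuous. Qed.
Let cl t : continuous (level t). Proof. exact: continuous_level. Qed.
Let cle t : continuous (fun x => level t x * expR (2 * v x)).
Proof. exact: continuous_level_exp. Qed.
Let cdle t : continuous (fun x => dlevel t x * expR (2 * v x)).
Proof. exact: continuous_dlevel_exp. Qed.
Let cmax t : continuous (fun x => Num.max (expR (2 * v x) - t) 0).
Proof.
move=> x; apply: (@continuous_max _ _ (fun x => expR (2 * v x) - t) (fun=> 0) x);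
  last exact: cvg_cst.
by apply: cvgB; [exact: cexp|exact: cvg_cst].
Qed.

Lemma level_shift t h x : level (t + h) x = step ((v x - t) / H - h / H).
Proof. by congr step; ring. Qed.

Lemma volume_decrement_ge0 t h : 0 <= h -> 0 <= B t - B (t + h).
Proof.
move=> h0; rewrite /level_volume -planeB; [|exact: nc..].
apply: plane_ge0 => x; rewrite -mulrBr mulr_ge0// -mulrBl mulr_ge0 ?expR_ge0//.
by rewrite level_shift step_decrement_ge0// divr_ge0// ltW.
Qed.

Lemma volume_decrement_le t h : 0 <= h -> B t - B (t + h) <= h / H * V.
Proof.
move=> h0; rewrite /level_volume -planeB; [|exact: nc..].
rewrite -planeZ; last exact: nc.
apply: le_plane; [by apply: niceB; exact: nc|by apply: niceZ; exact: nc|move=> x].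
rewrite -mulrBr -mulrBl [leRHS]mulrCA ler_wpM2l// ler_wpM2r ?expR_ge0//.
by rewrite level_shift step_decrement_le// divr_ge0// ltW.
Qed.

(** A difference quotient stands in for [b = - B'], which avoids differentiating under the integral;
    the error is quadratic in [h]. *)
Lemma rate_le t h : 0 <= h -> h * b t <= B t - B (t + h) + 2 * (h / H) ^+ 2 * V.
Proof.
move=> h0; rewrite /level_volume /level_rate -planeB; [|exact: nc..].
rewrite -!planeZ; [|exact: nc..].
rewrite -planeD; [|by apply: niceB; exact: nc|by apply: niceZ; exact: nc].
apply: le_plane; first by apply: niceZ; exact: nc.
  by apply: niceD; [apply: niceB; exact: nc|apply: niceZ; exact: nc].
move=> x.
have := @step_decrement_ge _ ((v x - t) / H) (h / H) (divr_ge0 h0 (ltW H0)).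
rewrite -level_shift -/(level t x) => /(ler_wpM2r (expR_ge0 (2 * v x))) /(ler_wpM2l (zeta_ge0 x)) h1.
apply: (@le_trans _ _ (zeta x * (h / H * step1 ((v x - t) / H) * expR (2 * v x)))).
  by rewrite /dlevel le_eqVlt; apply/orP; left; apply/eqP; ring.
by apply: le_trans h1 _; rewrite le_eqVlt; apply/orP; left; apply/eqP; ring.
Qed.

Lemma level_volume_ge0 t : 0 <= B t.
Proof.
by apply: plane_ge0 => x; rewrite mulr_ge0// mulr_ge0 ?expR_ge0// level_ge0.
Qed.

Lemma level_volume_le t : B t <= V.
Proof.
apply: le_plane; [exact: nc|exact: nc|move=> x].
by rewrite ler_wpM2l// ler_piMl ?expR_ge0// level_le1.
Qed.

Let V0 : 0 <= V.
Proof. by apply: plane_ge0 => x; rewrite mulr_ge0 ?expR_ge0. Qed.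

(** Upper counterpart of [layer_sum]: for geometric levels the last gap counted overshoots [f] by at
    most the ratio [Q]. *)
Lemma geometric_layer_le (E : nat -> R) (Q f : R) J : 1 <= Q -> 0 <= f ->
  (forall j, 0 <= E j) -> (forall j, E j.+1 = Q * E j) ->
  \sum_(0 <= j < J) (E j.+1 - E j) * (E j < f)%R%:R <= Q * f.
Proof.
move=> Q1 f0 E0 ES.
(* The bound by [E J] feeds the induction at the levels below [f]. *)
suff : \sum_(0 <= j < J) (E j.+1 - E j) * (E j < f)%R%:R <= Q * f /\
   \sum_(0 <= j < J) (E j.+1 - E j) * (E j < f)%R%:R <= E J by case.
have Q0 : 0 <= Q by lra.
elim: J => [|J [IH1 IH2]]; first by rewrite big_nil mulr_ge0.
rewrite big_nat_recr//=; case: ltP => h.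
  rewrite mulr1; split; last by lra.
  apply: le_trans (_ : E J.+1 <= _); first by lra.
  by rewrite ES ler_wpM2l// ltW.
rewrite mulr0 addr0; split => //; apply: le_trans IH2 _.
by rewrite ES ler_peMl.
Qed.

(* [B b] is close to [- B B' = - (B^2)' / 2]: keeping this factor [1 / 2] in the
   discrete sum is what yields the constant [4 pi]; the quadratic error [K h^2]
   disappears in the limit of small steps. *)
Let K := (gam / 2 * V ^+ 2 + 2 * (gam * V + s) * V) / H ^+ 2.
Let G t := gam / 2 * B t ^+ 2 + s * B t.

Let one_step t h : 0 <= h -> (gam * B t + s) * (h * b t) <= G t - G (t + h) + K * h ^+ 2.
Proof.
move=> h0; have d0 := volume_decrement_ge0 t h0; have d1 := volume_decrement_le t h0.
have r := rate_le t h0; have B0 := level_volume_ge0 t; have BV := level_volume_le t.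
have c0 : 0 <= gam * B t + s by rewrite addr_ge0// mulr_ge0.
apply: le_trans (ler_wpM2l c0 r) _.
have -> : G t - G (t + h) = (gam * B t + s) * (B t - B (t + h)) - gam / 2 * (B t - B (t + h)) ^+ 2.
  by rewrite /G; field.
have -> : K * h ^+ 2 = gam / 2 * (h / H * V) ^+ 2 + (gam * V + s) * (2 * (h / H) ^+ 2 * V).
  by rewrite /K; field; rewrite gt_eqF.
rewrite mulrDr.
have h1 : (B t - B (t + h)) ^+ 2 <= (h / H * V) ^+ 2.
  by rewrite ler_pXn2r// nnegrE (le_trans d0).
have h2 : gam / 2 * (B t - B (t + h)) ^+ 2 <= gam / 2 * (h / H * V) ^+ 2.
  by rewrite ler_wpM2l// divr_ge0.
have h3 : (gam * B t + s) * (2 * (h / H) ^+ 2 * V) <= (gam * V + s) * (2 * (h / H) ^+ 2 * V).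
  apply: ler_wpM2r.
    by apply: mulr_ge0 => //; apply: mulr_ge0 => //; exact: sqr_ge0.
  by rewrite lerD2r ler_wpM2l.
by lra.
Qed.

(** The level inequality at [T + j h], multiplied by [exp (2 h) - 1], is summed over [j]. The left
    side becomes a layer-cake sum that dominates the excess, the main term on the right telescopes
    in [G], and the cutoff errors add up to the volume of the annulus. *)
Lemma excess_le_discrete (T h : R) J : t0 <= T -> 0 < h ->
  (forall x, zeta x != 0 -> v x <= T + J%:R * h) ->
  4 * pi * (expR (- (12 * H)) * excess (T + 6 * H)) <=
  expR (2 * h) * (gam * 2 * (G T + J%:R * h * (K * h)) + (8 * pi + 1) * Om).
Proof.
move=> Tt0 h0 vmax; set Q := expR (2 * h).
pose t j := T + j%:R * h; pose E j := expR (2 * t j).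
have tS j : t j.+1 = t j + h by rewrite /t -natr1; ring.
have ES j : E j.+1 = Q * E j by rewrite /E tS -expRD; congr expR; ring.
have Q1 : 1 <= Q by rewrite -expR0 ler_expR; lra.
have E0 j : 0 < E j by exact: expR_gt0.
have E_nd j : E j <= E j.+1 by rewrite ES ler_peMl// ltW.
have pi0 := pi_gt0 R.
(* The function [level (t + 3 H)] equals [1] where [v >= t + 6 H]; lowering [v] by [6 H] multiplies
   [exp (2 v)] by [exp (- 12 H)]. *)
have lhs : expR (- (12 * H)) * excess (T + 6 * H) <=
    \sum_(0 <= j < J) (E j.+1 - E j) * m (t j + 3 * H).
  rewrite (eq_bigr (fun j => I (fun x => (E j.+1 - E j) * (zeta x * level (t j + 3 * H) x))));
    last by move=> j _; rewrite /level_mass planeZ//; exact: nc.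
  rewrite -plane_sum; last by move=> j; apply: niceZ; exact: nc.
  rewrite /excess -planeZ; last exact: nc.
  apply: le_plane; first by apply: niceZ; exact: nc.
    by apply: nice_sum => j; apply: niceZ; exact: nc.
  move=> x; have [z0|z0] := eqVneq (zeta x) 0.
    by rewrite z0 mul0r mulr0 big1// => j _; rewrite mul0r mulr0.
  have -> : \sum_(0 <= j < J) (E j.+1 - E j) * (zeta x * level (t j + 3 * H) x) =
    zeta x * \sum_(0 <= j < J) (E j.+1 - E j) * level (t j + 3 * H) x.
    by rewrite mulr_sumr; apply: eq_bigr => j _; rewrite mulrCA.
  rewrite mulrCA ler_wpM2l//.
  have -> : expR (- (12 * H)) * Num.max (expR (2 * v x) - expR (2 * (T + 6 * H))) 0 =
     Num.max (expR (2 * (v x - 6 * H)) - E 0%N) 0.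
    rewrite maxr_pMr ?expR_ge0// mulr0 mulrBr -!expRD; congr (Num.max (expR _ - expR _) _).
      by ring.
    by rewrite /t mul0r; ring.
  rewrite ge_max; apply/andP; split; last first.
    apply: sumr_ge0 => j _; rewrite mulr_ge0 ?subr_ge0//; exact: level_ge0.
  have := @layer_sum R E (expR (2 * (v x - 6 * H))) J E_nd.
  rewrite min_l; last first.
    have hJ : v x <= t J := vmax _ z0.
    by rewrite ler_expR ler_pM2l//; have := H0; lra.
  move=> /le_trans; apply; apply: ler_sum => j _; apply: ler_wpM2l.
    by rewrite subr_ge0.
  case: ltP => hj; last exact: level_ge0.
  by rewrite level_eq1//; move: hj; rewrite ltr_expR ltr_pM2l//; lra.
have err : \sum_(0 <= j < J) (E j.+1 - E j) * N (t j) <= Q * Om.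
  rewrite (eq_bigr (fun j => I (fun x => (E j.+1 - E j) * (omega x * level (t j) x))));
    last by move=> j _; rewrite /level_error planeZ//; exact: nc.
  rewrite -plane_sum; last by move=> j; apply: niceZ; exact: nc.
  rewrite /Om -planeZ; last exact: nc.
  apply: le_plane; last 2 first.
  - by apply: niceZ; exact: nc.
  - move=> x.
    have -> : \sum_(0 <= j < J) (E j.+1 - E j) * (omega x * level (t j) x) =
      omega x * \sum_(0 <= j < J) (E j.+1 - E j) * level (t j) x.
      by rewrite mulr_sumr; apply: eq_bigr => j _; rewrite mulrCA.
    rewrite mulrCA ler_wpM2l//.
    have := @geometric_layer_le E Q (expR (2 * v x)) J Q1 (expR_ge0 _) (fun j => ltW (E0 j)) ES.
    apply: le_trans; apply: ler_sum => j _; apply: ler_wpM2l; first by rewrite subr_ge0.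
    rewrite ltr_expR ltr_pM2l//; case: ltP => hj; first exact: level_le1.
    by rewrite level_eq0.
  - by apply: nice_sum => j; apply: niceZ; exact: nc.
have Qh : Q - 1 <= 2 * h * Q.
  have := expR_ge1Dx (- (2 * h)).
  have QE : expR (- (2 * h)) * Q = 1 by rewrite -expRD addNr expR0.
  move=> /(ler_wpM2r (expR_ge0 (2 * h))); rewrite -/Q QE; lra.
have term j : 4 * pi * ((E j.+1 - E j) * m (t j + 3 * H)) <=
   gam * 2 * Q * (G (t j) - G (t j.+1) + K * h ^+ 2) + (8 * pi + 1) * ((E j.+1 - E j) * N (t j)).
  have tj : t0 <= t j by apply: le_trans Tt0 _; rewrite lerDl mulr_ge0// ltW.
  have := ler_wpM2l (_ : 0 <= Q - 1) (level_ineq tj).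
  rewrite subr_ge0 => /(_ Q1) h1.
  have EE : E j.+1 - E j = (Q - 1) * expR (2 * t j) by rewrite ES mulrBl mul1r.
  have -> : 4 * pi * ((E j.+1 - E j) * m (t j + 3 * H)) =
     (Q - 1) * (4 * pi * (expR (2 * t j) * m (t j + 3 * H))) by rewrite EE; ring.
  apply: le_trans h1 _; rewrite mulrDr; apply: lerD; last first.
    by rewrite EE le_eqVlt; apply/orP; left; apply/eqP; ring.
  have b0 : 0 <= (gam * B (t j) + s) * b (t j).
    apply: mulr_ge0; first by rewrite addr_ge0// mulr_ge0// level_volume_ge0.
    by apply: plane_ge0 => x; rewrite mulr_ge0// mulr_ge0 ?expR_ge0//; exact: dlevel_ge0.
  apply: le_trans (ler_wpM2r (mulr_ge0 gam0 b0) Qh) _.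
  have -> : 2 * h * Q * (gam * ((gam * B (t j) + s) * b (t j))) =
     gam * 2 * Q * ((gam * B (t j) + s) * (h * b (t j))) by ring.
  rewrite tS; apply: ler_wpM2l; last exact: one_step (ltW h0).
  by rewrite !mulr_ge0// expR_ge0.
have tot : 4 * pi * \sum_(0 <= j < J) (E j.+1 - E j) * m (t j + 3 * H) <=
   gam * 2 * Q * (G T + J%:R * h * (K * h)) +
   (8 * pi + 1) * \sum_(0 <= j < J) (E j.+1 - E j) * N (t j).
  rewrite !mulr_sumr; apply: le_trans (ler_sum _ (fun j _ => term j)) _.
  rewrite big_split/= lerD2r -mulr_sumr ler_wpM2l ?mulr_ge0 ?expR_ge0//.
  have -> : \sum_(0 <= j < J) (G (t j) - G (t j.+1) + K * h ^+ 2) =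
      G (t 0%N) - G (t J) + J%:R * (K * h ^+ 2).
    elim: J {vmax lhs err} => [|n IH]; first by rewrite big_nil mul0r addr0 subrr.
    by rewrite big_nat_recr//= IH -natr1; ring.
  have -> : G (t 0%N) = G T by rewrite /t mul0r addr0.
  have GJ : 0 <= G (t J).
    have B0 := level_volume_ge0 (t J).
    apply: addr_ge0; last exact: mulr_ge0.
    by apply: mulr_ge0; [exact: divr_ge0|exact: sqr_ge0].
  have -> : J%:R * h * (K * h) = J%:R * (K * h ^+ 2) by ring.
  by lra.
have l1 := ler_wpM2l (ltW (mulr_gt0 (ltr0n R 4) pi0)) lhs.
apply: le_trans l1 _; apply: le_trans tot _.
have -> : Q * (gam * 2 * (G T + J%:R * h * (K * h)) + (8 * pi + 1) * Om) =
   gam * 2 * Q * (G T + J%:R * h * (K * h)) + (8 * pi + 1) * (Q * Om) by ring.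
by rewrite lerD2l; apply: ler_wpM2l => //; lra.
Qed.

Lemma nice_continuous_upper_bound (f : R * R -> R) : nice zeta -> continuous f ->
  exists M, forall x, zeta x != 0 -> f x <= M.
Proof.
move=> [_ [r Hr]] /lbm_continuous[_ /(_ r)[M HM]]; exists M => x zx.
have [xr|xr] := pselect (box r x); first exact: le_trans (ler_norm _) (HM _ xr).
by rewrite Hr// eqxx in zx.
Qed.

Lemma excess_le T : t0 <= T ->
  4 * pi * (expR (- (12 * H)) * excess (T + 6 * H)) <=
  gam * (gam * B T ^+ 2 + 2 * s * B T) + (8 * pi + 1) * Om.
Proof.
move=> Tt0; have [M HM] := nice_continuous_upper_bound nz cv.
(* From [T] the grid must reach an upper bound of [v] on the set where [zeta] is nonzero; the
   maximum with [1] keeps its length positive. It is then cut into [n + 1] equal steps. *)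
pose L := Num.max (M - T) 1.
have L0 : 0 < L by rewrite lt_max ltr01 orbT.
set A := 4 * pi * _.
pose F (h : R) := expR (2 * h) * (gam * 2 * (G T + L * (K * h)) + (8 * pi + 1) * Om).
have cF : continuous F.
  move=> h; apply: cvgM.
    apply: (@continuous_comp _ _ _ (fun h : R => 2 * h) expR); last exact: continuous_expR.
    by apply: cvgM; [exact: cvg_cst|exact: cvg_id].
  apply: cvgD; last exact: cvg_cst.
  apply: cvgM; first exact: cvg_cst.
  apply: cvgD; first exact: cvg_cst.
  apply: cvgM; first exact: cvg_cst.
  by apply: cvgM; [exact: cvg_cst|exact: cvg_id].
have hc : (L * harmonic n : R) @[n --> \oo] --> 0.
  by rewrite -(mulr0 L); apply: cvgM; [exact: cvg_cst|exact: cvg_harmonic].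
have Fc : (F (L * harmonic n)) @[n --> \oo] --> F 0.
  exact: (cvg_comp _ _ hc (cF 0)).
have -> : gam * (gam * B T ^+ 2 + 2 * s * B T) + (8 * pi + 1) * Om = F 0.
  by rewrite /F mulr0 expR0 mul1r mulr0 mulr0 addr0 /G; field.
rewrite -(cvg_lim _ Fc)//; apply: limr_ge; first exact: cvgP Fc.
near=> n.
have n0 : 0 < (n.+1%:R : R) by rewrite ltr0n.
have nh : n.+1%:R * (L * harmonic n) = L by rewrite /harmonic mulrCA mulfV ?mulr1// gt_eqF.
have h0 : 0 < L * harmonic n by rewrite mulr_gt0// /harmonic invr_gt0.
have := @excess_le_discrete T (L * harmonic n) n.+1 Tt0 h0.
rewrite nh; apply => x zx.
apply: le_trans (HM _ zx) _; rewrite -lerBlDl /L le_max lexx//.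
Unshelve. all: by end_near. Qed.

(** Where [v > T], subtracting [exp (2 (T - tau))] removes at most the fraction [exp (- 2 tau)] of
    [exp (2 v)]. This bounds the volume by the excess at a slightly lower level and so closes the
    recursion. *)
Lemma level_volume_excess T tau : 0 < tau ->
  (1 - expR (- (2 * tau))) * B T <= excess (T - tau).
Proof.
move=> tau0; rewrite /level_volume -planeZ; last exact: nc.
apply: le_plane; [by apply: niceZ; exact: nc|exact: nc|move=> x].
rewrite mulrCA ler_wpM2l//.
have e1 : expR (- (2 * tau)) < 1 by rewrite expR_lt1; lra.
have [h|h] := leP (v x) T.
  by rewrite level_eq0// mul0r mulr0 le_max lexx orbT.
rewrite le_max; apply/orP; left.
apply: (@le_trans _ _ ((1 - expR (- (2 * tau))) * expR (2 * v x))).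
  apply: ler_wpM2l; first by rewrite subr_ge0 ltW.
  by rewrite ler_piMl ?expR_ge0// level_le1.
rewrite mulrBl mul1r lerD2l lerN2 -expRD ler_expR; lra.
Qed.

Lemma excess_ge0 T : 0 <= excess T.
Proof. by apply: plane_ge0 => x; rewrite mulr_ge0// le_max lexx orbT. Qed.

End summation.

(** * A radial cutoff and its derivatives *)

Section cutoff.
Context {R : realType}.
Local Notation P := (measurableTypeR R * measurableTypeR R)%type.
Variables (a : R * R) (r : R).
Hypothesis r0 : 0 < r.

(** With this factor [u] is [0] on the circle of radius [r] and [3] on that of radius [r / 2], the
    two ends of the rise of [step]. *)
Let c := 4 / r ^+ 2.
Let c0 : 0 < c. Proof. by rewrite divr_gt0// exprn_gt0. Qed.
Let cr : c * r ^+ 2 = 4.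
Proof. by rewrite /c divfK// gt_eqF// exprn_gt0. Qed.
Let sqd (x : R * R) := (x.1 - a.1) ^+ 2 + (x.2 - a.2) ^+ 2.
Let u (x : R * R) := c * (r ^+ 2 - sqd x).

Definition cutoff x := step (u x).
Definition cutoff1 x := step1 (u x) * (- 2 * c * (x.1 - a.1)).
Definition cutoff2 x := step1 (u x) * (- 2 * c * (x.2 - a.2)).
Definition cutoff11 x := step2 (u x) * (- 2 * c * (x.1 - a.1)) ^+ 2 - 2 * c * step1 (u x).
Definition cutoff22 x := step2 (u x) * (- 2 * c * (x.2 - a.2)) ^+ 2 - 2 * c * step1 (u x).
(** The first term bounds the gradient, by [2 c r]; the second bounds the Laplacian, by
    [2 (4 c) 4 + 4 c = 36 c]. *)
Definition cutoff_bound := 8 / r + 144 / r ^+ 2.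
Definition annulus x : R := \1_(disc a r) x - \1_(disc a (r / 2)) x.

Let u_d1 (s b : R) : is_derive s 1 (fun s => u (s, b)) (- 2 * c * (s - a.1)).
Proof. by rewrite /u /sqd/=; der_to; [der|rewrite /=; ring]. Qed.

Let u_d2 (s b : R) : is_derive b 1 (fun b => u (s, b)) (- 2 * c * (b - a.2)).
Proof. by rewrite /u /sqd/=; der_to; [der|rewrite /=; ring]. Qed.

Let lin_d (s b : R) : is_derive s 1 (fun s => - 2 * c * (s - b)) (- 2 * c).
Proof. by der_to; [der|rewrite /=; ring]. Qed.

Lemma cutoff_d1 : has_d1 cutoff cutoff1.
Proof. by move=> s b; exact: (der_comp (g := fun s => u (s, b)) (der_step _) (u_d1 s b)). Qed.

Lemma cutoff_d2 : has_d2 cutoff cutoff2.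
Proof. by move=> s b; exact: (der_comp (g := fun b => u (s, b)) (der_step _) (u_d2 s b)). Qed.

Lemma cutoff1_d1 : has_d1 cutoff1 cutoff11.
Proof.
move=> s b; notypeclasses refine (is_derive_eq (der_mul
  (der_comp (g := fun s => u (s, b)) (der_step1 _) (u_d1 s b)) (lin_d s a.1)) _).
by rewrite /cutoff11/=; ring.
Qed.

Lemma cutoff2_d2 : has_d2 cutoff2 cutoff22.
Proof.
move=> s b; notypeclasses refine (is_derive_eq (der_mul
  (der_comp (g := fun b => u (s, b)) (der_step1 _) (u_d2 s b)) (lin_d b a.2)) _).
by rewrite /cutoff22/=; ring.
Qed.

Let cu : continuous u.
Proof.
move=> x; apply: cvgM; first exact: cvg_cst.
by apply: cvgB; [exact: cvg_cst|exact: continuous_sqdist].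
Qed.

Let cl1 : continuous (fun x : R * R => - 2 * c * (x.1 - a.1)).
Proof.
move=> x; apply: cvgM; first exact: cvg_cst.
by apply: cvgB; [exact: cvg_fst|exact: cvg_cst].
Qed.

Let cl2 : continuous (fun x : R * R => - 2 * c * (x.2 - a.2)).
Proof.
move=> x; apply: cvgM; first exact: cvg_cst.
by apply: cvgB; [exact: cvg_snd|exact: cvg_cst].
Qed.

Let cs1 : continuous (fun x => step1 (u x)).
Proof.
by move=> x; apply: (@continuous_comp _ _ _ u step1); [exact: cu|exact: continuous_step1].
Qed.

Let cs2 : continuous (fun x => step2 (u x)).
Proof.
by move=> x; apply: (@continuous_comp _ _ _ u step2); [exact: cu|exact: continuous_step2].
Qed.

Lemma continuous_cutoff : continuous cutoff.
Proof.
by move=> x; apply: (@continuous_comp _ _ _ u step); [exact: cu|exact: continuous_step].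
Qed.

Lemma continuous_cutoff1 : continuous cutoff1. Proof. exact: continuousM2. Qed.
Lemma continuous_cutoff2 : continuous cutoff2. Proof. exact: continuousM2. Qed.

Let cst2 : continuous (fun x => - (2 * c * step1 (u x))).
Proof.
apply: continuousN2; apply: continuousM2 => // x; exact: cvg_cst.
Qed.

Lemma continuous_cutoff11 : continuous cutoff11.
Proof.
apply: continuousD2 => //; apply: continuousM2 => //.
by under eq_fun do rewrite expr2; exact: continuousM2.
Qed.

Lemma continuous_cutoff22 : continuous cutoff22.
Proof.
apply: continuousD2 => //; apply: continuousM2 => //.
by under eq_fun do rewrite expr2; exact: continuousM2.
Qed.

Let u_le0 x : ~ disc a r x -> u x <= 0.
Proof.
move=> /negP; rewrite -leNgt => h.
by rewrite /u pmulr_rle0// subr_le0.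
Qed.

Let u_ge3 x : disc a (r / 2) x -> 3 <= u x.
Proof.
rewrite /disc/= -/(sqd x) => h; rewrite /u mulrBr cr.
have h2 : (r / 2) ^+ 2 = r ^+ 2 / 4 by field.
have : c * sqd x <= c * (r ^+ 2 / 4) by rewrite ler_pM2l// -h2 ltW.
by rewrite mulrA cr; lra.
Qed.

Let sub_disc x : disc a (r / 2) x -> disc a r x.
Proof.
rewrite /disc/= => /lt_trans; apply.
by have -> : (r / 2) ^+ 2 = r ^+ 2 / 4 by [field]; have := exprn_gt0 2 r0; lra.
Qed.

Let out (f : R * R -> R) : (forall x, u x <= 0 -> f x = 0) -> bounded_support f.
Proof.
move=> f0; have [_ [s Hs]] := nice_disc a r.
exists s => x xs; apply: f0; apply: u_le0 => xd.
by have := Hs x xs; rewrite indicE mem_set//= => /eqP; rewrite oner_eq0.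
Qed.

Lemma cutoff_supp : bounded_support cutoff.
Proof. by apply: out => x ux; rewrite /cutoff step_le0. Qed.
Lemma cutoff1_supp : bounded_support cutoff1.
Proof. by apply: out => x ux; rewrite /cutoff1 step1_le0// mul0r. Qed.
Lemma cutoff2_supp : bounded_support cutoff2.
Proof. by apply: out => x ux; rewrite /cutoff2 step1_le0// mul0r. Qed.
Lemma cutoff11_supp : bounded_support cutoff11.
Proof. by apply: out => x ux; rewrite /cutoff11 step1_le0// step2_le0// mul0r mulr0 subr0. Qed.
Lemma cutoff22_supp : bounded_support cutoff22.
Proof. by apply: out => x ux; rewrite /cutoff22 step1_le0// step2_le0// mul0r mulr0 subr0. Qed.

Lemma cutoff01 x : 0 <= cutoff x <= 1.
Proof. by rewrite /cutoff step_ge0 step_le1. Qed.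

Lemma cutoff_le_disc x : cutoff x <= \1_(disc a r) x.
Proof.
have [xd|xd] := pselect (disc a r x).
  by rewrite indicE mem_set//; case/andP: (cutoff01 x).
by rewrite /cutoff step_le0 ?indicE// u_le0.
Qed.

Lemma cutoff_eq1 x : disc a (r / 2) x -> cutoff x = 1.
Proof. by move=> xd; rewrite /cutoff step_ge3// u_ge3. Qed.

Lemma nice_annulus : nice annulus.
Proof. by apply: niceB; exact: nice_disc. Qed.

Lemma annulus_cases x : [\/ ~ disc a r x /\ annulus x = 0,
  disc a (r / 2) x /\ annulus x = 0 |
  [/\ disc a r x, ~ disc a (r / 2) x & annulus x = 1]].
Proof.
rewrite /annulus !indicE; have [xd|xd] := pselect (disc a (r / 2) x).
  by apply: Or32; rewrite !mem_set ?subrr//; exact: sub_disc.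
rewrite (memNset xd) subr0.
have [xr|xr] := pselect (disc a r x); last by apply: Or31; rewrite memNset.
by apply: Or33; rewrite mem_set.
Qed.

Lemma annulus_ge0 x : 0 <= annulus x.
Proof. by case: (annulus_cases x) => [[_ ->]|[_ ->]|[_ _ ->]]. Qed.

Lemma annulus_le x : annulus x <= \1_(disc a r) x.
Proof. by rewrite /annulus gerBl. Qed.

Lemma cutoff_sq_annulus x : cutoff x - cutoff x ^+ 2 <= annulus x.
Proof.
case: (annulus_cases x) => [[xd ->]|[xd ->]|[_ _ ->]].
- by rewrite /cutoff step_le0 ?u_le0// expr0n subrr.
- by rewrite cutoff_eq1// expr1n subrr.
- by have /andP[h0 h1] := cutoff01 x; have := sqr_ge0 (cutoff x); lra.
Qed.

Lemma cutoff_bound_ge0 : 0 <= cutoff_bound.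
Proof. by rewrite /cutoff_bound addr_ge0// divr_ge0// ?exprn_ge0// ltW. Qed.

Let grad_sq x : cutoff1 x ^+ 2 + cutoff2 x ^+ 2 =
  step1 (u x) ^+ 2 * (4 * c * (c * sqd x)).
Proof. by rewrite /cutoff1 /cutoff2 /sqd; ring. Qed.

Let csqd x : disc a r x -> c * sqd x <= 4.
Proof. by rewrite /disc/= -/(sqd x) => h; rewrite -cr ler_pM2l// ltW. Qed.

Let csqd0 x : 0 <= c * sqd x.
Proof. by apply: mulr_ge0; [exact: ltW|rewrite addr_ge0// sqr_ge0]. Qed.

Lemma cutoff_grad x : Num.sqrt (cutoff1 x ^+ 2 + cutoff2 x ^+ 2) <= cutoff_bound * annulus x.
Proof.
rewrite grad_sq; case: (annulus_cases x) => [[xd ->]|[xd ->]|[xr _ ->]].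
- by rewrite step1_le0 ?u_le0// expr0n mul0r sqrtr0 mulr0.
- by rewrite step1_ge3 ?u_ge3// expr0n mul0r sqrtr0 mulr0.
rewrite mulr1; apply: (@le_trans _ _ (8 / r)); last first.
  by rewrite /cutoff_bound lerDl divr_ge0// exprn_ge0// ltW.
rewrite -[leRHS]ger0_norm ?divr_ge0 ?(ltW r0)// -sqrtr_sqr; apply: ler_wsqrtr.
have -> : (8 / r) ^+ 2 = 4 * c * 4 by rewrite /c; field; rewrite gt_eqF.
have s0 := step1_ge0 (u x); have s1 := step1_le1 (u x).
apply: (@le_trans _ _ (1 * (4 * c * (c * sqd x)))).
  apply: ler_wpM2r; first by rewrite mulr_ge0// mulr_ge0// ltW.
  by rewrite expr_le1.
by rewrite mul1r ler_wpM2l ?csqd// mulr_ge0// ltW.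
Qed.

Lemma cutoff_laplacian x : `|cutoff11 x + cutoff22 x| <= cutoff_bound * \1_(disc a r) x.
Proof.
have -> : cutoff11 x + cutoff22 x = step2 (u x) * (4 * c * (c * sqd x)) - 4 * c * step1 (u x).
  by rewrite /cutoff11 /cutoff22 /sqd; ring.
have [xd|xd] := pselect (disc a r x); last first.
  by rewrite step2_le0 ?step1_le0 ?u_le0// mul0r mulr0 subr0 normr0 indicE memNset// mulr0.
rewrite indicE mem_set// mulr1.
apply: (@le_trans _ _ (144 / r ^+ 2)); last first.
  by rewrite /cutoff_bound lerDr divr_ge0// ltW.
have -> : 144 / r ^+ 2 = 2 * (4 * c * 4) + 4 * c * 1.
  by rewrite /c; field; rewrite gt_eqF.
have c4 : 0 <= 4 * c by rewrite mulr_ge0// ltW.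
apply: le_trans (ler_normB _ _) _; apply: lerD.
  rewrite normrM; apply: ler_pM => //; first exact: step2_norm_le1.
  by rewrite (ger0_norm (mulr_ge0 c4 (csqd0 x))) ler_wpM2l// csqd.
rewrite normrM (ger0_norm c4) ger0_norm ?step1_ge0//.
by apply: ler_wpM2l => //; exact: step1_le1.
Qed.

End cutoff.

(** * Decay of the volume excess *)

Section conformal_calculus.
Context {R : realType}.
Implicit Types (f : R * R -> R) (v : conformal_factor R).
Local Notation P := (measurableTypeR R * measurableTypeR R)%type.

Lemma has_d1_derive f : (forall x, derivable f x e1) -> has_d1 f ('D_e1 f).
Proof.
move=> df a b; have := df (a, b).
have E : (fun h : R => h^-1 *: ((f \o shift (a, b)) (h *: e1) - f (a, b))) =
   (fun h : R => h^-1 *: (((fun s => f (s, b)) \o shift a) (h *: 1) - f (a, b))).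
  apply/funext => h /=; congr (_ *: (f _ - _)).
  by transitivity (h * 1 + a, h * 0 + b) => //; rewrite mulr0 add0r.
by move=> d; split; move: d; rewrite /derivable /derive E.
Qed.

Lemma has_d2_derive f : (forall x, derivable f x e2) -> has_d2 f ('D_e2 f).
Proof.
move=> df a b; have := df (a, b).
have E : (fun h : R => h^-1 *: ((f \o shift (a, b)) (h *: e2) - f (a, b))) =
   (fun h : R => h^-1 *: (((fun s => f (a, s)) \o shift b) (h *: 1) - f (a, b))).
  apply/funext => h /=; congr (_ *: (f _ - _)).
  by transitivity (h * 0 + a, h * 1 + b) => //; rewrite mulr0 add0r.
by move=> d; split; move: d; rewrite /derivable /derive E.
Qed.

Lemma conformal_factor_C2 v :
  [/\ continuous v, continuous ('D_e1 v), continuous ('D_e2 v),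
      continuous ('D_e1 ('D_e1 v)) & continuous ('D_e2 ('D_e2 v))] /\
  [/\ has_d1 v ('D_e1 v), has_d2 v ('D_e2 v), has_d1 ('D_e1 v) ('D_e1 ('D_e1 v)) &
      has_d2 ('D_e2 v) ('D_e2 ('D_e2 v))].
Proof.
have [cv [d1 d2 [c1 [d11 d12 [c11 _] _]] [c2 [d21 d22 _ [c22 _]]]]] := cf_smooth v 2.
exact: (conj (And5 cv c1 c2 c11 c22) (And4 (has_d1_derive d1) (has_d2_derive d2)
  (has_d1_derive d11) (has_d2_derive d22))).
Qed.

Lemma continuous_expR2 v : continuous (fun x => expR (2 * v x)).
Proof.
have [[cv _ _ _ _] _] := conformal_factor_C2 v.
move=> x; apply: (@continuous_comp _ _ _ (fun x => 2 * v x) expR); last exact: continuous_expR.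
by apply: cvgM; [exact: cvg_cst|exact: cv].
Qed.

Lemma continuous_gauss_curvature v : continuous (gauss_curvature v).
Proof.
have [[cv _ _ c11 c22] _] := conformal_factor_C2 v.
have ce : continuous (fun x => - expR (- (2 * v x))).
  apply: continuousN2 => x.
  apply: (@continuous_comp _ _ _ (fun x => - (2 * v x)) expR); last exact: continuous_expR.
  by apply: cvgN; apply: cvgM; [exact: cvg_cst|exact: cv].
exact: (continuousM2 ce (continuousD2 c11 c22)).
Qed.

(** The Lebesgue density of the curvature integral that is assumed to tend to [0]. *)
Definition curvature_defect v (p : R) x :=
  `|gauss_curvature v x - 1| `^ p * expR (2 * v x).

Lemma lbm_powR f (p : R) : 0 <= p -> (forall x, 0 <= f x) ->
  locally_bounded_measurable f -> locally_bounded_measurable (fun x => f x `^ p).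
Proof.
move=> p0 f0 [mf bf]; split.
  exact: (measurableT_comp (measurable_powR p) mf).
move=> r; have [M HM] := bf r; exists (M `^ p) => z zr.
rewrite ger0_norm ?powR_ge0//; have h := le_trans (ler_norm _) (HM z zr).
by apply: ge0_ler_powR; rewrite ?nnegrE//; exact: le_trans (f0 z) h.
Qed.

Lemma lbm_curvature_defect v p : 0 <= p -> locally_bounded_measurable (curvature_defect v p).
Proof.
move=> p0; apply: lbmM; last by apply: lbm_continuous; exact: continuous_expR2.
apply: lbm_powR => //; apply: lbm_continuous => x.
apply: cvg_norm; apply: cvgB; last exact: cvg_cst.
exact: continuous_gauss_curvature.
Qed.

Lemma curvature_defect_ge0 v p x : 0 <= curvature_defect v p x.
Proof. by rewrite mulr_ge0 ?powR_ge0 ?expR_ge0. Qed.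

(** Either [y <= e], or [(y / e) ^ (p - 1) >= 1] and the second term alone exceeds [y]. *)
Lemma le_powR_young (p e y : R) : 1 < p -> 0 < e -> 0 <= y ->
  y <= e + (e `^ (p - 1))^-1 * y `^ p.
Proof.
move=> p1 e0 y0; have ep : 0 < e `^ (p - 1) by exact: powR_gt0.
have yp : 0 <= y `^ p by exact: powR_ge0.
have [ye|ye] := leP y e.
  by apply: le_trans ye _; rewrite lerDl mulr_ge0// invr_ge0 ltW.
rewrite -[leLHS]add0r; apply: lerD; first exact: ltW.
have y00 : 0 < y by exact: lt_trans ye.
rewrite mulrC ler_pdivlMr//.
have -> : y `^ p = y * y `^ (p - 1).
  have yn : (1 + (p - 1) == 0) ==> (y != 0) by rewrite (gt_eqF y00) implybT.
  have := powRD yn; rewrite (powRr1 (ltW y00)) => <-.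
  by congr powR; ring.
rewrite ler_pM2l//; apply: ge0_ler_powR; rewrite ?nnegrE ?subr_ge0// ltW//.
Qed.

Lemma curvature_upper_bound v p (gam : R) x : 1 < p -> 1 < gam ->
  - ('D_e1 ('D_e1 v) x + 'D_e2 ('D_e2 v) x) <=
  gam * expR (2 * v x) + ((gam - 1) `^ (p - 1))^-1 * curvature_defect v p x.
Proof.
move=> p1 gam1; set K := gauss_curvature v x.
have -> : - ('D_e1 ('D_e1 v) x + 'D_e2 ('D_e2 v) x) = K * expR (2 * v x).
  rewrite /K /gauss_curvature /laplacian mulNr mulNr mulrAC -expRD addNr expR0 mul1r.
  by [].
have g0 : 0 < gam - 1 by rewrite subr_gt0.
have := le_powR_young p1 g0 (normr_ge0 (K - 1)).
have := ler_norm (K - 1) => h1 h2.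
have h : K <= gam + ((gam - 1) `^ (p - 1))^-1 * `|K - 1| `^ p.
  by have := le_trans h1 h2; lra.
apply: le_trans (ler_wpM2r (expR_ge0 (2 * v x)) h) _.
by rewrite /curvature_defect -/K mulrA -mulrDl.
Qed.

End conformal_calculus.

(** * Contraction of the excess on one disc *)

Section contraction.
Context {R : realType}.
Local Notation I := plane_integral.
Variables (v : conformal_factor R) (p : R) (a : R * R) (r : R).
Hypotheses (p1 : 1 < p) (r0 : 0 < r).
(** The five factors [gam] to be absorbed are the coefficient of the curvature bound, the splitting
    of the squared perimeter, the shift by [6 H] ([gamH]), the passage from volume to excess
    ([gamtau]) and the linear term in [s] ([sE]). The level [t0] is where the cutoff errors become
    small; half of [s] is granted to them and half to the curvature defect. *)
Variables (gam H s tau t0 La : R).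
Hypotheses (gam1 : 1 < gam) (H0 : 0 < H) (tau0 : 0 < tau) (La0 : 0 < La).
Hypothesis gam6 : gam ^+ 6 * La = 4 * pi.
Hypothesis gamH : expR (12 * H) = gam.
Hypothesis gamtau : 1 - expR (- (2 * tau)) = gam^-1.
Hypothesis sE : s = (gam - 1) * gam * La / 2.
Let C := cutoff_bound r.
Let W := excess v (cutoff a r).
Let Om := I (fun x => annulus a r x * expR (2 * v x)).
Let kap := ((gam - 1) `^ (p - 1))^-1.
Hypothesis vol : I (fun x => \1_(disc a r) x * expR (2 * v x)) <= La.
Hypothesis defect :
  kap * I (fun x => \1_(disc a r) x * curvature_defect v p x) <= s / 2.
Hypothesis t0s : C * expR (- (2 * t0)) * La <= s / 2.
Hypothesis t0C : gam / (gam - 1) * C ^+ 2 * (expR (- (2 * t0)) * La) <= 1.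

Let gam0 : 0 < gam. Proof. exact: lt_trans gam1. Qed.
Let s0 : 0 <= s.
Proof. by rewrite sE divr_ge0// !mulr_ge0// ?subr_ge0 ltW. Qed.
Let C0 : 0 <= C. Proof. exact: cutoff_bound_ge0. Qed.

Let nE : nice (fun x => \1_(disc a r) x * expR (2 * v x)).
Proof. by apply: niceM; [exact: nice_disc|apply: lbm_continuous; exact: continuous_expR2]. Qed.

Let planeM_kap : I (fun x => \1_(disc a r) x * (kap * curvature_defect v p x)) =
  kap * I (fun x => \1_(disc a r) x * curvature_defect v p x).
Proof.
rewrite -planeZ; first by congr plane_integral; apply/funext => x; rewrite mulrCA.
apply: niceM; first exact: nice_disc.
by apply: lbm_curvature_defect; exact: ltW (lt_trans ltr01 p1).
Qed.

Lemma level_ineq_conformal t : t0 <= t ->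
  4 * pi * (expR (2 * t) * level_mass v (cutoff a r) H (t + 3 * H)) <=
  gam * ((gam * level_volume v (cutoff a r) H t + s) * level_rate v (cutoff a r) H t) +
  (8 * pi + 1) * (expR (2 * t) * level_error v (annulus a r) H t).
Proof.
move=> tt0.
have [[cv c1 c2 c11 c22] [d1 d2 d11 d22]] := conformal_factor_C2 v.
have g1 : 0 < gam - 1 by rewrite subr_gt0.
have kap0 : 0 <= kap by rewrite invr_ge0 powR_ge0.
have p0 : 0 <= p := ltW (lt_trans ltr01 p1).
have lk : locally_bounded_measurable (fun x => kap * curvature_defect v p x).
  by apply: lbmM; [exact: lbm_cst|exact: lbm_curvature_defect].
have k0 x : 0 <= kap * curvature_defect v p x.
  by rewrite mulr_ge0// curvature_defect_ge0.
have M0 : 0 <= I (fun x => \1_(disc a r) x * expR (2 * v x)).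
  by apply: plane_ge0 => x; rewrite mulr_ge0 ?expR_ge0.
have et : expR (- (2 * t)) <= expR (- (2 * t0)) by rewrite ler_expR; lra.
have eM : expR (- (2 * t)) * I (fun x => \1_(disc a r) x * expR (2 * v x)) <=
    expR (- (2 * t0)) * La.
  by apply: ler_pM => //; exact: expR_ge0.
have L := @level_inequality R v ('D_e1 v) ('D_e2 v) ('D_e1 ('D_e1 v)) ('D_e2 ('D_e2 v))
  d1 d2 d11 d22 cv c1 c2 c11 c22
  (cutoff a r) (cutoff1 a r) (cutoff2 a r) (cutoff11 a r) (cutoff22 a r)
  (\1_(disc a r)) (annulus a r)
  (@cutoff_d1 R a r) (@cutoff_d2 R a r) (@cutoff1_d1 R a r) (@cutoff2_d2 R a r)
  (@continuous_cutoff R a r) (@continuous_cutoff1 R a r) (@continuous_cutoff2 R a r)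
  (@continuous_cutoff11 R a r) (@continuous_cutoff22 R a r)
  (cutoff_supp a r0) (cutoff1_supp a r0) (cutoff2_supp a r0)
  (cutoff11_supp a r0) (cutoff22_supp a r0) (nice_disc a r) (nice_annulus a r)
  (cutoff01 a r) (cutoff_le_disc a r0) (annulus_ge0 a r0) (annulus_le a r)
  (cutoff_sq_annulus a r0) C C0 (cutoff_grad a r0) (cutoff_laplacian a r0) H H0
  gam (fun x => kap * curvature_defect v p x) gam1 lk k0
  (fun x => curvature_upper_bound v x p1 gam1) t s.
apply: L.
- rewrite planeM_kap//; have := le_trans (ler_wpM2l C0 eM) (_ : _ <= s / 2).
  rewrite mulrA => /(_ t0s); rewrite -mulrA => h.
  by have := lerD defect h; rewrite !mulrA; lra.
- apply: le_trans t0C; apply: ler_wpM2l => //.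
  by rewrite mulr_ge0 ?sqr_ge0// divr_ge0 ?(ltW gam0)// ltW.
Qed.

Let nz : nice (cutoff a r).
Proof. by split; [apply: lbm_continuous; exact: continuous_cutoff|exact: cutoff_supp]. Qed.
Let cv : continuous v. Proof. by have [[]] := conformal_factor_C2 v. Qed.
Let growth := gam * (8 * pi + 1) / (4 * pi).
Let W0 T : 0 <= W T. Proof. by apply: excess_ge0; exact: cutoff01. Qed.
Let Om0 : 0 <= Om.
Proof. by apply: plane_ge0 => x; rewrite mulr_ge0 ?expR_ge0 ?annulus_ge0. Qed.

(** The bound on the excess is quadratic in the volume [b] above the level. One factor [b] is
    estimated by [La], the other by [gam] times the excess at [T - tau]; then
    [gam ^+ 5 * La = 4 pi / gam] makes this a contraction. *)
Lemma excess_contraction T : t0 <= T -> W (T + 6 * H) <= gam^-1 * W (T - tau) + growth * Om.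
Proof.
move=> Tt0; have pi0 := pi_gt0 R.
have h1 := excess_le cv nz (nice_annulus a r) (cutoff01 a r) (annulus_ge0 a r0)
  H0 (ltW gam0) s0 level_ineq_conformal Tt0.
have h2 := level_volume_excess cv nz (cutoff01 a r) H0 T tau0.
rewrite gamtau in h2.
set b := level_volume v (cutoff a r) H T in h1 h2.
have b0 : 0 <= b by apply: level_volume_ge0; exact: cutoff01.
have bLa : b <= La.
  apply: le_trans vol; apply: le_trans (level_volume_le cv nz (cutoff01 a r) H T) _.
  apply: le_plane => //.
    by apply: niceM => //; apply: lbm_continuous; exact: continuous_expR2.
  by move=> x; rewrite ler_wpM2r ?expR_ge0// cutoff_le_disc.
have h3 : b <= gam * W (T - tau).
  by rewrite -ler_pdivrMl.
have h4 : gam * b ^+ 2 + 2 * s * b <= gam ^+ 3 * La * W (T - tau).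
  apply: (@le_trans _ _ (gam ^+ 2 * La * b)).
    have -> : gam ^+ 2 * La * b = gam * (La * b) + 2 * s * b by rewrite sE; field.
    by rewrite lerD2r ler_wpM2l ?(ltW gam0)// expr2 ler_wpM2r.
  have -> : gam ^+ 3 * La * W (T - tau) = gam ^+ 2 * La * (gam * W (T - tau)) by ring.
  by apply: ler_wpM2l => //; rewrite mulr_ge0 ?(ltW La0)// exprn_ge0// ltW.
have h5 : 4 * pi * (gam^-1 * W (T + 6 * H)) <= gam * (gam ^+ 3 * La * W (T - tau)) + (8 * pi + 1) * Om.
  have <- : expR (- (12 * H)) = gam^-1 by rewrite expRN gamH.
  apply: le_trans h1 _; rewrite lerD2r; apply: ler_wpM2l => //; exact: ltW.
have gn : gam != 0 by rewrite gt_eqF.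
have E1 : W (T + 6 * H) = gam / (4 * pi) * (4 * pi * (gam^-1 * W (T + 6 * H))).
  rewrite mulrA divfK ?mulVKf//.
  by rewrite gt_eqF// mulr_gt0.
have p40 : 0 < 4 * pi :> R by rewrite mulr_gt0.
have q0 : 0 <= gam / (4 * pi) by apply: divr_ge0; exact: ltW.
rewrite E1; apply: le_trans (ler_wpM2l q0 h5) _.
rewrite le_eqVlt; apply/orP; left; apply/eqP.
have -> : gam^-1 = gam ^+ 5 * La / (4 * pi).
  by rewrite -gam6; field; rewrite gn gt_eqF.
rewrite /growth; move: (4 * pi) p40 => q q00.
by field; rewrite gt_eqF.
Qed.

(** Each application raises the level by [6 H + tau], and the errors form a geometric series. At the
    start the excess is at most the volume of the disc. *)
Lemma excess_iterate n :
  W (t0 - tau + n%:R * (6 * H + tau)) <= gam^-1 ^+ n * La + growth / (1 - gam^-1) * Om.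
Proof.
have pi0 := pi_gt0 R.
have gi : 0 < gam^-1 by rewrite invr_gt0.
have gi1 : gam^-1 < 1 by rewrite invf_lt1.
have gr0 : 0 <= growth.
  apply: divr_ge0; last by rewrite mulr_ge0// ltW.
  by apply: mulr_ge0; [exact: ltW|rewrite addr_ge0// mulr_ge0// ltW].
have C20 : 0 <= growth / (1 - gam^-1) * Om by rewrite mulr_ge0// divr_ge0// subr_ge0 ltW.
elim: n => [|n IH].
  rewrite mul0r addr0 expr0 mul1r.
  apply: (@le_trans _ _ La); last by rewrite lerDl.
  apply: le_trans vol; apply: le_plane => //.
    apply: niceM => //; apply: lbm_continuous => x.
    apply: (@continuous_max _ _ (fun x => expR (2 * v x) - expR (2 * (t0 - tau))) (fun=> 0) x);
      last exact: cvg_cst.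
    by apply: cvgB; [exact: continuous_expR2|exact: cvg_cst].
  move=> x; apply: ler_pM.
  - by case/andP: (cutoff01 a r x).
  - by rewrite le_max lexx orbT.
  - exact: cutoff_le_disc.
  - by rewrite ge_max expR_ge0 andbT lerBlDr lerDl expR_ge0.
have -> : t0 - tau + n.+1%:R * (6 * H + tau) = t0 + n%:R * (6 * H + tau) + 6 * H.
  by rewrite -natr1; ring.
have tn : t0 <= t0 + n%:R * (6 * H + tau).
  by rewrite lerDl mulr_ge0// addr_ge0 ?mulr_ge0// ltW.
apply: le_trans (excess_contraction tn) _.
rewrite [X in W X](_ : _ = t0 - tau + n%:R * (6 * H + tau)); last by ring.
apply: le_trans (lerD (ler_wpM2l (ltW gi) IH) (lexx _)) _.
rewrite le_eqVlt; apply/orP; left; apply/eqP.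
rewrite exprS; field; rewrite gt_eqF//= gt_eqF// subr_gt0//.
Qed.

(** On the small disc the cutoff is [1], and [exp (2 v)] is at most its excess over [exp (2 T)] plus
    [exp (2 T)]. *)
Lemma disc_volume_le r' T : 0 < r' -> r' <= r / 2 ->
  I (fun x => \1_(disc a r') x * expR (2 * v x)) <= W T + expR (2 * T) * (pi * r' ^+ 2).
Proof.
move=> r'0 rr'; have nd := nice_disc a r'.
apply: (@le_trans _ _ (W T + expR (2 * T) * I (\1_(disc a r')))); last first.
  by rewrite lerD2l ler_wpM2l ?expR_ge0// disc_area_le.
have nW : nice (fun x => cutoff a r x * Num.max (expR (2 * v x) - expR (2 * T)) 0).
  apply: niceM => //; apply: lbm_continuous => x.
  apply: (@continuous_max _ _ (fun x => expR (2 * v x) - expR (2 * T)) (fun=> 0) x);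
    last exact: cvg_cst.
  by apply: cvgB; [exact: continuous_expR2|exact: cvg_cst].
rewrite -planeZ// -planeD//; last exact: niceZ.
apply: le_plane.
- by apply: niceM => //; apply: lbm_continuous; exact: continuous_expR2.
- by apply: niceD => //; exact: niceZ.
move=> x; have [xd|xd] := pselect (disc a r' x); last first.
  rewrite indicE memNset// mul0r mulr0 addr0; apply: mulr_ge0.
    by case/andP: (cutoff01 a r x).
  by rewrite le_max lexx orbT.
rewrite cutoff_eq1//; last first.
  apply: lt_le_trans xd _; rewrite ler_pXn2r// nnegrE ltW// divr_gt0//.
rewrite indicE mem_set// !mul1r mulr1.
by rewrite -lerBlDr le_max lexx.
Qed.

End contraction.

(** * Integrals against the conformal measure *)

Section conformal_measure_integral.
Context {R : realType}.
Variable v : conformal_factor R.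
Local Notation I := plane_integral.
Local Notation P := (measurableTypeR R * measurableTypeR R)%type.
Local Notation nu := (conformal_measure v).
Local Notation lam := (@plane_measure R).
Let g (x : P) := (expR (2 * v x))%:E.

Import HBNNSimple.

Let g0 x : (0 <= g x)%E. Proof. by rewrite lee_fin expR_ge0. Qed.
Let mg : measurable_fun [set: P] g. Proof. exact: measurable_conformal_density. Qed.

Let density_nnsfun (h : {nnsfun P >-> R}) :
  (\int[nu]_x (h x)%:E = \int[lam]_x ((h x)%:E * g x))%E.
Proof.
transitivity (\int[nu]_x (\sum_(y \in range h) (y * \1_(h @^-1` [set y]) x)%:E))%E.
  by apply: eq_integral => x _; rewrite fimfunE -fsumEFin.
have mh y : measurable_fun [set: P] (fun x => (y * \1_(h @^-1` [set y]) x)%:E).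
  by apply/measurable_EFinP; apply: measurable_funM.
rewrite ge0_integral_fsum//; last by move=> y x _; exact: nnfun_muleindic_ge0.
transitivity (\int[lam]_x (\sum_(y \in range h) ((y * \1_(h @^-1` [set y]) x)%:E * g x)))%E;
    last first.
  apply: eq_integral => x _; rewrite [in RHS]fimfunE -fsumEFin//.
  by rewrite ge0_mule_fsuml// => y; exact: nnfun_muleindic_ge0.
rewrite ge0_integral_fsum//; last 2 first.
- by move=> y; exact: emeasurable_funM.
- by move=> y x _; rewrite mule_ge0// nnfun_muleindic_ge0.
apply: eq_fsbigr => y /set_mem[x _ hx].
have y0 : 0 <= y by rewrite -hx.
have my : measurable (h @^-1` [set y]) by [].
under eq_integral do rewrite EFinM.
rewrite ge0_integralZl//; last exact/measurable_EFinP.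
under [in RHS]eq_integral do rewrite EFinM -muleA.
rewrite ge0_integralZl//; last 2 first.
- by apply: emeasurable_funM => //; exact/measurable_EFinP.
- by move=> z _; rewrite mule_ge0// lee_fin.
congr (_ * _)%E; rewrite integral_indic//= setIT /conformal_measure integral_mkcond.
apply: eq_integral => z _; rewrite patchE indicE.
by case: (z \in _); rewrite ?mul1e ?mul0e.
Qed.

(** The density gives the measure of sets. The formula for integrals follows on simple functions by
    linearity and in general by monotone convergence on both sides. *)
Lemma integral_conformal_measure (f : P -> \bar R) :
  measurable_fun [set: P] f -> (forall x, 0 <= f x)%E ->
  (\int[nu]_x f x = \int[lam]_x (f x * g x))%E.
Proof.
move=> mf f0; pose h := nnsfun_approx measurableT mf.
have hc x : ((EFin \o h n) x @[n --> \oo] --> f x)%E by exact: cvg_nnsfun_approx.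
have hd x : {homo (fun n => (h n x)%:E) : m n / (m <= n)%N >-> (m <= n)%E}.
  by move=> m n mn; rewrite lee_fin; exact/lefP/nd_nnsfun_approx.
have e1 : (\int[nu]_x f x = limn (fun n => \int[nu]_x (h n x)%:E))%E.
  rewrite -(@monotone_convergence _ _ _ nu _ measurableT (fun n x => (h n x)%:E)).
  - by apply: eq_integral => x _; apply/esym/cvg_lim => //; exact: hc.
  - by move=> n; exact/measurable_EFinP.
  - by move=> n x _; rewrite lee_fin.
  - by move=> x _; exact: hd.
have e2 : (\int[lam]_x (f x * g x) = limn (fun n => \int[lam]_x ((h n x)%:E * g x)))%E.
  rewrite -(@monotone_convergence _ _ _ lam _ measurableT (fun n x => (h n x)%:E * g x)%E).
  - apply: eq_integral => x _; apply/esym/cvg_lim => //.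
    by apply: cvgeZr => //; exact: hc.
  - by move=> n; apply: emeasurable_funM => //; exact/measurable_EFinP.
  - by move=> n x _; rewrite mule_ge0// lee_fin.
  - by move=> x _ m n mn; rewrite lee_wpmul2r//; exact: hd.
rewrite e1 e2; congr (limn _); apply/funext => n; exact: density_nnsfun.
Qed.

Lemma euclidean_ball_disc (a : R * R) (r : R) : 0 < r -> euclidean_ball a r = disc a r.
Proof.
move=> r0; apply/seteqP.
have E (z : R * R) : (Num.sqrt ((z.1 - a.1) ^+ 2 + (z.2 - a.2) ^+ 2) < r) =
    ((z.1 - a.1) ^+ 2 + (z.2 - a.2) ^+ 2 < r ^+ 2).
  by rewrite -{1}(gtr0_norm r0) -sqrtr_sqr ltr_sqrt// exprn_gt0.
by split => z; rewrite /euclidean_ball /disc/= E.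
Qed.

Lemma conformal_measure_disc (a : R * R) (r : R) :
  nu (disc a r) = (I (fun x => \1_(disc a r) x * expR (2 * v x)))%:E.
Proof.
rewrite -plane_EFin; last first.
  apply: niceM; first exact: nice_disc.
  by apply: lbm_continuous; exact: continuous_expR2.
rewrite /conformal_measure integral_mkcond; apply: eq_integral => z _.
by rewrite patchE indicE; case: (z \in _); rewrite ?mul1r ?mul0r.
Qed.

Lemma square_compact (a : R * R) (r : R) : compact (square a r).
Proof. by apply: compact_setX; exact: segment_compact. Qed.

Lemma disc_sub_square (a : R * R) (r : R) : 0 < r -> disc a r `<=` square a r.
Proof.
move=> r0 z; rewrite /disc/= => h.
have s1 := sqr_ge0 (z.1 - a.1); have s2 := sqr_ge0 (z.2 - a.2).
have n (x : R) : x ^+ 2 < r ^+ 2 -> - r <= x <= r.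
  move=> hx; rewrite -ler_norml -(@ler_pXn2r _ 2) ?nnegrE ?normr_ge0 ?(ltW r0)//.
  by rewrite real_normK ?num_real// ltW.
have /andP[h1 h2] := n (z.1 - a.1) ltac:(lra).
have /andP[h3 h4] := n (z.2 - a.2) ltac:(lra).
by split; rewrite /= in_itv/=; lra.
Qed.

(** The curvature hypothesis concerns compact sets, hence the closed square around the disc. *)
Lemma curvature_defect_le (p : R) (a : R * R) (r : R) : 0 <= p -> 0 < r ->
  ((I (fun x => \1_(disc a r) x * curvature_defect v p x))%:E <=
  \int[nu]_(x in square a r) (`|gauss_curvature v x - 1| `^ p)%:E)%E.
Proof.
move=> p0 r0.
have lK : locally_bounded_measurable (fun x => `|gauss_curvature v x - 1| `^ p).
  apply: lbm_powR => //; apply: lbm_continuous => x.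
  by apply: cvg_norm; apply: cvgB; [exact: continuous_gauss_curvature|exact: cvg_cst].
have ms : measurable (square a r : set P) by apply: measurableX; exact: measurable_itv.
rewrite integral_mkcond integral_conformal_measure; last 2 first.
- apply/(measurable_restrictT _ _).1 => //.
  by apply/measurable_EFinP; exact: measurable_funS (proj1 lK).
- by move=> x; rewrite patchE; case: ifPn => // _; rewrite lee_fin powR_ge0.
have nn : nice (fun x => \1_(disc a r) x * curvature_defect v p x).
  by apply: niceM; [exact: nice_disc|exact: lbm_curvature_defect].
rewrite -plane_EFin//; apply: ge0_le_integral => //.
- by move=> x _; rewrite lee_fin mulr_ge0// curvature_defect_ge0.
- by apply/measurable_EFinP; exact: proj1 (proj1 nn).
- apply: emeasurable_funM => //.
  apply/(measurable_restrictT _ _).1 => //.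
  by apply/measurable_EFinP; exact: measurable_funS (proj1 lK).
move=> x _; rewrite patchE indicE; case: (boolP (x \in disc a r)) => xd.
  have -> : x \in square a r by apply/mem_set/disc_sub_square => //; exact/set_mem.
  by rewrite mul1r /curvature_defect -EFinM.
by rewrite mul0r mule_ge0//; case: ifPn => // _; rewrite lee_fin powR_ge0.
Qed.

End conformal_measure_integral.

(** * Uniform smallness of the volume of small discs *)

Section small_discs.
Context {R : realType}.
Local Notation I := plane_integral.

Definition disc_volume (v : conformal_factor R) (a : R * R) (r : R) :=
  I (fun x => \1_(disc a r) x * expR (2 * v x)).

(* Each of the approximations made in one contraction step costs a factor [gam]: five
   of them are absorbed, and the sixth is the contraction rate. *)
Lemma exists_growth_factor (La : R) : 0 < La < 4 * pi ->
  exists2 gam, 1 < gam & gam ^+ 6 * La = 4 * pi.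
Proof.
move=> /andP[La0 Lapi]; have pi0 := pi_gt0 R.
exists (expR (ln (4 * pi / La) / 6)).
  by rewrite expR_gt1 divr_gt0// ln_gt0// ltr_pdivlMr// mul1r.
rewrite -expRM_natl.
have -> : 6%:R * (ln (4 * pi / La) / 6) = ln (4 * pi / La) by field.
by rewrite lnK ?posrE ?divr_gt0 ?mulr_gt0// divfK// gt_eqF.
Qed.

Lemma annulus_volume (v : conformal_factor R) (a : R * R) (r : R) : 
  I (fun x => annulus a r x * expR (2 * v x)) =
  disc_volume v a r - disc_volume v a (r / 2).
Proof.
have n s : nice (fun x => \1_(disc a s) x * expR (2 * v x)).
  by apply: niceM; [exact: nice_disc|apply: lbm_continuous; exact: continuous_expR2].
rewrite /disc_volume -planeB//; congr plane_integral; apply/funext => x.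
by rewrite /annulus mulrBl.
Qed.

(** The order of the quantifiers is the point: [eta] does not depend on [r], and [r'] and [delta]
    depend neither on the centre nor on [v]. Thus [r] can be chosen after [eta] to make the annulus
    small, and [r'] serves a whole sequence. *)
Lemma disc_volume_vanishing (p La eps : R) : 1 < p -> 0 < La < 4 * pi -> 0 < eps ->
  exists2 eta, 0 < eta & forall r, 0 < r -> exists r' delta,
    [/\ 0 < r', 0 < delta & forall (a : R * R) (v : conformal_factor R),
      disc_volume v a r <= La ->
      disc_volume v a r - disc_volume v a (r / 2) <= eta ->
      I (fun x => \1_(disc a r) x * curvature_defect v p x) <= delta ->
      disc_volume v a r' <= eps].
Proof.
move=> p1 La4 eps0; have [gam gam1 gam6] := exists_growth_factor La4.
have /andP[La0 _] := La4; have pi0 := pi_gt0 R.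
have gam0 : 0 < gam := lt_trans ltr01 gam1.
have gi0 : 0 < gam^-1 by rewrite invr_gt0.
have gi1 : gam^-1 < 1 by rewrite invf_lt1.
have g1 : 0 < gam - 1 by rewrite subr_gt0.
(* [H] and [tau] solve [exp (12 H) = gam] and [1 - exp (- 2 tau) = 1 / gam]. *)
pose H := ln gam / 12.
have H0 : 0 < H by rewrite divr_gt0// ln_gt0.
have gamH : expR (12 * H) = gam.
  by rewrite /H mulrC divfK ?lnK ?posrE.
pose tau := - ln (1 - gam^-1) / 2.
have tau0 : 0 < tau.
  rewrite divr_gt0// oppr_gt0 ln_lt0// subr_gt0 gi1/=.
  by rewrite gtrBl.
have gamtau : 1 - expR (- (2 * tau)) = gam^-1.
  have -> : - (2 * tau) = ln (1 - gam^-1) by rewrite /tau; field.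
  by rewrite lnK ?posrE ?subr_gt0// opprB addrC subrK.
pose s := (gam - 1) * gam * La / 2.
have s0 : 0 < s by rewrite divr_gt0// !mulr_gt0.
pose kap := ((gam - 1) `^ (p - 1))^-1.
have kap0 : 0 < kap by rewrite invr_gt0 powR_gt0.
pose growth := gam * (8 * pi + 1) / (4 * pi) / (1 - gam^-1).
have growth0 : 0 < growth.
  apply: divr_gt0; last by rewrite subr_gt0.
  apply: divr_gt0; last exact: mulr_gt0.
  by apply: mulr_gt0 => //; have := pi0; lra.
(* A third of [eps] goes to the annulus, a third to the geometric decay after [n] iterations, and a
   third to the term [exp (2 T) pi r'^2]. *)
exists (eps / (3 * growth)) => [|r r0]; first by rewrite divr_gt0// mulr_gt0.
have [n Hn] := expr_unbounded (3 * La / eps) gam1.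
have gn0 : 0 < gam ^+ n by rewrite exprn_gt0.
have Hn' : gam^-1 ^+ n * La <= eps / 3.
  rewrite exprVn mulrC ler_pdivrMr//.
  move: Hn; rewrite ler_pdivrMr// => h; lra.
pose C := cutoff_bound r.
have C0 : 0 < C.
  by rewrite /C /cutoff_bound addr_gt0// divr_gt0// exprn_gt0.
(* The value of [exp (- 2 t0)]; the two entries are what [t0s] and [t0C] demand. *)
pose x0 := Num.min (s / (2 * (C * La))) ((gam - 1) / (gam * C ^+ 2 * La)).
have C20 : 0 < C ^+ 2 by rewrite exprn_gt0.
have x00 : 0 < x0.
  by rewrite lt_min; apply/andP; split; rewrite divr_gt0// !mulr_gt0.
pose t0 := - ln x0 / 2.
have et0 : expR (- (2 * t0)) = x0.
  have -> : - (2 * t0) = ln x0 by rewrite /t0; field.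
  by rewrite lnK ?posrE.
have t0s : C * expR (- (2 * t0)) * La <= s / 2.
  rewrite et0 mulrAC.
  have : x0 <= s / (2 * (C * La)) by rewrite ge_min lexx.
  rewrite ler_pdivlMr ?mulr_gt0// => h; lra.
have t0C : gam / (gam - 1) * C ^+ 2 * (expR (- (2 * t0)) * La) <= 1.
  rewrite et0.
  have : x0 <= (gam - 1) / (gam * C ^+ 2 * La) by rewrite ge_min lexx orbT.
  rewrite ler_pdivlMr ?mulr_gt0// => h.
  have -> : gam / (gam - 1) * C ^+ 2 * (x0 * La) = x0 * (gam * C ^+ 2 * La) / (gam - 1).
    by field; rewrite gt_eqF.
  by rewrite ler_pdivrMr// mul1r.
pose T := t0 - tau + n%:R * (6 * H + tau).
pose e := expR (2 * T); have e0 : 0 < e by exact: expR_gt0.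
pose r' := Num.min (r / 2) (Num.sqrt (eps / (3 * pi * e))).
have q0 : 0 < eps / (3 * pi * e) by rewrite divr_gt0// !mulr_gt0.
have r'0 : 0 < r' by rewrite lt_min divr_gt0//= sqrtr_gt0.
exists r', (s / (2 * kap)); split => //; first by rewrite divr_gt0// mulr_gt0.
move=> a v vol ann defect.
have rr' : r' <= r / 2 by rewrite ge_min lexx.
have defect' : kap * I (fun x => \1_(disc a r) x * curvature_defect v p x) <= s / 2.
  move: defect; rewrite ler_pdivlMr ?mulr_gt0// => h; lra.
have it := @excess_iterate R v p a r p1 r0 gam H s tau t0 La gam1 H0 tau0 La0
  gam6 gamH gamtau erefl vol defect' t0s t0C n.
have := @disc_volume_le R v a r r0 r' T r'0 rr'.
rewrite -/(disc_volume v a r') => /le_trans; apply.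
have h1 : growth * (disc_volume v a r - disc_volume v a (r / 2)) <= eps / 3.
  have g30 : 0 < 3 * growth by rewrite (mulr_gt0 _ growth0).
  by move: ann; rewrite (ler_pdivlMr _ _ g30) => h; lra.
have h2 : e * (pi * r' ^+ 2) <= eps / 3.
  have hr : r' ^+ 2 <= eps / (3 * pi * e).
    rewrite -[leRHS]sqr_sqrtr ?(ltW q0)// ler_pXn2r ?nnegrE ?sqrtr_ge0 ?(ltW r'0)//.
    by rewrite ge_min lexx orbT.
  move: hr; rewrite ler_pdivlMr ?mulr_gt0// => h; lra.
move: it; rewrite annulus_volume -/T -/growth -/e => it.
by lra.
Qed.

End small_discs.

(** * Concentration points *)

Section liminf.
Context {R : realType}.
Local Open Scope ereal_scope.
Implicit Types (u : (\bar R)^nat) (x : \bar R).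

Lemma limn_einfE u : limn_einf u = ereal_sup (range (einfs u)).
Proof. by rewrite limn_einf_lim; apply/cvg_lim => //; exact: cvg_einfs_sup. Qed.

Lemma limn_einf_gt u x : x < limn_einf u ->
  exists N, forall n, (N <= n)%N -> x < u n.
Proof.
rewrite limn_einfE => /ereal_sup_gt[_ [N _ <-]] h; exists N => n Nn.
by apply: lt_le_trans h _; apply: ereal_inf_lbound; exists n.
Qed.

Lemma limn_einf_lt u x : limn_einf u < x ->
  forall N, exists2 n, (N <= n)%N & u n < x.
Proof.
rewrite limn_einfE => h N.
have : einfs u N < x by apply: le_lt_trans h; apply: ereal_sup_ubound; exists N.
by move=> /ereal_inf_lt[_ [n /= Nn <-]]; exists n.
Qed.

Lemma limn_einf_ge u x N : (forall n, (N <= n)%N -> x <= u n) -> x <= limn_einf u.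
Proof.
move=> h; rewrite limn_einfE; apply: (@le_trans _ _ (einfs u N)).
  by apply: le_ereal_inf_tmp => _ [n /= Nn <-]; exact: h.
by apply: ereal_sup_ubound; exists N.
Qed.

End liminf.

Section concentration.
Context {R : realType}.
Variables (p : R) (v : nat -> conformal_factor R).
Hypothesis p1 : 1 < p.
Hypothesis volume_lty : (limsup_volume v < +oo)%E.
Hypothesis curvature : forall K' : set (R * R), compact K' ->
  (\int[conformal_measure (v n)]_(x in K')
     (`|gauss_curvature (v n) x - 1| `^ p)%:E)%E @[n --> \oo] --> 0%E.
Local Notation P := (measurableTypeR R * measurableTypeR R)%type.

Lemma ball_volume n (a : R * R) (r : R) : 0 < r ->
  conformal_measure (v n) (euclidean_ball a r) = (disc_volume (v n) a r)%:E.
Proof. by move=> r0; rewrite euclidean_ball_disc// conformal_measure_disc. Qed.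

Lemma concentration_le (a : R * R) (r : R) : 0 < r ->
  (concentration v a <= limn_einf (fun n => conformal_measure (v n) (euclidean_ball a r)))%E.
Proof. by move=> r0; apply: ereal_inf_lbound; exists r. Qed.

(** If the concentration [rho] lay strictly between [0] and [4 pi], some disc would have volume
    below [La < 4 pi] and a nearly empty outer annulus for infinitely many [n]. By
    [disc_volume_vanishing] the volume of a fixed smaller disc would then be at most [rho / 2]
    infinitely often, although its lower limit is at least [rho]. *)
Lemma concentration_quantized (a : R * R) :
  (0 < concentration v a)%E -> ((4 * pi)%:E <= concentration v a)%E.
Proof.
move=> c0; rewrite leNgt; apply/negP => c4.
have [rho rhoE] : exists rho, concentration v a = rho%:E.
  exists (fine (concentration v a)); rewrite fineK// fin_numElt.
  by rewrite (lt_trans _ c0) ?ltNyr//= (lt_trans c4) ?ltry.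
rewrite rhoE !lte_fin in c0 c4.
have La4 : 0 < (rho + 4 * pi) / 2 < 4 * pi by apply/andP; split; lra.
have rho2 : 0 < rho / 2 by lra.
have [eta eta0 Heta] := disc_volume_vanishing p1 La4 rho2.
set La := (rho + 4 * pi) / 2 in La4 Heta.
(* The first entry keeps the volume of the disc below [La]. By the second, the annulus has volume
   below [eta] once the disc of half the radius has volume above [rho - eta / 2]. *)
pose d := Num.min (La - rho) (eta / 2).
have d0 : 0 < d by rewrite lt_min divr_gt0// andbT /La; lra.
have dLa : d <= La - rho by rewrite ge_min lexx.
have deta : d <= eta / 2 by rewrite ge_min lexx orbT.
have : (concentration v a < (rho + d)%:E)%E by rewrite rhoE lte_fin; lra.
move=> /ereal_inf_lt[_ [r /= r0 <-]] freq.
have [r' [delta [r'0 delta0 H]]] := Heta r r0.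
have r20 : 0 < r / 2 by lra.
have [N1 h1] : exists N, forall n, (N <= n)%N ->
    ((rho - eta / 2)%:E < conformal_measure (v n) (euclidean_ball a (r / 2)))%E.
  apply: limn_einf_gt; apply: lt_le_trans (concentration_le a r20).
  by rewrite rhoE lte_fin; lra.
have [N2 h2] : exists N, forall n, (N <= n)%N ->
    ((rho / 2)%:E < conformal_measure (v n) (euclidean_ball a r'))%E.
  apply: limn_einf_gt; apply: lt_le_trans (concentration_le a r'0).
  by rewrite rhoE lte_fin; lra.
have [N3 _ h3] : \forall n \near \oo, (\int[conformal_measure (v n)]_(x in square a r)
     (`|gauss_curvature (v n) x - 1| `^ p)%:E < delta%:E)%E.
  have := curvature (@square_compact R a r).
  move=> /(_ [set y | (y < delta%:E)%E]); apply.
  by apply: open_nbhs_nbhs; split; [exact: open_ereal_lt_ereal|rewrite /= lte_fin].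
(* The upper bound holds only for infinitely many [n], the three other estimates for all large [n];
   a single common index suffices. *)
have [n] := limn_einf_lt freq (maxn N1 (maxn N2 N3)).
rewrite !geq_max => /and3P[n1 n2 n3].
have := h1 n n1; have := h2 n n2; have := h3 n n3.
rewrite !ball_volume// !lte_fin => dn k2 k1 k0.
have defect := le_lt_trans (curvature_defect_le (v n) a (ltW (lt_trans ltr01 p1)) r0) dn.
rewrite lte_fin in defect.
have := H a (v n) _ _ (ltW defect).
by move=> /(_ ltac:(lra) ltac:(lra)); lra.
Qed.

(** The sum of the coordinate distances is used because a disc is controlled coordinatewise by its
    enclosing square. *)
Lemma separation_radius (B : seq (R * R)) : exists2 r : R, 0 < r &
  forall x y, x \in B -> y \in B -> x != y -> 4 * r <= `|x.1 - y.1| + `|x.2 - y.2|.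
Proof.
have key (x : R * R) (s : seq (R * R)) : exists2 r : R, 0 < r &
    forall y, y \in s -> x != y -> 4 * r <= `|x.1 - y.1| + `|x.2 - y.2|.
  elim: s => [|y s [r r0 IH]]; first by exists 1.
  have [xy|xy] := eqVneq x y.
    exists r => // z; rewrite inE => /predU1P[->|]; first by rewrite xy eqxx.
    exact: IH.
  have d0 : 0 < `|x.1 - y.1| + `|x.2 - y.2|.
    rewrite lt_def addr_ge0// andbT paddr_eq0// !normr_eq0 !subr_eq0.
    by apply: contra xy => /andP[/eqP h1 /eqP h2]; apply/eqP/injective_projections.
  exists (Num.min r ((`|x.1 - y.1| + `|x.2 - y.2|) / 4)).
    by rewrite lt_min r0 divr_gt0.
  move=> z; rewrite inE => /predU1P[->|zs] xz.
    by rewrite mulrC -ler_pdivlMr// ge_min lexx orbT.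
  by apply: (le_trans _ (IH z zs xz)); rewrite ler_pM2l// ge_min lexx.
suff [r r0 H] : exists2 r : R, 0 < r & forall x, x \in B -> forall y, y \in B ->
    x != y -> 4 * r <= `|x.1 - y.1| + `|x.2 - y.2| by exists r => // x y xB yB; exact: H.
elim: {1}B => [|x s [r r0 IH]]; first by exists 1.
have [r' r'0 H'] := key x B.
exists (Num.min r r') => [|z]; first by rewrite lt_min r0.
rewrite inE => /predU1P[->|zs] y yB xy.
  by apply: (le_trans _ (H' y yB xy)); rewrite ler_pM2l// ge_min lexx orbT.
by apply: (le_trans _ (IH z zs y yB xy)); rewrite ler_pM2l// ge_min lexx.
Qed.

Lemma disc_separated (x y z : R * R) (r : R) : 0 < r ->
  4 * r <= `|x.1 - y.1| + `|x.2 - y.2| -> disc x r z -> disc y r z -> False.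
Proof.
move=> r0 xy zx zy.
have [hx1 hx2] := @disc_sub_square R x r r0 z zx.
have [hy1 hy2] := @disc_sub_square R y r r0 z zy.
move: zx zy; rewrite /disc/=.
have n (w : R) (b : R) : (z.1 - w) ^+ 2 + b ^+ 2 < r ^+ 2 -> - r < z.1 - w < r.
  move=> h; rewrite -ltr_norml -(@ltr_pXn2r _ 2) ?nnegrE ?normr_ge0 ?(ltW r0)//.
  by rewrite real_normK ?num_real//; have := sqr_ge0 b; lra.
move=> /n/andP[k1 k2] /n/andP[k3 k4].
move: hx2 hy2; rewrite /= !in_itv/= => /andP[l1 l2] /andP[l3 l4].
have : `|x.1 - y.1| < 2 * r by rewrite ltr_norml; apply/andP; split; lra.
have : `|x.2 - y.2| <= 2 * r by rewrite ler_norml; apply/andP; split; lra.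
by lra.
Qed.

(** Disjoint discs around the points of [B] each have volume above [4 pi - d] for all large [n].
    Arbitrary finite families are treated because the finiteness of the set of concentration points
    is deduced from this bound. *)
Lemma concentration_count (B : {fset R * R}) :
  (forall x, x \in B -> (0 < concentration v x)%E) ->
  ((#|` B|%:R * (4 * pi))%:E <= limsup_volume v)%E.
Proof.
move=> HB; have [r r0 sep] := separation_radius B.
apply: le_trans (limn_einf_sup _).
apply/lee_addgt0Pr => e e0.
pose k : R := #|` B|%:R.
have k0 : 0 <= k by rewrite ler0n.
(* The total loss [k d] is at most [e], and the denominator is positive even for empty [B]. *)
pose d := e / (k + 1).
have d0 : 0 < d by rewrite divr_gt0// ltr_wpDl.
have kd : k * d <= e.
  by rewrite /d mulrCA ler_piMr ?(ltW e0)// ler_pdivrMr ?mul1r ?lerDl// ltr_wpDl.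
have ev (s : seq (R * R)) : {subset s <= B} -> exists N, forall n, (N <= n)%N ->
    forall x, x \in s -> 4 * pi - d < disc_volume (v n) x r.
  elim: s => [|x s IH] sB; first by exists 0%N.
  have [|N HN] := IH; first by move=> y ys; apply: sB; rewrite inE ys orbT.
  have [M HM] : exists N, forall n, (N <= n)%N ->
      ((4 * pi - d)%:E < conformal_measure (v n) (euclidean_ball x r))%E.
    apply: limn_einf_gt; apply: lt_le_trans (concentration_le x r0).
    apply: lt_le_trans (concentration_quantized _); first by rewrite lte_fin; lra.
    by apply: HB; apply: sB; rewrite inE eqxx.
  exists (maxn N M) => n; rewrite geq_max => /andP[nN nM] y.
  rewrite inE => /predU1P[->|]; last exact: HN.
  by have := HM n nM; rewrite ball_volume// lte_fin.
have [N HN] := ev B (fun x h => h).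
rewrite -leeBlDr//; apply: (@limn_einf_ge _ _ _ N) => n nN.
have D : trivIset [set` B] (fun x => disc x r : set P).
  apply/trivIsetP => x y xB yB xy; apply/seteqP; split => // z [zx zy].
  exact: (disc_separated r0 (sep x y xB yB xy) zx zy).
have mD x : measurable (disc x r : set P) by exact: disc_measurable.
have mU := @measure_fin_bigcup _ _ _ (conformal_measure (v n)) _ _
  (fun x => disc x r : set P) (finite_fset B) D (fun x _ => mD x).
have mle : (conformal_measure (v n) (\bigcup_(x in [set` B]) disc x r) <=
    conformal_measure (v n) setT)%E.
  apply: le_measure => //; apply: mem_set => //.
  by apply: fin_bigcup_measurable => // x _; exact: mD.
apply: le_trans mle; rewrite [leRHS]mU -fsbig_seq//.
have -> : (\sum_(x <- B) conformal_measure (v n) (disc x r) =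
    (\sum_(x <- B) disc_volume (v n) x r)%:E)%E.
  by rewrite -sumEFin; apply: eq_bigr => x _; rewrite conformal_measure_disc.
rewrite -EFinB lee_fin.
apply: (@le_trans _ _ (\sum_(x <- B) (4 * pi - d))); last first.
  rewrite big_seq [leRHS]big_seq; apply: ler_sum => x xB; apply/ltW; exact: HN.
rewrite big_const_seq count_predT iter_addr_0 -mulr_natl -/k; lra.
Qed.

(** An infinite set would contain finite families with too many points for the volume bound. *)
Lemma concentration_finite :
  finite_set [set x | (0 < concentration v x)%E].
Proof.
apply: contrapT => inf.
(* Counting the empty family gives nonnegativity, hence a finite value. *)
have c0 : (0 <= limsup_volume v)%E.
  by have := @concentration_count fset0 (fun x h => ltac:(by rewrite inE in h));
    rewrite cardfs0 mul0r.
have [N HN] : exists N : nat, (limsup_volume v < (N%:R * (4 * pi))%:E)%E.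
  have cf : limsup_volume v \is a fin_num by rewrite ge0_fin_numE.
  exists (Num.truncn (fine (limsup_volume v))).+1.
  rewrite -(fineK cf) lte_fin; apply: lt_le_trans (truncnS_gt _) _.
  by rewrite ler_peMr//; have := pi_ge2 R; lra.
have [B BA NB] := infinite_set_fset N inf.
have := concentration_count (fun x xB => BA x xB).
apply/negP; rewrite -ltNge; apply: lt_le_trans HN _.
by rewrite lee_fin ler_pM2r ?mulr_gt0 ?pi_gt0// ler_nat.
Qed.

End concentration.

Unset Implicit Arguments.

Theorem propositionA5 (R : realType) (p : R) (v : nat -> conformal_factor R) :
  1 < p ->
  (limsup_volume v < +oo)%E ->
  (forall K' : set (R * R), compact K' ->
     (\int[conformal_measure (v n)]_(x in K')
        (`|gauss_curvature (v n) x - 1| `^ p)%:E)%E @[n --> \oo] --> 0%E) ->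
  (forall x : R * R, (0 < concentration v x)%E ->
     ((4 * pi)%:E <= concentration v x)%E) /\
  (finite_set [set x : R * R | (0 < concentration v x)%E] /\
   ((#|` fset_set [set x : R * R | (0 < concentration v x)%E]|%:R)%:E
      <= limsup_volume v * ((4 * pi)^-1)%:E)%E).
Proof.
move=> p1 vol curv; have fin := concentration_finite p1 vol curv.
split; first by move=> x; exact: (concentration_quantized p1 curv).
split=> //; rewrite lee_pdivlMr ?mulr_gt0 ?pi_gt0// -EFinM.
apply: (concentration_count p1 curv) => x.
by rewrite in_fset_set// => /set_mem.
Qed.
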